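(* Let $d,l\ge1$, let $C$ be a $d\times d$ positive definite matrix, let $A_1,\dots,A_l$ be real $d\times d$ matrices, and let $(X_t:t\in\mathbb{Z})$ be the associated BEKK-ARCH(1) process, with representation $X_t=M_tX_{t-1}+Q_t$, $M_t=\sum_{j=1}^{l}m_{j,t}A_j$, as described in the context. Suppose that $\{A_1,\dots,A_l\}$ is simultaneously diagonalizable: there exist a non-singular real $d\times d$ matrix $P$ and real diagonal $d\times d$ matrices $D_1,\dots,D_l$ with $D_j=PA_jP^{-1}$ for $j=1,\dots,l$. Let $D_{ii,j}$ denote the $i$th diagonal element of $D_j$, and suppose that for each $i=1,\dots,d$ there exists $\alpha_i^{(Y)}>0$ such that $$\mathbb{E}\Big[\Big|\sum_{j=1}^{l}D_{ii,j}m_{j,t}\Big|^{\alpha_i^{(Y)}}\Big]=1 .$$ Then the process has an almost surely unique strictly stationary and ergodic solution $X_t=(X_{1,t},\dots,X_{d,t})'$. Moreover, let $P^{ij}$ denote element $(i,j)$ of $P^{-1}$ and, for $i\in\{1,\dots,d\}$, define the collection $\mathcal{A}_i=\{\alpha=\alpha_j^{(Y)}: j=1,\dots,d \text{ and } P^{ij}\ne0\}$. Suppose that $\alpha_i=\min\mathcal{A}_i$ has multiplicity one, i.e. there is exactly one $j\in\{1,\dots,d\}$ with $P^{ij}\neq 0$ and $\alpha_j^{(Y)}=\alpha_i$. Then $X_{i,t}$ is regularly varying with index $\alpha_i$.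
   Context: The BEKK-ARCH(1) process is $X_t=H_t^{1/2}Z_t$, $(Z_t)$ i.i.d. with $Z_t\sim N(0,I_d)$, $H_t=C+\sum_{i=1}^{l}A_iX_{t-1}X_{t-1}'A_i'$, $t\in\mathbb{Z}$. It has the stochastic recurrence representation $X_t=M_tX_{t-1}+Q_t$ with $M_t=\sum_{i=1}^{l}m_{i,t}A_i$, where the $(m_{i,t}:t\in\mathbb{Z})$, $i=1,\dots,l$, are mutually independent i.i.d. sequences of $N(0,1)$ variables and $(Q_t:t\in\mathbb{Z})$ is i.i.d. with $Q_t\sim N(0,C)$, independent of all $(m_{i,t})$; ''solution'' refers to this recurrence. A real random variable $X$ is regularly varying with index $\alpha\ge0$ if $\lim_{x\to\infty}\mathbb{P}(|X|>cx)/\mathbb{P}(|X|>x)=c^{-\alpha}$ for every $c>0$ and there are constants $p,q\ge0$ with $p+q=1$, $\lim_{x\to\infty}\mathbb{P}(X>x)/\mathbb{P}(|X|>x)=p$ and $\lim_{x\to\infty}\mathbb{P}(X\le -x)/\mathbb{P}(|X|>x)=q$. In the conclusion on $X_{i,t}$, $X_t$ is the strictly stationary solution. *)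

(* Defs.v *)
From HB Require Import structures.
From mathcomp Require Import all_boot all_order all_algebra finmap.
From mathcomp Require Import all_classical all_reals all_analysis.

Set Implicit Arguments.
Unset Strict Implicit.
Unset Printing Implicit Defensive.

Import Order.TTheory GRing.Theory Num.Theory.
Import numFieldNormedType.Exports.

Local Open Scope classical_set_scope.
Local Open Scope ring_scope.

Definition posdefmx (R : realType) (d : nat) (C : 'M[R]_d) : Prop :=
  C^T = C /\ forall u : 'cV[R]_d, u != 0 -> 0 < (u^T *m C *m u) 0 0.

(* The product of d copies of the Borel sigma-algebra of R, i.e. the Borel
   sigma-algebra of R^d. *)
Definition vec_borel (R : realType) (d : nat) : set_system 'cV[R]_d :=
  <<s \bigcup_(i : 'I_d)
        preimage_set_system setT (fun x : 'cV[R]_d => x i 0)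
          (measurable : set (set R)) >>.

(* The product sigma-algebra on (R^d)^K. *)
Definition path_borel (R : realType) (d : nat) (K : Type) :
    set_system (K -> 'cV[R]_d) :=
  <<s \bigcup_(k : K)
        preimage_set_system setT (fun x : K -> 'cV[R]_d => x k)
          (@vec_borel R d) >>.

Section Probability.
Context (dT : measure_display) (T : measurableType dT) (R : realType).
Variable Pr : probability T R.

Definition random_vector (d : nat) (Y : T -> 'cV[R]_d) : Prop :=
  forall B, vec_borel B -> measurable (Y @^-1` B).

Definition mutually_independent (K : choiceType) (F : K -> set_system T) :
    Prop :=
  forall (J : {fset K}) (E : K -> set T),
    (forall k, k \in J -> F k (E k)) ->
    Pr (\bigcap_(k in [set` J]) E k) = (\prod_(k <- J) Pr (E k))%E.

(* The laws are compared on measurable sets only: [normal_prob 0 s] and the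
   image of [Pr] need not agree as functions on arbitrary sets.  The second
   parameter of [normal_prob] is the standard deviation. *)
Definition centered_normal (s : R) (Y : T -> R) : Prop :=
  forall B : set R, measurable B -> Pr (Y @^-1` B) = normal_prob 0 s B.

(* Y ~ N(0, C) for a positive definite C: every nontrivial linear form u'Y is
   N(0, u'Cu).  The case u = 0 is left out because [normal_prob 0 0] is not the
   Dirac measure at 0. *)
Definition centered_normal_vector (d : nat) (C : 'M[R]_d) (Y : T -> 'cV[R]_d) :
    Prop :=
  forall u : 'cV[R]_d, u != 0 ->
    centered_normal (Num.sqrt ((u^T *m C *m u) 0 0))
                    (fun w => (u^T *m Y w) 0 0).

(* The indices are the (j, t) of the scalar m_{j,t} and the t of the vector
   Q_t. *)
Definition noise_sigma (d l : nat) (m : 'I_l -> int -> {RV Pr >-> R})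
    (Q : int -> T -> 'cV[R]_d) (k : 'I_l * int + int) : set_system T :=
  match k with
  | inl jt => preimage_set_system setT (m jt.1 jt.2) measurable
  | inr t => preimage_set_system setT (Q t) (@vec_borel R d)
  end.

(* The sigma-algebras of all the m_{j,t} and all the Q_t are jointly
   independent: this says at once that each (m_{j,t})_t and (Q_t)_t is an
   independent sequence and that these l + 1 sequences are independent of each
   other. *)
Record bekk_noise (d l : nat) (C : 'M[R]_d) (m : 'I_l -> int -> {RV Pr >-> R})
    (Q : int -> T -> 'cV[R]_d) : Prop := BekkNoise {
  bekk_m_normal : forall j t, centered_normal 1 (m j t);
  bekk_Q_measurable : forall t, random_vector (Q t);
  bekk_Q_normal : forall t, centered_normal_vector C (Q t);
  bekk_independent : mutually_independent (noise_sigma m Q)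
}.

Definition bekk_M (d l : nat) (A : 'I_l -> 'M[R]_d)
    (m : 'I_l -> int -> {RV Pr >-> R}) (t : int) (w : T) : 'M[R]_d :=
  \sum_(j < l) m j t w *: A j.

Definition bekk_solution (d l : nat) (A : 'I_l -> 'M[R]_d)
    (m : 'I_l -> int -> {RV Pr >-> R}) (Q X : int -> T -> 'cV[R]_d) : Prop :=
  (forall t, random_vector (X t)) /\
  (forall t, {ae Pr, forall w,
     X t w = bekk_M A m t w *m X (t - 1) w + Q t w}).

Definition strictly_stationary (d : nat) (X : int -> T -> 'cV[R]_d) : Prop :=
  forall (n : nat) (t : 'I_n -> int) (h : int) (B : set ('I_n -> 'cV[R]_d)),
    path_borel B ->
    Pr [set w | B (fun k => X (t k + h) w)] = Pr [set w | B (fun k => X (t k) w)].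

(* The law of the process on path space gives every shift-invariant event
   probability 0 or 1. *)
Definition ergodic_process (d : nat) (X : int -> T -> 'cV[R]_d) : Prop :=
  forall B : set (int -> 'cV[R]_d),
    path_borel B ->
    (fun (x : int -> 'cV[R]_d) t => x (t + 1)) @^-1` B = B ->
    Pr [set w | B (fun t => X t w)] = 0%E \/ Pr [set w | B (fun t => X t w)] = 1%E.

(* Quotients are taken in R, where y / 0 = 0; the first limit at c = 1 forces
   the denominators to be eventually nonzero. *)
Definition regularly_varying (Y : T -> R) (a : R) : Prop :=
  [/\ 0 <= a,
      forall c : R, 0 < c ->
        fine (Pr [set w | c * x < `|Y w|]) / fine (Pr [set w | x < `|Y w|])
          @[x --> +oo] --> c `^ (- a) &
      exists p q : R,
        [/\ 0 <= p, 0 <= q, p + q = 1,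
            fine (Pr [set w | x < Y w]) / fine (Pr [set w | x < `|Y w|])
              @[x --> +oo] --> p &
            fine (Pr [set w | Y w <= - x]) / fine (Pr [set w | x < `|Y w|])
              @[x --> +oo] --> q]].

End Probability.

(* The collection of the alpha_j with P^{ij} != 0, where P^{ij} is an entry of
   the inverse of P. *)
Definition tail_indices (R : realType) (d : nat) (P : 'M[R]_d)
    (alphaY : 'I_d -> R) (i : 'I_d) : set R :=
  [set alphaY j | j in [set j | invmx P i j != 0]].

(* Main.v *)
Require Import Defs.
From HB Require Import structures.
From mathcomp Require Import all_boot all_order all_algebra finmap.
From mathcomp Require Import all_classical all_reals all_analysis.
From mathcomp Require Import measurable_realfun.
From mathcomp Require Import ring lra zify.

Set Implicit Arguments.
Unset Strict Implicit.
Unset Printing Implicit Defensive.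

Import Order.TTheory GRing.Theory Num.Theory.
Import numFieldNormedType.Exports.

Local Open Scope classical_set_scope.
Local Open Scope ring_scope.

(** Why the theorem holds.  The matrix [P] diagonalizes all the multipliers at
once, so the coordinates of [Y = P X] satisfy scalar recurrences
[y t = a t * y (t - 1) + b t], in which [a t] and [b t] are centred normal
variables, independent of each other and of the past ([diag_step],
[mult_normal], [add_normal]).

Existence and uniqueness.  As [a] has moment 1 of order [alpha] and charges the
neighbourhoods of 0, its moments of lower orders are less than 1
([amoment_lt1]).  Hence the moments of products of [k] multipliers decay
geometrically, the series obtained by iterating the recurrence converges almost
surely ([rsum_ae_cvg]), and the difference of two stationary solutions, which is
such a product times a tight variable, vanishes ([bekk_solution_unique]).  The sum
of the series is a function of the noise path that commutes with time shifts.
Since the law of the noise is shift invariant, this gives stationarity, and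
since far away blocks of the noise are independent, shift invariant events
have probability 0 or 1 ([shift_invariant_01]).  The law of [Q t] is only given
through its linear forms; that these determine it is [cramer_wold].

Tail of a scalar coordinate.  Given the past, [a y + b] has the same normal law as
[a * sqrt (y ^ 2 + k2)] for a constant [k2].  So [U = y ^ 2] solves the recurrence
[U = (U + k2) * a ^ 2] in law, in which all terms are nonnegative
([square_law]).  Let [w s] be the mean of the power of order [alpha / 2] of
[min (U, exp s)].  Under the law with density [|a| ^ alpha], this function
satisfies a renewal equation with step [ln (a ^ 2)], whose mean is positive,
and with a forcing term that increases to a finite positive limit [K].  The
increments of such a [w] are bounded ([bounded_increments]).  Along a sequence on
which they approach their upper limit, they approach it along all translates too,
because they are averages of their translates up to a vanishing term and the
step charges every interval ([extremal_shift]); the same holds for the lower limit.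
Comparison with [K] shows that for increments of length [h] both limits are
close to [h * K] divided by the mean step ([extremal_increment]).  As
the increments of [w] bound the tail of [U] from both sides, [x ^ alpha P(|y| > x)]
has a positive finite limit ([renewal_tail], [perp_tail_limit]).

Conclusion.  A coordinate of [X] is a combination of coordinates of [Y].  The one
with the least exponent dominates, the others having tails of a smaller order
([perp_tail_alpha], [power_tail_add]).  The noise and its reflection
[(m, - Q)] have the same law, so the coordinates of [X] are symmetric, and both
one-sided tails are half of the tail ([power_tail_regularly_varying]). *)

(** * Independence *)

Section Cylinders.
Context (K : choiceType) (E : pointedType) (S : K -> set_system E).

Definition cylinders (I : set K) : set_system E :=
  [set B | exists J : {fset K}, exists2 F : K -> set E,
     (forall k, k \in J -> I k /\ S k (F k)) & B = \bigcap_(k in [set` J]) F k].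

Hypothesis S_T : forall k, S k setT.
Hypothesis S_I : forall k, setI_closed (S k).

Lemma cylinders_setT I : cylinders I setT.
Proof.
by exists fset0, (fun=> setT) => //; apply/seteqP; split.
Qed.

Lemma setI_closed_cylinders I : setI_closed (cylinders I).
Proof.
move=> _ _ [J1 [F1 h1 ->]] [J2 [F2 h2 ->]].
pose G (J : {fset K}) (F : K -> set E) k := if k \in J then F k else setT.
exists (J1 `|` J2)%fset, (fun k => G J1 F1 k `&` G J2 F2 k) => [k|].
  rewrite inE /G => /orP kJ; split.
    by case: kJ => [/h1[]|/h2[]].
  apply: S_I; case: ifP => //; by [move/h1 => []|move/h2 => []].
apply/seteqP; split => [x [x1 x2] k _|x xU]; rewrite /G.
  split; case: ifP => // kJ; [exact: x1|exact: x2].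
split => k /= kJ; have /= := xU k; rewrite inE kJ ?orbT/= => /(_ isT);
  by rewrite /G kJ => -[].
Qed.

Lemma g_sigma_cylindersE (I : set K) :
  <<s \bigcup_(k in I) S k >> = <<s cylinders I >>.
Proof.
apply/seteqP; split; apply: smallest_sub.
- exact: smallest_sigma_algebra.
- move=> B [k Ik SB]; apply: sub_sigma_algebra.
  exists [fset k]%fset, (fun=> B) => [j /fset1P ->//|].
  apply/seteqP; split => [x Bx j _//|x]; apply.
  by rewrite /= inE.
- exact: smallest_sigma_algebra.
- move=> _ [J [F h ->]].
  apply: (@fin_bigcap_measurable _ (g_sigma_algebraType (\bigcup_(k in I) S k))).
    exact: finite_fset.
  by move=> k /h[Ik Sk]; apply: sub_sigma_algebra; exists k.
Qed.

End Cylinders.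

Section Independence.
Context (dT : measure_display) (T : measurableType dT) (R : realType).
Variable Pr : probability T R.

(** A class of events on which a product rule holds only has to be checked on
a pi-system: both sides are finite measures in the first event. *)
Lemma product_rule_extends (G : set_system T) (B : set T) :
  setI_closed G -> G setT -> G `<=` measurable -> measurable B ->
  (forall A, G A -> Pr (A `&` B) = Pr A * Pr B)%E ->
  forall A, <<s G >> A -> Pr (A `&` B) = (Pr A * Pr B)%E.
Proof.
move=> GI GT Gm mB GB A sA.
have PB : (Pr B = (fine (Pr B))%:E) by rewrite fineK// fin_num_measure.
have PB0 : 0 <= fine (Pr B) by rewrite fine_ge0.
pose m1 := mrestr Pr mB.
pose m2 := mscale (NngNum PB0) Pr.
have m2E C : m2 C = (Pr B * Pr C)%E by rewrite /m2 /mscale/= -PB.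
rewrite muleC -m2E -[LHS]/(m1 A).
apply: (@g_sigma_algebra_measure_unique _ R T G Gm (fun=> setT)) => //.
- by rewrite bigcup_const.
- by move=> C GC; rewrite -[RHS]/(m2 C) m2E -[LHS]/(Pr (C `&` B)) GB// muleC.
- move=> _; rewrite [ltLHS](_ : _ = Pr B); last by rewrite -[LHS]/(Pr (setT `&` B)) setTI.
  by apply: le_lt_trans (probability_le1 _ mB) _; rewrite ltry.
Qed.

Context (K : choiceType) (F : K -> set_system T).
Hypothesis FT : forall k, F k setT.
Hypothesis FI : forall k, setI_closed (F k).
Hypothesis Fm : forall k, F k `<=` measurable.
Hypothesis F_ind : mutually_independent Pr F.

Lemma sub_cylinders_measurable (I : set K) : cylinders F I `<=` measurable.
Proof.
move=> _ [J [G h ->]]; apply: fin_bigcap_measurable; first exact: finite_fset.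
by move=> k /h[_]; exact: Fm.
Qed.

Lemma sub_g_sigma_measurable (I : set K) :
  <<s \bigcup_(k in I) F k >> `<=` measurable.
Proof.
apply: smallest_sub; first exact: sigma_algebra_measurable.
by move=> A [k _]; exact: Fm.
Qed.

Lemma independent_cylinders (I J : set K) A B : I `&` J = set0 ->
  cylinders F I A -> cylinders F J B -> Pr (A `&` B) = (Pr A * Pr B)%E.
Proof.
move=> IJ0 [I' [A' hA ->]] [J' [B' hB ->]].
pose G k := if k \in I' then A' k else B' k.
have dis k : k \in J' -> k \notin I'.
  move=> kJ; apply/negP => kI; suff : set0 k by [].
  by rewrite -IJ0; split; [have [] := hA _ kI|have [] := hB _ kJ].
have AE : \bigcap_(k in [set` I']) A' k = \bigcap_(k in [set` I']) G k.
  by apply: eq_bigcapr => k /= kI; rewrite /G kI.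
have BE : \bigcap_(k in [set` J']) B' k = \bigcap_(k in [set` J']) G k.
  by apply: eq_bigcapr => k /= /dis kI; rewrite /G (negbTE kI).
have FG1 k : k \in I' -> F k (G k).
  by move=> kI; rewrite /G kI; have [] := hA _ kI.
have FG2 k : k \in J' -> F k (G k).
  by move=> kJ; rewrite /G (negbTE (dis _ kJ)); have [] := hB _ kJ.
have -> : \bigcap_(k in [set` I']) A' k `&` \bigcap_(k in [set` J']) B' k =
          \bigcap_(k in [set` (I' `|` J')%fset]) G k.
  rewrite AE BE -bigcap_setU; congr (\bigcap_(k in _) G k).
  by apply/seteqP; split => k /=; rewrite inE => /orP.
rewrite F_ind; last by move=> k; rewrite inE => /orP[/FG1|/FG2].
rewrite AE BE (F_ind FG1) (F_ind FG2).
rewrite -(@big_cat _ _ mule)/=; apply: perm_big.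
apply: uniq_perm; first exact: fset_uniq.
  rewrite cat_uniq !fset_uniq andbT/=; apply/hasPn => k kJ; exact: dis.
by move=> k; rewrite inE mem_cat.
Qed.

(** The product rule is extended from cylinders first in one event, then in the
other. *)
Lemma independent_disjoint (I J : set K) A B : I `&` J = set0 ->
  <<s \bigcup_(k in I) F k >> A -> <<s \bigcup_(k in J) F k >> B ->
  Pr (A `&` B) = (Pr A * Pr B)%E.
Proof.
move=> IJ0 sA sB.
have mB := sub_g_sigma_measurable sB.
rewrite g_sigma_cylindersE// in sA; rewrite g_sigma_cylindersE// in sB.
apply: (product_rule_extends _ _ _ _ _ sA) => //.
- exact: setI_closed_cylinders.
- exact: cylinders_setT.
- exact: sub_cylinders_measurable.
- move=> A' cA'; rewrite setIC muleC.
  apply: (product_rule_extends _ _ _ _ _ sB) => //.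
  + exact: setI_closed_cylinders.
  + exact: cylinders_setT.
  + exact: sub_cylinders_measurable.
  + exact: sub_cylinders_measurable cA'.
  + by move=> B' cB'; rewrite setIC muleC; apply: independent_cylinders cA' cB'.
Qed.

End Independence.

Section JointLaw.
Context (dT : measure_display) (T : measurableType dT) (R : realType).
Variable Pr : probability T R.

(** Independence makes the two laws agree on cylinders, which form a
pi-system. *)
Lemma eq_joint_law (K : choiceType) (E : pointedType) (S : K -> set_system E)
    (N N' : T -> E) :
  (forall k, sigma_algebra setT (S k)) ->
  (forall k, preimage_set_system setT N (S k) `<=` measurable) ->
  (forall k, preimage_set_system setT N' (S k) `<=` measurable) ->
  mutually_independent Pr (fun k => preimage_set_system setT N (S k)) ->
  mutually_independent Pr (fun k => preimage_set_system setT N' (S k)) ->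
  (forall k B, S k B -> Pr (N @^-1` B) = Pr (N' @^-1` B)) ->
  forall B, <<s \bigcup_k S k >> B -> Pr (N @^-1` B) = Pr (N' @^-1` B).
Proof.
move=> sS mN mN' iN iN' NN' B sB.
have ST k : S k setT.
  by have [h0 hD _] := sS k; have := hD _ h0; rewrite setTD setC0.
have SI k : setI_closed (S k).
  by have := sS k => /sigma_algebraP[] //= _ _ _ ->.
have sBm : forall M : T -> E,
    (forall k, preimage_set_system setT M (S k) `<=` measurable) ->
    measurable_fun setT (M : T -> g_sigma_algebraType (\bigcup_k S k)).
  move=> M mM; apply: (@measurability _ _ _ (g_sigma_algebraType (\bigcup_k S k)) _ _ (\bigcup_k S k)) => //.
  move=> _ [A [k _ SA] <-]; apply: (mM k); by exists A.
have mN1 := sBm _ mN; have mN'1 := sBm _ mN'.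
pose ST' := g_sigma_algebraType (\bigcup_k S k).
pose n1 : {mfun T >-> ST'} := HB.pack (N : T -> ST') (isMeasurableFun.Build _ _ _ _ _ mN1).
pose n2 : {mfun T >-> ST'} := HB.pack (N' : T -> ST') (isMeasurableFun.Build _ _ _ _ _ mN'1).
have sG := g_sigma_cylindersE S setT.
have -> : Pr (N @^-1` B) = distribution Pr n1 B by [].
have -> : Pr (N' @^-1` B) = distribution Pr n2 B by [].
apply: (@measure_unique _ R ST' (cylinders S setT) (fun=> setT)).
- exact: sG.
- exact: setI_closed_cylinders.
- by move=> _; exact: cylinders_setT.
- by rewrite bigcup_const.
- move=> _ [J [F h ->]].
  rewrite -[LHS]/(Pr (N @^-1` _)) -[RHS]/(Pr (N' @^-1` _)) !preimage_bigcap.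
  rewrite iN; last first.
    by move=> k /h[_ SF]; exists (F k) => //; rewrite setTI.
  rewrite iN'; last first.
    by move=> k /h[_ SF]; exists (F k) => //; rewrite setTI.
  rewrite !big_seq; apply: eq_bigr => k /h[_ SF]; exact: NN' SF.
- by move=> _; rewrite /= probability_setT ltry.
- exact: sB.
Qed.

Context d1 d2 (E1 : measurableType d1) (E2 : measurableType d2).

(** By independence the joint law is a product measure, to which the theorem of
Tonelli applies. *)
Lemma integral_independent (X : {RV Pr >-> E1}) (Y : {RV Pr >-> E2})
    (h : E1 * E2 -> \bar R) :
  (forall A B, measurable A -> measurable B ->
     Pr (X @^-1` A `&` Y @^-1` B) = (Pr (X @^-1` A) * Pr (Y @^-1` B))%E) ->
  measurable_fun setT h -> (forall z, 0 <= h z)%E ->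
  (\int[Pr]_w h (X w, Y w) = \int[Pr]_w \int[Pr]_w' h (X w, Y w'))%E.
Proof.
move=> ind mh h0.
have mXY : measurable_fun setT (fun w => (X w, Y w)).
  by apply/measurable_fun_pairP; split; exact: measurable_funPT.
pose XY : {mfun T >-> (E1 * E2)%type} :=
  HB.pack (fun w => (X w, Y w)) (isMeasurableFun.Build _ _ _ _ _ mXY).
have -> : (\int[Pr]_w h (X w, Y w) = \int[distribution Pr XY]_z h z)%E.
  by rewrite ge0_integral_distribution.
have FT := fubini_tonelli1 (m1 := distribution Pr X) (m2 := distribution Pr Y) h mh h0.
transitivity (\int[distribution Pr X]_x fubini_F (distribution Pr Y) h x)%E.
  rewrite -FT; apply: eq_measure_integral => /= A mA _.
  by apply/esym/product_measure_unique.
rewrite ge0_integral_distribution//.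
- apply: eq_integral => w _ /=; rewrite /fubini_F ge0_integral_distribution//.
  by apply: measurableT_comp => //; exact: measurable_pair1.
- exact: measurable_fun_fubini_tonelli_F.
- by move=> x; exact: integral_ge0.
Qed.

End JointLaw.

(** * Integrals and almost sure statements *)

Section DominatedConvergence.
Context (dT : measure_display) (T : measurableType dT) (R : realType).
Variable mu : {measure set T -> \bar R}.

Lemma integrable_le (f g : T -> R) : measurable_fun setT f ->
  mu.-integrable setT (EFin \o g) -> (forall x, `|f x| <= g x) ->
  mu.-integrable setT (EFin \o f).
Proof.
move=> mf ig fg; apply: le_integrable ig => //; first exact/measurable_EFinP.
by move=> x _ /=; rewrite lee_fin (le_trans (fg x))// ler_norm.
Qed.

Lemma integrable_add (f g : T -> R) :
  mu.-integrable setT (EFin \o f) -> mu.-integrable setT (EFin \o g) ->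
  mu.-integrable setT (EFin \o (fun x => f x + g x)).
Proof. by move=> jf jg; exact: (integrableD measurableT jf jg). Qed.

Lemma integrable_sub (f g : T -> R) :
  mu.-integrable setT (EFin \o f) -> mu.-integrable setT (EFin \o g) ->
  mu.-integrable setT (EFin \o (fun x => f x - g x)).
Proof. by move=> jf jg; exact: (integrableB measurableT jf jg). Qed.

Lemma integrable_scale (c : R) (f : T -> R) :
  mu.-integrable setT (EFin \o f) ->
  mu.-integrable setT (EFin \o (fun x => c * f x)).
Proof. by move=> jf; exact: (integrableZl measurableT c jf). Qed.

Lemma integrable_norm (f : T -> R) :
  mu.-integrable setT (EFin \o f) ->
  mu.-integrable setT (EFin \o (fun x => `|f x|)).
Proof. by move=> jf; exact: (integrable_abse jf). Qed.

Lemma Rintegral_dominated_cvg (f_ : nat -> T -> R) (f g : T -> R) :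
  (forall n, measurable_fun setT (f_ n)) -> measurable_fun setT f ->
  mu.-integrable setT (EFin \o g) ->
  (forall n x, `|f_ n x| <= g x) ->
  (forall x, f_ n x @[n --> \oo] --> f x) ->
  (\int[mu]_x f_ n x)%R @[n --> \oo] --> (\int[mu]_x f x)%R.
Proof.
move=> mf_ mf ig fg ff.
have [] := @dominated_convergence _ _ R mu setT measurableT
  (fun n => EFin \o f_ n) (EFin \o f) (EFin \o g).
- by move=> n; exact/measurable_EFinP.
- exact/measurable_EFinP.
- by apply/aeW => x _; apply: cvg_EFin; [exact: nearW|exact: ff].
- exact: ig.
- by apply/aeW => x n _ /=; rewrite lee_fin.
move=> If _ cv; apply: fine_cvg; rewrite fineK//.
exact: (integrable_fin_num measurableT If).
Qed.

(** Dominated convergence, applied to the positive parts of [f_ n - f]. *)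
Lemma Rintegral_limsup_le (f_ : nat -> T -> R) (f g : T -> R) :
  (forall n, measurable_fun setT (f_ n)) ->
  mu.-integrable setT (EFin \o g) -> mu.-integrable setT (EFin \o f) ->
  (forall n x, `|f_ n x| <= g x) ->
  (forall x (e : R), 0 < e -> \forall n \near \oo, f_ n x <= f x + e) ->
  forall e, 0 < e ->
    \forall n \near \oo, (\int[mu]_x f_ n x)%R <= (\int[mu]_x f x)%R + e.
Proof.
move=> mf_ ig jf fg ff e e0.
have mf : measurable_fun setT f by move/integrableP : jf => [/measurable_EFinP].
pose h n x := Num.max (f_ n x - f x) 0.
have mh n : measurable_fun setT (h n).
  by apply: measurable_maxr => //; exact: measurable_funB.
have hg n x : `|h n x| <= g x + `|f x|.
  rewrite /h ger0_norm ?le_max ?lexx ?orbT// ge_max.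
  rewrite addr_ge0 ?andbT//; last exact: le_trans (normr_ge0 _) (fg n x).
  by rewrite (le_trans (ler_norm _))// (le_trans (ler_normB _ _))// lerD2r.
have ih n : mu.-integrable setT (EFin \o h n).
  apply: (@integrable_le _ (fun x => g x + `|f x|)) => //.
  by apply: integrable_add => //; exact: integrable_norm.
have : (\int[mu]_x h n x)%R @[n --> \oo] --> (\int[mu]_x (cst 0 x))%R.
  apply: (@Rintegral_dominated_cvg _ _ (fun x => g x + `|f x|)) => //.
    by apply: integrable_add => //; exact: integrable_norm.
  move=> x; apply/cvgrPdist_le => z z0; near=> n.
  rewrite sub0r normrN /h ger0_norm ?le_max ?lexx ?orbT// ge_max (ltW z0) andbT.
  by rewrite lerBlDl; near: n; exact: ff.
rewrite Rintegral_cst// mul0r => /cvgrPdist_le/(_ e e0) hc.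
near=> n.
have hn : `|0 - (\int[mu]_x h n x)%R| <= e by near: n.
have if_ : mu.-integrable setT (EFin \o f_ n) by exact: integrable_le ig (fg n).
apply: le_trans (_ : _ <= (\int[mu]_x (f x + h n x))%R) _.
  apply: le_Rintegral => //; first exact: integrable_add.
  by move=> x _; rewrite -lerBlDl /h le_max lexx.
rewrite RintegralD// lerD2l; apply: le_trans hn.
by rewrite sub0r normrN ler_norm.
Unshelve. all: by end_near. Qed.

End DominatedConvergence.

Section ProbabilitySpace.
Context (dT : measure_display) (T : measurableType dT) (R : realType).
Variable Pr : probability T R.

Lemma measurable_gtr (f : T -> R) x : measurable_fun setT f ->
  measurable [set w | x < f w].
Proof.
move=> mf; have := mf measurableT `]x, +oo[%classic (measurable_itv _).
rewrite setTI; congr measurable; apply/seteqP; split => w /=; by rewrite in_itv/= andbT.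
Qed.

Lemma measurable_sum_cond (I : Type) (r : seq I) (p : pred I) (F : I -> T -> R) :
  (forall j, measurable_fun setT (F j)) ->
  measurable_fun setT (fun w => \sum_(j <- r | p j) F j w).
Proof.
move=> mF; rewrite (_ : (fun w => _) = (fun w => \sum_(j <- r) if p j then F j w else 0)).
  by apply: measurable_sum => j; case: (p j) => //; exact: measurable_cst.
by apply/funext => w; rewrite big_mkcond.
Qed.

Lemma bounded_integrable (f : T -> R) M : measurable_fun setT f ->
  (forall w, `|f w| <= M) -> Pr.-integrable setT (EFin \o f).
Proof.
move=> mf fM; apply: (@integrable_le _ _ _ _ _ (cst M)) => //.
apply/integrableP; split; first exact/measurable_EFinP.
rewrite /= (_ : (fun w : T => _) = (cst `|M|%:E)); last by apply/funext.
by rewrite integral_cst//= probability_setT mule1 ltry.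
Qed.

Lemma eq_law_integral (Y Y' : T -> R) (f : R -> \bar R) :
  measurable_fun setT Y -> measurable_fun setT Y' ->
  (forall B, measurable B -> Pr (Y @^-1` B) = Pr (Y' @^-1` B)) ->
  measurable_fun setT f -> (forall x, 0 <= f x)%E ->
  (\int[Pr]_w f (Y w) = \int[Pr]_w f (Y' w))%E.
Proof.
move=> mY mY' eqYY' mf f0.
pose Y1 : {mfun T >-> R} := HB.pack Y (isMeasurableFun.Build _ _ _ _ _ mY).
pose Y2 : {mfun T >-> R} := HB.pack Y' (isMeasurableFun.Build _ _ _ _ _ mY').
rewrite -[LHS](@ge0_integral_distribution _ _ _ _ _ Pr Y1 f)//.
rewrite -[RHS](@ge0_integral_distribution _ _ _ _ _ Pr Y2 f)//.
by apply: eq_measure_integral => B mB _; exact: eqYY'.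
Qed.

Lemma Rintegral_gt0 (f : T -> R) : Pr.-integrable setT (EFin \o f) ->
  (forall x, 0 <= f x) -> (0 < Pr [set x | (0 < f x)%R])%E ->
  0 < (\int[Pr]_x f x)%R.
Proof.
move=> If f0 Pf; rewrite lt_neqAle Rintegral_ge0// ?andbT.
apply/eqP => I0; have mf : measurable_fun setT f.
  by apply/measurable_EFinP; case/integrableP : If.
have : (\int[Pr]_x `|(f x)%:E| = 0)%E.
  rewrite -[RHS]/(0%R%:E) I0 /Rintegral fineK ?integrable_fin_num//.
  by apply: eq_integral => x _; rewrite gee0_abs ?lee_fin.
move=> /(ae_eq_integral_abs Pr measurableT); case.
  exact/measurable_EFinP.
move=> N [mN N0 hN]; have : (Pr [set x | (0 < f x)%R] <= 0)%E.
  rewrite -N0; apply: le_measure; rewrite ?inE//; first exact: measurable_gtr.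
  move=> x /= fx; apply: hN => /= /(_ I) [fx0].
  by rewrite fx0 ltxx in fx.
by rewrite leNgt Pf.
Qed.

Lemma le_measure_ae (A B : set T) : measurable A -> measurable B ->
  {ae Pr, forall w, A w -> B w} -> (Pr A <= Pr B)%E.
Proof.
move=> mA mB [N [mN N0 hN]].
apply: (@le_trans _ _ (Pr (B `|` N))).
  apply: le_measure; rewrite ?inE//; first exact: measurableU.
  move=> w Aw; have [Bw|nBw] := pselect (B w); [by left|right].
  by apply: hN => /= /(_ Aw).
have PN : (Pr N <= 0)%E by rewrite le_eqVlt; apply/orP; left; apply/eqP.
by apply: le_trans (measureU2 _ mB mN) _; rewrite -[leRHS]adde0; exact: leeD.
Qed.

Lemma eq_measure_ae (A B : set T) : measurable A -> measurable B ->
  {ae Pr, forall w, A w <-> B w} -> Pr A = Pr B.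
Proof.
move=> mA mB AB; apply/eqP; rewrite eq_le; apply/andP; split; apply: le_measure_ae => //;
  by apply: filterS AB => w [].
Qed.

End ProbabilitySpace.

(** * Renewal theory *)

Section BoundedIncrements.
Context (R : realType).
Variables (w : R -> R) (K C0 lam gam rho : R).
Hypothesis w_nd : forall x y, x <= y -> w x <= w y.
Hypothesis w_ge0 : forall x, 0 <= w x.
Hypotheses (K0 : 0 <= K) (C00 : 0 <= C0) (lam0 : 0 < lam) (gam0 : 0 < gam).
Hypotheses (rho0 : 0 <= rho) (rho1 : rho < 1).
Hypothesis w_left : forall t, t <= 0 -> w (t + 1) - w t <= C0 * expR (gam * t).
Hypothesis w_growth : forall e : R, 0 < e -> e <= gam ->
  exists C, forall t, w (t + 1) - w t <= C * expR (e * t).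
Hypothesis w_step : forall a b, 0 <= a -> 0 <= b ->
  (forall y, w y <= a + b * expR (lam * y)) ->
  forall t, w t <= K + a + b * rho * expR (lam * t).

Let el1 : 0 < expR lam - 1. Proof. by rewrite subr_gt0 expR_gt1. Qed.

Lemma increment_iter e C : 0 < e -> e <= lam -> 0 <= C ->
  (forall t, w (t + 1) - w t <= C * expR (e * t)) ->
  forall t (k : nat), w (t + k%:R) - w t <=
    C * expR (e * t) * (expR (lam * k%:R) / (expR lam - 1)).
Proof.
move=> e0 el C_0 hC t; elim=> [|k IH].
  rewrite addr0 subrr; apply: mulr_ge0; first by rewrite mulr_ge0 ?expR_ge0.
  by rewrite divr_ge0 ?expR_ge0// ltW.
have -> : w (t + k.+1%:R) - w t =
    (w (t + k%:R + 1) - w (t + k%:R)) + (w (t + k%:R) - w t).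
  by rewrite -natr1 addrA; ring.
apply: le_trans (lerD (hC _) IH) _.
have -> : expR (lam * k.+1%:R) / (expR lam - 1) =
    expR (lam * k%:R) + expR (lam * k%:R) / (expR lam - 1).
  rewrite -natr1 mulrDr mulr1 expRD.
  by field; rewrite gt_eqF.
rewrite [leRHS]mulrDr lerD2r mulrDr expRD -!mulrA.
rewrite ler_wpM2l// ler_wpM2l ?expR_ge0// ler_expR.
by rewrite ler_wpM2r.
Qed.

Lemma w_step_iter n a b : 0 <= a -> 0 <= b ->
  (forall y, w y <= a + b * expR (lam * y)) ->
  forall t, w t <= K *+ n + a + b * rho ^+ n * expR (lam * t).
Proof.
move=> a0 b0 h; elim: n => [|n IH] t; first by rewrite mulr0n add0r expr0 mulr1.
have := w_step _ _ IH t; rewrite mulrSr exprS => /(_ _ _)/le_trans; apply.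
- by rewrite addr_ge0// mulrn_wge0.
- by rewrite mulr_ge0// exprn_ge0.
- by apply/eqP/eqP; rewrite le_eqVlt; apply/orP; left; apply/eqP; ring.
Qed.

(** The hypothesis [w_step] is the renewal equation tested against exponential
bounds.  Iterating it [n] times turns a bound [C e^(e t)] on the increments into
[K *+ n + 1/2 C e^(e t)], which is better than the former as soon as [C] is
large.  So the best constant [C] is bounded independently of [e], and [e] may
tend to 0. *)
Lemma bounded_increments : exists B : R, 0 <= B /\ forall t, w (t + 1) - w t <= B.
Proof.
pose q n := expR lam / (expR lam - 1) * expR lam * rho ^+ n.
(* [n] steps of the recurrence halve the exponential part of a bound. *)
have [n qn] : exists n, q n <= 2^-1.
  have : q n @[n --> \oo] --> expR lam / (expR lam - 1) * expR lam * 0.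
    by apply: cvgMr; apply: cvg_expr; rewrite ger0_norm.
  rewrite mulr0 => /cvgrPdist_lt/(_ 2^-1); rewrite invr_gt0 ltr0n => /(_ isT).
  move=> [N _ /(_ N (leqnn N))] /=; rewrite sub0r normrN => /ltW qN.
  by exists N; apply: le_trans (ler_norm _) qN.
have q0 : 0 <= q n.
  by rewrite /q !mulr_ge0 ?expR_ge0 ?exprn_ge0// invr_ge0 ltW.
pose B := Num.max C0 (K *+ n *+ 2); exists B.
have B0 : 0 <= B by rewrite /B le_max C00.
split => // t.
have improve e C : 0 < e -> e <= lam -> 0 <= C ->
    (forall t, w (t + 1) - w t <= C * expR (e * t)) ->
    forall t, w (t + 1) - w t <= K *+ n + q n * C * expR (e * t).
  move=> e0 el C_0 hC s.
  pose b := C * expR (e * s) * (expR lam / (expR lam - 1)) * expR (- (lam * s)).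
  have b0 : 0 <= b.
    by rewrite /b !mulr_ge0 ?expR_ge0// invr_ge0 ltW.
  have /(w_step_iter n (w_ge0 s) b0) : forall y, w y <= w s + b * expR (lam * y).
    move=> y; have [ys|sy] := leP y s.
      by rewrite -[leLHS]addr0 lerD ?w_nd// mulr_ge0// expR_ge0.
    pose k := (Num.truncn (y - s)).+1.
    have yk : y <= s + k%:R.
      by rewrite -lerBlDl ltW// /k Num.Theory.truncnS_gt.
    have ky : k%:R <= y - s + 1.
      rewrite /k -natr1 lerD2r Num.Theory.truncn_le subr_ge0 ltW//.
    apply: le_trans (w_nd yk) _; rewrite -lerBlDl.
    apply: le_trans (increment_iter e0 el C_0 hC s k) _.
    rewrite /b -!mulrA; apply: ler_wpM2l => //; apply: ler_wpM2l; first exact: expR_ge0.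
    rewrite mulrC [leRHS]mulrCA; apply: ler_wpM2l; first by rewrite invr_ge0 ltW.
    rewrite -!expRD ler_expR; apply: le_trans (ler_wpM2l (ltW lam0) ky) _.
    by rewrite le_eqVlt; apply/orP; left; apply/eqP; ring.
  move=> /(_ (s + 1)); rewrite lerBlDr => /le_trans; apply.
  rewrite mulrDr mulr1 expRD /b /q.
  have := expRxMexpNx_1 (lam * s).
  move: (expR (lam * s)) (expR (- (lam * s))) => x y xy.
  rewrite le_eqVlt; apply/orP; left; apply/eqP.
  transitivity (K *+ n + w s + C * expR (e * s) * (expR lam / (expR lam - 1)) *
    (x * y) * rho ^+ n * expR lam); first by ring.
  by rewrite xy; ring.
have bound e : 0 < e -> e <= lam -> e <= gam ->
    forall t, w (t + 1) - w t <= B * expR (e * t).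
  move=> e0 el eg.
  have [C hC] := w_growth e0 eg.
  have D0 s : 0 <= w (s + 1) - w s by rewrite subr_ge0 w_nd// lerDl.
  pose A := range (fun s => (w (s + 1) - w s) * expR (- (e * s))).
  have E s : (w (s + 1) - w s) * expR (- (e * s)) * expR (e * s) = w (s + 1) - w s.
    by rewrite -mulrA [X in _ * X]mulrC expRxMexpNx_1 mulr1.
  have Aub : has_ubound A.
    exists C => _ [s _ <-]; rewrite -(@ler_pM2r _ (expR (e * s))) ?expR_gt0//.
    by rewrite E.
  have supA s : w (s + 1) - w s <= sup A * expR (e * s).
    rewrite -{1}E ler_wpM2r ?expR_ge0//; apply: ub_le_sup => //.
    by exists s.
  have supA0 : 0 <= sup A.
    have := le_trans (D0 0) (supA 0); rewrite mulr0 expR0 mulr1//.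
  have supAB : sup A <= B.
    have : sup A <= Num.max B ((B + sup A) / 2).
      apply: ge_sup; first by exists ((w (0 + 1) - w 0) * expR (- (e * 0))), 0.
      move=> _ [s _ <-]; rewrite -(@ler_pM2r _ (expR (e * s))) ?expR_gt0// E.
      have [s0|s0] := leP s 0.
        apply: le_trans (w_left s0) _; apply: ler_pM => //.
        - by rewrite le_max /B le_max lexx.
        - by rewrite ler_expR ler_wnM2r.
      apply: le_trans (improve e _ e0 el supA0 supA s) _.
      have e1 : 1 <= expR (e * s) by rewrite -expR0 ler_expR mulr_ge0// ltW.
      have KB : K *+ n <= B / 2.
        by rewrite ler_pdivlMr// mulr_natr /B le_max lexx orbT.
      apply: le_trans (_ : _ <= (B + sup A) / 2 * expR (e * s)) _; last first.
        by rewrite ler_wpM2r ?expR_ge0// le_max lexx orbT.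
      rewrite [(B + _) / 2]mulrDl mulrDl; apply: lerD.
        by apply: le_trans KB _; rewrite ler_peMr// divr_ge0.
      rewrite ler_wpM2r ?expR_ge0// mulrC ler_wpM2l//.
    rewrite le_max => /orP[//|]; rewrite ler_pdivlMr//; lra.
  move=> s; apply: le_trans (supA s) _.
  by rewrite ler_wpM2r// expR_ge0.
have [t0|t0] := leP t 0.
  apply: le_trans (w_left t0) _; apply: le_trans (_ : _ <= C0) _.
    by rewrite ler_piMr// -expR0 ler_expR mulr_ge0_le0// ltW.
  by rewrite /B le_max lexx.
apply/ler_addgt0Pr => z z0.
(* [e1] is chosen so that [B e^(e1 t)] is at most [B + z]. *)
pose e1 := ln (1 + z / (B + 1)) / t.
have zB : 0 < z / (B + 1) by rewrite divr_gt0// ltr_wpDl.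
have e10 : 0 < e1 by rewrite divr_gt0// ln_gt0// ltrDl.
pose e := Num.min e1 (Num.min lam gam).
have /(bound e)/(_ _ _ t) : 0 < e by rewrite !lt_min e10 lam0.
rewrite !ge_min !lexx !orbT => /(_ isT isT)/le_trans; apply.
apply: le_trans (_ : _ <= B * (1 + z / (B + 1))) _.
  rewrite ler_wpM2l// -[leRHS]lnK ?posrE; last by rewrite addr_gt0.
  rewrite ler_expR -ler_pdivlMr// -/e1 /e ge_min lexx//.
rewrite mulrDr mulr1 lerD2l mulrCA ler_piMr ?ltW//.
by rewrite ltr_pdivrMr ?mul1r ?ltrDl// ltr_wpDl.
Qed.

End BoundedIncrements.

(** Let [Z] be a probability density, under which the random walk step [L] has a
law that charges every interval, and let [w] solve
[w t = E (Z * (w (t - L) + G (t - L)))] with a forcing term [G] that increases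
to [K].  This section describes the increments [D] of [w] along a sequence [u]
along which they tend to an extreme value [S]: the upper limit of [D] if
[sg = 1], and the lower limit if [sg = -1]. *)
Section RenewalLimitPoints.
Context (dT : measure_display) (T : measurableType dT) (R : realType).
Variables (Pr : probability T R) (Z L : T -> R) (w G : R -> R) (K B : R).
Hypotheses (mZ : measurable_fun setT Z) (mL : measurable_fun setT L).
Hypothesis Z0 : forall x, 0 <= Z x.
Hypothesis iZ : Pr.-integrable setT (EFin \o Z).
Hypothesis Z1 : (\int[Pr]_x Z x)%R = 1.
Hypothesis Z_support : forall s r : R, 0 < r ->
  0 < (\int[Pr]_x (Z x * (`|L x - s| < r)%R%:R))%R.
Hypothesis iZL : Pr.-integrable setT (EFin \o (fun x => Z x * L x)).
Hypothesis w_nd : forall x y, x <= y -> w x <= w y.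
Hypothesis G_nd : forall x y, x <= y -> G x <= G y.
Hypothesis iw : forall t, Pr.-integrable setT (EFin \o (fun x => Z x * w (t - L x))).
Hypotheses (G_ge0 : forall x, 0 <= G x) (G_le : forall x, G x <= K).
Hypothesis G_cvg : G t @[t --> +oo] --> K.
Hypothesis w_renew : forall t,
  w t = (\int[Pr]_x (Z x * w (t - L x)))%R + (\int[Pr]_x (Z x * G (t - L x)))%R.
Hypothesis B0 : 0 <= B.
Hypothesis w_incr : forall t, w (t + 1) - w t <= B.
Hypothesis w_unif : forall e : R, 0 < e -> exists2 r : R, 0 < r &
  forall t t', `|t - t'| < r -> `|w t - w t'| <= e.

Let mono_measurable (f : R -> R) : (forall x y, x <= y -> f x <= f y) ->
  measurable_fun setT f.
Proof. by move=> f_nd; apply: nondecreasing_measurable => // x y; exact: f_nd. Qed.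

Let mw := mono_measurable w_nd.
Let mG := mono_measurable G_nd.

Let mshift (f : R -> R) t : measurable_fun setT f ->
  measurable_fun setT (fun x => f (t - L x)).
Proof. by move=> mf; apply: measurableT_comp => //; exact: measurable_funB. Qed.

Let integrableZ (f : T -> R) M : measurable_fun setT f ->
  (forall x, `|f x| <= M) -> Pr.-integrable setT (EFin \o (fun x => Z x * f x)).
Proof.
move=> mf fM.
apply: (@integrable_le _ _ _ _ _ (fun x => M * Z x)); first exact: measurable_funM.
  exact: integrable_scale.
by move=> x; rewrite normrM ger0_norm// mulrC ler_wpM2r.
Qed.

Lemma w_incr_nat t (k : nat) : w (t + k%:R) - w t <= B *+ k.
Proof.
elim: k => [|k IH]; first by rewrite addr0 subrr.
by have := w_incr (t + k%:R); rewrite (mulrSr B) -natr1 addrA; lra.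
Qed.

Lemma w_incr_norm t s : `|w t - w (t - s)| <= B * (`|s| + 1).
Proof.
wlog s0 : t s / 0 <= s.
  move=> H; have [/H->//|s0] := leP 0 s.
  have := H (t - s) (- s); rewrite opprK subrK normrN distrC; apply.
  by rewrite oppr_ge0 ltW.
rewrite [leLHS]ger0_norm; last by rewrite subr_ge0 w_nd// gerBl.
rewrite (ger0_norm s0).
apply: le_trans (_ : _ <= w (t - s + (Num.truncn s).+1%:R) - w (t - s)) _.
  by rewrite lerD2r w_nd// -lerBlDl opprB addrCA subrr addr0 ltW// Num.Theory.truncnS_gt.
apply: le_trans (w_incr_nat _ _) _; rewrite -mulr_natr ler_wpM2l//.
by rewrite -natr1 lerD2r Num.Theory.truncn_le.
Qed.

Variable h : R.
Hypothesis h0 : 0 < h.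
Let D t := w (t + h) - w t.
Let mD : measurable_fun setT D.
Proof.
apply: measurable_funB => //; apply: measurableT_comp => //.
exact: measurable_funD.
Qed.

Let D_norm t : `|D t| <= B * (h + 1).
Proof.
by have := w_incr_norm (t + h) h; rewrite addrK (gtr0_norm h0).
Qed.

Let GD t := (\int[Pr]_x (Z x * (G (t + h - L x) - G (t - L x))))%R.

Let shiftDE t (x : T) : w (t + h - L x) - w (t - L x) = D (t - L x).
Proof. by rewrite /D; congr (w _ - _); rewrite addrAC. Qed.

Let iG t : Pr.-integrable setT (EFin \o (fun x => Z x * G (t - L x))).
Proof.
by apply: (@integrableZ _ K) => [|x]; [exact: mshift|rewrite ger0_norm].
Qed.

Let D_renew t : D t = (\int[Pr]_x (Z x * D (t - L x)))%R + GD t.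
Proof.
rewrite {1}/D (w_renew (t + h)) (w_renew t) /GD.
under [X in _ = X + _]eq_Rintegral do rewrite -shiftDE mulrBr.
under [X in _ = _ + X]eq_Rintegral do rewrite mulrBr.
by rewrite !RintegralB//; ring.
Qed.

Let GD_cvg (u : nat -> R) : u n @[n --> \oo] --> +oo ->
  GD (u n) @[n --> \oo] --> 0.
Proof.
move=> uoo.
have -> : 0 = (\int[Pr]_x (Z x * (K - K)))%R.
  by under eq_Rintegral do rewrite subrr mulr0; rewrite Rintegral_cst// mul0r.
have Gu t x : G (u n + t - L x) @[n --> \oo] --> K.
  apply: cvg_comp G_cvg; under eq_fun do rewrite -addrA.
  exact: cvg_comp uoo (cvg_addrr _).
apply: (@Rintegral_dominated_cvg _ _ _ _ _ _ (fun x => (2 * K) * Z x)) => //.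
- move=> n; apply: measurable_funM => //; apply: measurable_funB; exact: mshift.
- exact: measurable_funM.
- exact: integrable_scale.
- move=> n x; rewrite normrM ger0_norm// mulrC ler_wpM2r//.
  rewrite (le_trans (ler_normB _ _))// mulr2n mulrDl mul1r lerD// ger0_norm//.
- move=> x; apply: cvgMr; apply: cvgB; first exact: Gu.
  by have := Gu 0 x; under eq_fun do rewrite addr0.
Qed.

Variables (u : nat -> R) (S sg : R).
Hypothesis u_oo : u n @[n --> \oo] --> +oo.
Hypothesis sg1 : sg ^+ 2 = 1.
Hypothesis D_S : D (u n) @[n --> \oo] --> S.
Hypothesis S_extr : forall e : R, 0 < e -> \forall t \near +oo, sg * (D t - S) <= e.

Let u_shift t : (u n + t) @[n --> \oo] --> +oo.
Proof. exact: cvg_comp u_oo (cvg_addrr _). Qed.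

Let sg_norm : `|sg| = 1.
Proof.
by have /eqP := sg1; rewrite sqrf_eq1 => /orP[]/eqP ->; rewrite ?normrN normr1.
Qed.

Let en n x := sg * (S - D (u n - L x)).

Let men n : measurable_fun setT (en n).
Proof.
apply: measurable_funM => //; apply: measurable_funB => //.
apply: (@mshift D) => //.
Qed.

Let en_norm n x : `|en n x| <= `|S| + B * (h + 1).
Proof.
rewrite /en normrM sg_norm mul1r (le_trans (ler_normB _ _))// lerD2l.
exact: D_norm.
Qed.

(** [D (u n)] is the [Z]-mean of the [D (u n - L)], up to a vanishing term, so
the mean of [en n] tends to 0; since the lower limit of [en n] is nonnegative,
it tends to 0 in the mean as well. *)
Let L1_cvg : (\int[Pr]_x (Z x * `|en n x|))%R @[n --> \oo] --> 0.
Proof.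
pose neg n x := Num.max (- en n x) 0.
have mneg n : measurable_fun setT (neg n).
  apply: measurable_maxr => //; exact: measurableT_comp.
have neg_norm n x : `|neg n x| <= `|S| + B * (h + 1).
  rewrite ger0_norm /neg ?le_max ?lexx ?orbT// ge_max.
  rewrite (le_trans (ler_norm _)) ?normrN ?en_norm//=.
  by rewrite addr_ge0// mulr_ge0// addr_ge0// ltW.
have enE n x : Z x * `|en n x| = Z x * en n x + 2 * (Z x * neg n x).
  rewrite (mulrCA 2) -mulrDr; congr (_ * _); rewrite /neg.
  have [e0|e0] := leP 0 (en n x).
    by rewrite max_r ?oppr_le0// mulr0 addr0 ger0_norm.
  by rewrite max_l ?oppr_ge0 ?(ltW e0)// ltr0_norm//; ring.
have ien n : Pr.-integrable setT (EFin \o (fun x => Z x * en n x)).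
  exact: integrableZ (en_norm n).
have ineg n : Pr.-integrable setT (EFin \o (fun x => Z x * neg n x)).
  exact: integrableZ (neg_norm n).
have ineg2 n : Pr.-integrable setT (EFin \o (fun x => 2 * (Z x * neg n x))).
  exact: integrable_scale.
have -> : (fun n => \int[Pr]_x (Z x * `|en n x|))%R =
    (fun n => sg * (S - D (u n) + GD (u n)) + 2 * (\int[Pr]_x (Z x * neg n x))%R).
  apply/funext => n; under eq_Rintegral do rewrite enE.
  rewrite RintegralD// RintegralZl//; congr (_ + _).
  rewrite {1}(D_renew (u n)) opprD -!addrA addNr addr0.
  rewrite -[X in _ * (X - _)]mul1r -{1}Z1 -RintegralZr// -RintegralB//; last 2 first.
  - by under eq_fun do rewrite mulrC; exact: integrable_scale.
  - by apply: (@integrableZ _ (B * (h + 1))) => //; exact: mshift.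
  rewrite -RintegralZl//; last first.
    under eq_fun do rewrite -mulrBr.
    apply: (@integrableZ _ (`|S| + B * (h + 1))) => [|x].
      by apply: measurable_funB => //; exact: mshift.
    by rewrite (le_trans (ler_normB _ _))// lerD2l.
  by apply: eq_Rintegral => x _; rewrite /en; ring.
rewrite -[X in _ --> X](_ : sg * (S - S + 0) + 2 * 0 = _); last by rewrite subrr; ring.
apply: cvgD.
  apply: cvgMr; apply: cvgD; last exact: GD_cvg.
  by apply: cvgB => //; exact: cvg_cst.
apply: cvgMr.
have -> : 0 = (\int[Pr]_x (Z x * 0))%R.
  by under eq_Rintegral do rewrite mulr0; rewrite Rintegral_cst// mul0r.
apply: (@Rintegral_dominated_cvg _ _ _ _ _ _ (fun x => (`|S| + B * (h + 1)) * Z x)) => //.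
- by move=> n; apply: measurable_funM.
- exact: measurable_funM.
- exact: integrable_scale.
- by move=> n x; rewrite normrM ger0_norm// mulrC ler_wpM2r.
- move=> x; apply: cvgMr; apply/cvgrPdist_le => e e0; near=> n.
  rewrite sub0r normrN ger0_norm /neg ?le_max ?lexx ?orbT// ge_max (ltW e0) andbT.
  rewrite /en -mulrN opprB.
  near: n; exact: (u_shift (- L x)) (S_extr e0).
Unshelve. all: by end_near. Qed.

(** By [L1_cvg], [D (u n - L)] is close to [S] with a high probability, and [L] is
close to [s] with a positive one; [D] is uniformly continuous. *)
Lemma extremal_shift s : D (u n - s) @[n --> \oo] --> S.
Proof.
apply/cvgrPdist_le => e e0.
have e4 : 0 < e / 4 by rewrite divr_gt0.
have [r r0 wr] := w_unif e4.
have Dr t t' : `|t - t'| < r -> `|D t - D t'| <= e / 2.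
  move=> tt'; have -> : D t - D t' = (w (t + h) - w (t' + h)) - (w t - w t').
    by rewrite /D; ring.
  rewrite (le_trans (ler_normB _ _))//.
  have -> : e / 2 = e / 4 + e / 4 by field.
  by apply: lerD; apply: wr => //; rewrite opprD addrACA subrr addr0.
pose I x := (`|L x - s| < r)%R%:R : R.
have mI : measurable_fun setT I.
  pose A := [set x | `|L x - s| < r].
  rewrite (_ : I = \1_A); last first.
    apply/funext => x; rewrite /I indicE; congr (_%:R).
    by congr nat_of_bool; apply/idP/idP; rewrite inE.
  apply: measurable_indic.
  rewrite (_ : A = setT `&` (fun x => `|L x - s|) @^-1` `]-oo, r[%classic).
    have mf : measurable_fun setT (fun x => `|L x - s|).
      by apply: measurableT_comp => //; exact: measurable_funB.
    by apply: mf => //; exact: measurable_itv.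
  by rewrite setTI; apply/seteqP; split => x /=; rewrite in_itv.
have iI : Pr.-integrable setT (EFin \o (fun x => Z x * I x)).
  apply: (@integrableZ _ 1) => // x; rewrite /I.
  by case: (_ < _); rewrite ?normr1 ?normr0.
have c0 := Z_support s r0; set c := (X in 0 < X) in c0.
have ce : 0 < c * (e / 2) by rewrite mulr_gt0// divr_gt0.
move/cvgrPdist_le : L1_cvg => /(_ _ ce) hn.
near=> n.
have : `|0 - (\int[Pr]_x (Z x * `|en n x|))%R| <= c * (e / 2) by near: n.
rewrite sub0r normrN ger0_norm; last first.
  by apply: Rintegral_ge0 => x _; rewrite mulr_ge0.
move=> le1.
have : c * (`|S - D (u n - s)| - e / 2) <= (\int[Pr]_x (Z x * `|en n x|))%R.
  rewrite -RintegralZr//; apply: le_Rintegral => //.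
  - by under eq_fun do rewrite mulrC; exact: integrable_scale.
  - apply: (@integrableZ _ (`|S| + B * (h + 1))).
      exact: measurableT_comp.
    by move=> x; rewrite normr_id.
  move=> x _; rewrite -mulrA ler_wpM2l// /I.
  case: ltP => [Ls|_]; last by rewrite mul0r.
  rewrite mul1r lerBlDr /en normrM sg_norm mul1r.
  have -> : S - D (u n - s) = (S - D (u n - L x)) + (D (u n - L x) - D (u n - s)).
    by ring.
  rewrite (le_trans (ler_normD _ _))// lerD2l Dr//.
  by rewrite opprB addrC addrA subrK distrC.
move=> /le_trans/(_ le1); rewrite ler_pM2l// lerBlDr.
by have -> : e / 2 + e / 2 = e by field.
Unshelve. all: by end_near. Qed.

Let S0 : 0 <= S.
Proof.
apply: (cvgr_to_ge D_S); apply: nearW => n.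
by rewrite /D subr_ge0 w_nd// lerDl ltW.
Qed.

Lemma w_shift_left (k : nat) :
  w (u n) - w (u n - h *+ k) @[n --> \oo] --> S *+ k.
Proof.
elim: k => [|k IH].
  by under eq_fun do rewrite subr0 subrr; exact: cvg_cst.
have -> : (fun n => w (u n) - w (u n - h *+ k.+1)) =
   (fun n => (w (u n) - w (u n - h *+ k)) + D (u n - h *+ k.+1)).
  apply/funext => n; rewrite /D.
  have -> : u n - h *+ k.+1 + h = u n - h *+ k by rewrite mulrSr; ring.
  by ring.
by rewrite (mulrSr S); exact: cvgD IH (extremal_shift _).
Qed.

Lemma w_shift_right (k : nat) :
  w (u n + h *+ k) - w (u n) @[n --> \oo] --> S *+ k.
Proof.
elim: k => [|k IH].
  by under eq_fun do rewrite addr0 subrr; exact: cvg_cst.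
have -> : (fun n => w (u n + h *+ k.+1) - w (u n)) =
   (fun n => (w (u n + h *+ k) - w (u n)) + D (u n - (- (h *+ k)))).
  apply/funext => n; rewrite /D opprK.
  have -> : u n + h *+ k + h = u n + h *+ k.+1 by rewrite mulrSr; ring.
  by ring.
by rewrite (mulrSr S); exact: cvgD IH (extremal_shift _).
Qed.

Let near_le (a b c : R) (v : nat -> R) : v n @[n --> \oo] --> a -> a <= b -> 0 < c ->
  \forall n \near \oo, v n <= b + c.
Proof.
move=> va ab c0; have : a < b + c by rewrite (le_lt_trans ab)// ltrDl.
exact: (@cvgr_le _ _ _ _ _ _ va).
Qed.

Let near_ge (a b c : R) (v : nat -> R) : v n @[n --> \oo] --> a -> b <= a -> 0 < c ->
  \forall n \near \oo, b - c <= v n.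
Proof.
move=> va ab c0; have : b - c < a by rewrite (lt_le_trans _ ab)// gtrBl.
exact: (@cvgr_ge _ _ _ _ _ _ va).
Qed.

Let truncn_h s : 0 <= s -> h *+ Num.truncn (s / h) <= s /\
  s <= h *+ (Num.truncn (s / h)).+1.
Proof.
move=> s0; have sh : 0 <= s / h by rewrite divr_ge0// ltW.
split; rewrite -mulr_natl.
  by rewrite -ler_pdivlMr// Num.Theory.truncn_le.
by rewrite -ler_pdivrMr// ltW// Num.Theory.truncnS_gt.
Qed.

Let truncn_S s : 0 <= s -> S *+ Num.truncn (s / h) <= s / h * S /\
  s / h * S <= S *+ (Num.truncn (s / h)).+1.
Proof.
move=> s0; have sh : 0 <= s / h by rewrite divr_ge0// ltW.
rewrite -!(mulr_natl S); split; apply: ler_wpM2r => //.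
  by rewrite Num.Theory.truncn_le.
by rewrite ltW// Num.Theory.truncnS_gt.
Qed.

Let w_shift_le (s e : R) : 0 < e ->
  \forall n \near \oo, w (u n) - w (u n - s) <= (s / h + 1) * S + e.
Proof.
move=> e0; rewrite mulrDl mul1r.
have [s0|s0] := leP 0 s.
  have [_ ks] := truncn_h s0; have [kS _] := truncn_S s0.
  have cv := @w_shift_left (Num.truncn (s / h)).+1.
  apply: filterS (near_le cv (_ : _ <= s / h * S + S) e0).
    move=> n; apply: le_trans; rewrite lerD2l lerN2 w_nd// lerD2l lerN2//.
  by rewrite mulrSr lerD2r.
have s0' : 0 <= - s by rewrite oppr_ge0 ltW.
have [ks _] := truncn_h s0'; have [_ kS] := truncn_S s0'.
have cv : - (w (u n + h *+ (Num.truncn (- s / h))) - w (u n)) @[n --> \oo] --> - (S *+ (Num.truncn (- s / h))).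
  by apply: cvgN; exact: w_shift_right.
have kS' : - (S *+ Num.truncn (- s / h)) <= s / h * S + S.
  by move: kS; rewrite mulrSr !mulNr; lra.
apply: filterS (near_le cv kS' e0) => n.
rewrite opprB; apply: le_trans; rewrite lerD2l lerN2 w_nd// lerD2l; exact: ks.
Qed.

Let w_shift_ge (s e : R) : 0 < e ->
  \forall n \near \oo, (s / h - 1) * S - e <= w (u n) - w (u n - s).
Proof.
move=> e0; rewrite mulrBl mul1r.
have [s0|s0] := leP 0 s.
  have [ks _] := truncn_h s0; have [_ kS] := truncn_S s0.
  have cv := @w_shift_left (Num.truncn (s / h)).
  apply: filterS (near_ge cv (_ : s / h * S - S <= _) e0).
    by move=> n /le_trans; apply; rewrite lerD2l lerN2 w_nd// lerD2l lerN2.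
  by rewrite lerBlDr -mulrSr.
have s0' : 0 <= - s by rewrite oppr_ge0 ltW.
have [_ ks] := truncn_h s0'; have [kS _] := truncn_S s0'.
have cv : - (w (u n + h *+ (Num.truncn (- s / h)).+1) - w (u n)) @[n --> \oo] --> - (S *+ (Num.truncn (- s / h)).+1).
  by apply: cvgN; exact: w_shift_right.
have kS' : s / h * S - S <= - (S *+ (Num.truncn (- s / h)).+1).
  by move: kS; rewrite mulrSr !mulNr; lra.
apply: filterS (near_ge cv kS' e0) => n.
move=> /le_trans; apply; rewrite opprB lerD2l lerN2 w_nd// lerD2l; exact: ks.
Qed.

Let phi n x := w (u n) - w (u n - L x).

Let phi_cvg : (\int[Pr]_x (Z x * phi n x))%R @[n --> \oo] --> K.
Proof.
have -> : (fun n => \int[Pr]_x (Z x * phi n x))%R =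
    (fun n => \int[Pr]_x (Z x * G (u n - L x)))%R.
  apply/funext => n; rewrite /phi; under eq_Rintegral do rewrite mulrBr.
  rewrite RintegralB//; last first.
    by under eq_fun do rewrite mulrC; exact: integrable_scale.
  rewrite RintegralZr// Z1 mul1r {1}(w_renew (u n)); ring.
have -> : K = (\int[Pr]_x (Z x * K))%R by rewrite RintegralZr// Z1 mul1r.
apply: (@Rintegral_dominated_cvg _ _ _ _ _ _ (fun x => K * Z x)) => //.
- by move=> n; apply: measurable_funM => //; exact: mshift.
- exact: measurable_funM.
- exact: integrable_scale.
- by move=> n x; rewrite normrM ger0_norm// mulrC ler_wpM2r// ger0_norm.
- by move=> x; apply: cvgMr; apply: cvg_comp G_cvg; exact: u_shift.
Qed.

Let mphi n : measurable_fun setT (fun x => Z x * phi n x).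
Proof.
by apply: measurable_funM => //; apply: measurable_funB => //; exact: mshift.
Qed.

Let phi_norm n x : `|Z x * phi n x| <= B * (`|Z x * L x| + Z x).
Proof.
rewrite normrM (ger0_norm (Z0 x)) (le_trans (ler_wpM2l (Z0 x) (w_incr_norm _ _)))//.
by rewrite normrM (ger0_norm (Z0 x)) mulrCA mulrDr mulr1.
Qed.

Let iphi : Pr.-integrable setT (EFin \o (fun x => B * (`|Z x * L x| + Z x))).
Proof.
by apply: integrable_scale; apply: integrable_add => //; exact: integrable_norm.
Qed.

Let mean := (\int[Pr]_x (Z x * L x))%R.

Let ilin a : Pr.-integrable setT (EFin \o (fun x => Z x * ((L x / h + a) * S))).
Proof.
have -> : (fun x => Z x * ((L x / h + a) * S)) =
   (fun x => (S / h) * (Z x * L x) + (a * S) * Z x).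
  by apply/funext => x; rewrite mulrDl; ring.
by apply: integrable_add; exact: integrable_scale.
Qed.

Let lin a : (\int[Pr]_x (Z x * ((L x / h + a) * S)))%R = (mean / h + a) * S.
Proof.
under eq_Rintegral.
  move=> x _.
  have -> : Z x * ((L x / h + a) * S) = (S / h) * (Z x * L x) + (a * S) * Z x.
    by rewrite mulrDl; ring.
  over.
rewrite RintegralD//; [|exact: integrable_scale..].
by rewrite !RintegralZl// Z1 /mean; ring.
Qed.

(* The error is divided by [Z x + 1] to be at most [z] after the weighting by
   [Z x]. *)
Let weigh x a b z : 0 < z -> a <= b + z / (Z x + 1) -> Z x * a <= Z x * b + z.
Proof.
move=> z0 ab; apply: le_trans (ler_wpM2l (Z0 x) ab) _.
rewrite mulrDr lerD2l mulrCA ler_piMr ?ltW//.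
by rewrite ltr_pdivrMr ?mul1r ?ltrDl// ltr_wpDl.
Qed.

(** Splitting [w (u n) - w (u n - s)] into increments of length [h] compares
the limit [K] of the mean of this difference with the extremal increment. *)
Lemma extremal_increment : (mean - h) * S <= K * h <= (mean + h) * S.
Proof.
have z1 x z : 0 < z -> 0 < z / (Z x + 1).
  by move=> z0; rewrite divr_gt0// ltr_wpDl.
have [hK1 hK2] : (mean / h - 1) * S <= K /\ K <= (mean / h + 1) * S.
  split; apply/ler_addgt0Pr => e e0.
  - have : \forall n \near \oo, (\int[Pr]_x (- (Z x * phi n x)))%R <=
        (\int[Pr]_x (Z x * ((L x / h - 1) * - S)))%R + e.
      apply: (@Rintegral_limsup_le _ _ _ _ _ _ _ _ iphi) => //.
      + by move=> n; exact: measurableT_comp.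
      + under eq_fun do rewrite mulrN mulrN -mulN1r.
        by apply: integrable_scale; exact: ilin.
      + by move=> n x; rewrite normrN.
      + move=> x z z0; apply: filterS (w_shift_ge (L x) (z1 x z z0)) => n hn.
        rewrite -mulrN; apply: weigh => //; rewrite /phi; lra.
    have -> : (\int[Pr]_x (Z x * ((L x / h - 1) * - S)))%R = - ((mean / h - 1) * S).
      rewrite -lin -[RHS]mulN1r -RintegralZl//.
      by apply: eq_Rintegral => x _; ring.
    have : (\int[Pr]_x (- (Z x * phi n x)))%R @[n --> \oo] --> - K.
      rewrite (_ : (fun n => _) = (fun n => - (\int[Pr]_x (Z x * phi n x))%R)).
        exact: cvgN.
      apply/funext => n; rewrite -mulN1r -RintegralZl//; last first.
        exact: integrable_le (phi_norm n).
      by apply: eq_Rintegral => x _; rewrite mulN1r.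
    by move=> /cvgr_to_le/[apply]; lra.
  - have : \forall n \near \oo, (\int[Pr]_x (Z x * phi n x))%R <=
        (\int[Pr]_x (Z x * ((L x / h + 1) * S)))%R + e.
      apply: (@Rintegral_limsup_le _ _ _ _ _ _ _ _ iphi) => //.
      move=> x z z0; apply: filterS (w_shift_le (L x) (z1 x z z0)) => n hn.
      exact: weigh.
    by rewrite lin; exact: cvgr_to_le phi_cvg.
have hh : h != 0 by rewrite gt_eqF.
apply/andP; split.
  move: hK1; rewrite -(ler_pM2r h0); congr (_ <= _); by field.
by move: hK2; rewrite -(ler_pM2r h0); congr (_ <= _); field.
Qed.

End RenewalLimitPoints.

Section RenewalTheorem.

(** The upper limit of [f] at infinity if [sg = 1], the lower limit if
[sg = -1], as a limit along a sequence. *)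
Lemma limsup_seq (R : realType) (f : R -> R) M sg : sg ^+ 2 = 1 ->
  (forall t, `|f t| <= M) ->
  exists S, exists u : nat -> R, [/\ u n @[n --> \oo] --> +oo,
    f (u n) @[n --> \oo] --> S &
    forall e : R, 0 < e -> \forall t \near +oo, sg * (f t - S) <= e].
Proof.
wlog -> : f sg / sg = 1.
  move=> H sg2; have /orP[/eqP->|/eqP->] : (sg == 1) || (sg == - 1).
  - by rewrite -sqrf_eq1 sg2.
  - by move=> fM; apply: H => //; rewrite expr1n.
  move=> fM; have [] := H (fun t => - f t) 1 erefl.
  - by rewrite expr1n.
  - by move=> t; rewrite normrN.
  move=> S [u [uoo fu hS]]; exists (- S), u; split => //.
    have -> : (fun n => f (u n)) = (fun n => - (- f (u n))).
      by apply/funext => n; rewrite opprK.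
    exact: cvgN.
  move=> e /hS; apply: filterS => t; rewrite mul1r mulN1r; lra.
move=> _ fM.
pose A (n : nat) := [set f t | t in [set t | n%:R <= t]].
have A0 n : A n !=set0 by exists (f n%:R), n%:R => /=.
have Aub n : has_ubound (A n).
  by exists M => _ [t _ <-]; rewrite (le_trans (ler_norm _)).
pose a n := sup (A n).
have a_ni : nonincreasing_seq a.
  move=> m n mn; apply: ge_sup => // _ [t nt <-].
  by apply: ub_le_sup => //; exists t => //=; apply: le_trans nt; rewrite ler_nat.
have a_lb : has_lbound (range a).
  exists (- M) => _ [n _ <-]; apply: le_trans (_ : f n%:R <= _).
    by rewrite lerNl; apply: le_trans (fM n%:R); rewrite -normrN ler_norm.
  by apply: ub_le_sup => //; exists n%:R => /=.
have a_cvg := nonincreasing_cvgn a_ni a_lb.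
set S := inf (range a) in a_cvg.
have /choice[u hu] : forall n, exists t, n%:R <= t /\ a n - n.+1%:R^-1 < f t.
  move=> n; have n0 : (0 : R) < n.+1%:R^-1 by rewrite invr_gt0.
  have [_ [t nt <-] ht] := sup_adherent n0 (conj (A0 n) (Aub n)).
  by exists t.
exists S, u; split.
- apply/cvgryPge => B; near=> n; have [nu _] := hu n; apply: le_trans nu.
  by near: n; exact: nbhs_infty_ger.
- apply: (@squeeze_cvgr _ _ _ _ (fun n => a n - n.+1%:R^-1) a).
  + apply: nearW => n; have [nu /ltW ->] := hu n => /=.
    by apply: ub_le_sup => //; exists (u n).
  + by rewrite -[X in _ --> X]subr0; apply: cvgB => //; exact: cvg_harmonic.
  + exact: a_cvg.
- move=> e e0; move/cvgrPdist_le : a_cvg => /(_ _ e0)[N _ hN].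
  near=> t; rewrite mul1r.
  have := hN N (leqnn N); rewrite /= distrC => /(le_trans (ler_norm _)).
  apply: le_trans; rewrite lerD2r; apply: ub_le_sup => //; exists t => //=.
Unshelve. all: by end_near. Qed.

Context (dT : measure_display) (T : measurableType dT) (R : realType).
Variables (Pr : probability T R) (Z L : T -> R) (w G p : R -> R) (K lam gam rho : R).
Hypotheses (mZ : measurable_fun setT Z) (mL : measurable_fun setT L).
Hypothesis Z0 : forall x, 0 <= Z x.
Hypothesis Z1 : (\int[Pr]_x (Z x)%:E = 1)%E.
Hypothesis Z_support : forall s r : R, 0 < r ->
  0 < (\int[Pr]_x (Z x * (`|L x - s| < r)%R%:R))%R.
Hypothesis iZL : Pr.-integrable setT (EFin \o (fun x => Z x * L x)).
Hypotheses (lam0 : 0 < lam) (gam0 : 0 < gam) (rho1 : rho < 1).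
Hypothesis Zlam : (\int[Pr]_x (Z x * expR (- (lam * L x)))%:E = rho%:E)%E.
Hypothesis w_nd : forall x y, x <= y -> w x <= w y.
Hypothesis w_ge0 : forall x, 0 <= w x.
Hypothesis G_nd : forall x y, x <= y -> G x <= G y.
Hypotheses (G_ge0 : forall x, 0 <= G x) (G_le : forall x, G x <= K).
Hypothesis G_cvg : G t @[t --> +oo] --> K.
Hypothesis K0 : 0 < K.
Hypothesis w_renew : forall t,
  ((w t)%:E = \int[Pr]_x (Z x * (w (t - L x) + G (t - L x)))%:E)%E.
Hypotheses (p_ge0 : forall t, 0 <= p t) (p_le1 : forall t, p t <= 1).
Hypothesis w_incr_ge : forall t h, 0 <= h ->
  (expR (gam * h) - 1) * expR (gam * t) * p (t + h) <= w (t + h) - w t.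
Hypothesis w_incr_le : forall t h, 0 <= h ->
  w (t + h) - w t <= (expR (gam * h) - 1) * expR (gam * t) * p t.
Hypothesis p_growth : forall e : R, 0 < e -> e <= gam ->
  exists C, forall t, expR (gam * t) * p t <= C * expR (e * t).

Let mono_measurable (f : R -> R) : (forall x y, x <= y -> f x <= f y) ->
  measurable_fun setT f.
Proof. by move=> f_nd; apply: nondecreasing_measurable => // x y; exact: f_nd. Qed.

Let mw := mono_measurable w_nd.
Let mG := mono_measurable G_nd.

Let mshift (f : R -> R) t : measurable_fun setT f ->
  measurable_fun setT (fun x => f (t - L x)).
Proof. by move=> mf; apply: measurableT_comp => //; exact: measurable_funB. Qed.

Let ge0_integrable (f : T -> R) r : measurable_fun setT f -> (forall x, 0 <= f x) ->
  (\int[Pr]_x (f x)%:E = r%:E)%E -> Pr.-integrable setT (EFin \o f).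
Proof.
move=> mf f0 fr; apply/integrableP; split; first exact/measurable_EFinP.
under eq_integral do rewrite /= ger0_norm//.
by rewrite fr ltry.
Qed.

Let iZ : Pr.-integrable setT (EFin \o Z).
Proof. exact: ge0_integrable Z1. Qed.

Let iZlam : Pr.-integrable setT (EFin \o (fun x => Z x * expR (- (lam * L x)))).
Proof.
apply: ge0_integrable Zlam => [|x]; last by rewrite mulr_ge0// expR_ge0.
apply: measurable_funM => //; apply: measurableT_comp => //.
by apply: measurableT_comp => //; exact: measurable_funM.
Qed.

Let iwG t : Pr.-integrable setT (EFin \o (fun x => Z x * (w (t - L x) + G (t - L x)))).
Proof.
apply: (@ge0_integrable _ (w t)) => [|x|]; last by rewrite w_renew.
- by apply: measurable_funM => //; apply: measurable_funD; exact: mshift.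
- by rewrite mulr_ge0// addr_ge0.
Qed.

Let iw t : Pr.-integrable setT (EFin \o (fun x => Z x * w (t - L x))).
Proof.
apply: integrable_le (iwG t) _ => [|x].
  by apply: measurable_funM => //; exact: mshift.
by rewrite ger0_norm ?mulr_ge0// ler_wpM2l// lerDl.
Qed.

Let iG t : Pr.-integrable setT (EFin \o (fun x => Z x * G (t - L x))).
Proof.
apply: integrable_le (iwG t) _ => [|x].
  by apply: measurable_funM => //; exact: mshift.
by rewrite ger0_norm ?mulr_ge0// ler_wpM2l// lerDr.
Qed.

Let RZ1 : (\int[Pr]_x Z x)%R = 1. Proof. by rewrite /Rintegral Z1. Qed.

Let RZlam : (\int[Pr]_x (Z x * expR (- (lam * L x))))%R = rho.
Proof. by rewrite /Rintegral Zlam. Qed.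

Let w_renewR t :
  w t = (\int[Pr]_x (Z x * w (t - L x)))%R + (\int[Pr]_x (Z x * G (t - L x)))%R.
Proof.
rewrite -RintegralD//; under eq_Rintegral do rewrite -mulrDr.
by rewrite /Rintegral -w_renew.
Qed.

Let w_step a b : 0 <= a -> 0 <= b ->
  (forall y, w y <= a + b * expR (lam * y)) ->
  forall t, w t <= K + a + b * rho * expR (lam * t).
Proof.
move=> a0 b0 wab t; rewrite w_renewR -RintegralD//.
have -> : K + a + b * rho * expR (lam * t) = (\int[Pr]_x ((K + a) * Z x +
    (b * expR (lam * t)) * (Z x * expR (- (lam * L x)))))%R.
  rewrite RintegralD//; [|exact: integrable_scale..].
  by rewrite !RintegralZl// RZ1 RZlam; ring.
apply: le_Rintegral => //.
- exact: integrable_add.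
- by apply: integrable_add; exact: integrable_scale.
move=> x _; rewrite -mulrDr.
have -> : (K + a) * Z x + b * expR (lam * t) * (Z x * expR (- (lam * L x))) =
  Z x * (K + (a + b * expR (lam * (t - L x)))).
  by rewrite mulrBr expRD; ring.
by rewrite ler_wpM2l// addrC lerD.
Qed.

Let gp_incr t : w (t + 1) - w t <= (expR gam - 1) * (expR (gam * t) * p t).
Proof. by have := @w_incr_le t 1 ler01; rewrite mulr1 mulrA. Qed.

Let egam0 : 0 < expR gam - 1. Proof. by rewrite subr_gt0 expR_gt1. Qed.

Let rho0 : 0 <= rho.
Proof. by rewrite -RZlam; apply: Rintegral_ge0 => x _; rewrite mulr_ge0// expR_ge0. Qed.

Let incr_bounded : exists B : R, 0 <= B /\ forall t, w (t + 1) - w t <= B.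
Proof.
apply: (@bounded_increments R w K (expR gam - 1) lam gam rho) => //.
- exact: ltW.
- exact: ltW.
- move=> t _; apply: le_trans (gp_incr t) _; apply: ler_wpM2l; first exact: ltW.
  by rewrite ler_piMr// expR_ge0.
- move=> e e0 eg; have [C hC] := p_growth e0 eg; exists ((expR gam - 1) * C) => t.
  by apply: le_trans (gp_incr t) _; rewrite -mulrA; apply: ler_wpM2l => //; exact: ltW.
Qed.

Let mean := (\int[Pr]_x (Z x * L x))%R.

(** The inequality [1 - x <= exp (- x)] turns [rho < 1] into a positive drift. *)
Let mean_gt0 : 0 < mean.
Proof.
have : (\int[Pr]_x (Z x - lam * (Z x * L x)))%R <= rho.
  rewrite -RZlam; apply: le_Rintegral => //.
    by apply: integrable_sub => //; exact: integrable_scale.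
  move=> x _; rewrite mulrCA -{1}[Z x]mulr1 -mulrBr ler_wpM2l//.
  exact: expR_ge1Dx.
rewrite RintegralB//; last exact: integrable_scale.
rewrite RintegralZl// RZ1 -/mean lerBlDr => h.
rewrite -(pmulr_rgt0 _ lam0) -(ltrD2l rho) addr0; exact: lt_le_trans rho1 h.
Qed.

Let gp_bounded : exists2 B : R, 0 <= B & forall t, expR (gam * t) * p t <= B.
Proof.
have [B [B0 hB]] := incr_bounded.
exists (expR gam / (expR gam - 1) * B).
  by rewrite mulr_ge0// divr_ge0 ?expR_ge0// ltW.
move=> t; have := @w_incr_ge (t - 1) 1 ler01; rewrite subrK mulr1.
have := hB (t - 1); rewrite subrK => h1 h2.
have := le_trans h2 h1; rewrite mulrBr mulr1 expRB => h3.
rewrite -ler_pdivrMl; last by rewrite divr_gt0 ?expR_gt0.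
apply: le_trans h3; rewrite le_eqVlt; apply/orP; left; apply/eqP.
by field; rewrite !gt_eqF ?expR_gt0.
Qed.

Let w_unif (e : R) : 0 < e -> exists2 r : R, 0 < r &
  forall t t', `|t - t'| < r -> `|w t - w t'| <= e.
Proof.
have [B B0 hB] := gp_bounded => e0.
have eB : 0 < e / (B + 1) by rewrite divr_gt0// ltr_wpDl.
exists (ln (1 + e / (B + 1)) / gam); first by rewrite divr_gt0// ln_gt0// ltrDl.
move=> t t'; wlog tt' : t t' / t' <= t.
  move=> H; have [/H//|/ltW/H] := leP t' t.
  by rewrite distrC => {}H; rewrite [X in _ -> X <= _]distrC.
rewrite ger0_norm ?subr_ge0// ger0_norm ?subr_ge0 ?w_nd//.
rewrite ltr_pdivlMr// => /ltW tr.
have := @w_incr_le t' (t - t'); rewrite subr_ge0 => /(_ tt').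
rewrite (addrC t') subrK => /le_trans; apply.
rewrite -mulrA (le_trans (ler_wpM2l _ (hB t')))//.
  by rewrite subr_ge0 -expR0 ler_expR; apply: mulr_ge0; [exact: ltW|rewrite subr_ge0].
have : expR (gam * (t - t')) - 1 <= e / (B + 1).
  rewrite lerBlDl -[leRHS]lnK ?posrE ?addr_gt0// ler_expR mulrC//.
move=> /(ler_wpM2r B0)/le_trans; apply.
rewrite -mulrA ler_piMr ?ltW// mulrC ltr_pdivrMr ?mul1r ?ltrDl// ltr_wpDl//.
Qed.

(** [extremal_increment] is applied along two sequences, which realize the upper
and the lower limit of the increments. *)
Let increment_limits h : 0 < h -> h < mean -> forall e : R, 0 < e ->
  \forall t \near +oo, K * h / (mean + h) - e <= w (t + h) - w t <= K * h / (mean - h) + e.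
Proof.
move=> h0 hm e e0.
have [B [B0 hB]] := incr_bounded.
pose D t := w (t + h) - w t.
have DM t : `|D t| <= B * (`|h| + 1).
  by have := w_incr_norm w_nd B0 hB (t + h) h; rewrite addrK.
have main u S sg := @extremal_increment _ _ _ Pr Z L w G K B mZ mL Z0 iZ RZ1
  Z_support iZL w_nd G_nd iw G_ge0 G_le G_cvg w_renewR B0 hB w_unif h h0 u S sg.
have [S1 [u1 [u1oo Du1 S1e]]] := @limsup_seq R D _ 1 (expr1n _ _) DM.
have /andP[S1K _] := main _ _ _ u1oo (expr1n _ _) Du1 S1e.
have N1 : (-1 : R) ^+ 2 = 1 by rewrite sqrrN expr1n.
have [S2 [u2 [u2oo Du2 S2e]]] := @limsup_seq R D _ (-1) N1 DM.
have /andP[_ S2K] := main _ _ _ u2oo N1 Du2 S2e.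
near=> t.
have t1 : 1 * (D t - S1) <= e by near: t; exact: S1e.
have t2 : (-1) * (D t - S2) <= e by near: t; exact: S2e.
have S1' : S1 <= K * h / (mean - h) by rewrite ler_pdivlMr ?subr_gt0// mulrC.
have S2' : K * h / (mean + h) <= S2 by rewrite ler_pdivrMr ?addr_gt0// [leRHS]mulrC.
move: t1 t2; rewrite -/(D t); lra.
Unshelve. all: by end_near. Qed.

(** Key renewal theorem for a tail [p].  When [w] is the mean of a power of
order [gam] truncated at the level [exp t], its increments of length [h] are
[(exp (gam h) - 1) exp (gam t) p], up to a shift of [p] by at most [h]; they
tend to [h * K / mean] up to a relative error that vanishes with [h]. *)
Theorem renewal_tail : exists2 c : R, 0 < c & expR (gam * t) * p t @[t --> +oo] --> c.
Proof.
pose c := K / (gam * mean).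
exists c; first by rewrite divr_gt0// mulr_gt0.
have lin_cvg (a b : R) : b + a * h @[h --> 0^'+] --> b.
  rewrite -[X in _ --> X]addr0 -{2}(mulr0 a).
  apply: cvgD; first exact: cvg_cst.
  by apply: cvgMr; apply: cvg_at_right_filter; exact: cvg_id.
have exp_cvg a : expR (a * h) @[h --> 0^'+] --> (1 : R).
  rewrite -[X in _ --> X]expR0; apply: (@cvg_comp _ _ _ (fun h => a * h) expR).
    rewrite (_ : (fun h => a * h) = (fun h => 0 + a * h)); first exact: lin_cvg.
    by apply/funext => ?; rewrite add0r.
  exact: continuous_expR.
have frac_cvg (a : R) : K / (gam * (mean + a * h)) @[h --> 0^'+] --> c.
  rewrite /c; apply: cvgMr; apply: cvgV; first by rewrite gt_eqF// mulr_gt0.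
  by apply: cvgMr; exact: lin_cvg.
have U_cvg : expR (gam * h) * (K / (gam * (mean + (-1) * h))) @[h --> 0^'+] --> c.
  by rewrite -[X in _ --> X]mul1r; apply: cvgM => //.
have V_cvg : expR ((- gam) * h) * (K / (gam * (mean + 1 * h))) @[h --> 0^'+] --> c.
  by rewrite -[X in _ --> X]mul1r; apply: cvgM => //.
apply/cvgrPdist_le => e e0.
have e2 : 0 < e / 2 by rewrite divr_gt0.
near (0:R)^'+ => h.
have h0 : 0 < h by near: h; exact: nbhs_right_gt.
have hm : h < mean by near: h; exact: nbhs_right_lt.
have Uh : expR (gam * h) * (K / (gam * (mean - h))) <= c + e / 2.
  rewrite -(mulN1r h); near: h.
  by apply: (@cvgr_le _ _ _ _ _ _ U_cvg); rewrite ltrDl.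
have : c - e / 2 <= expR ((- gam) * h) * (K / (gam * (mean + 1 * h))).
  by near: h; apply: (@cvgr_ge _ _ _ _ _ _ V_cvg); rewrite gtrBl.
rewrite mulNr expRN mul1r => Vh.
have gh0 : 0 < gam * h by rewrite mulr_gt0.
have egh0 : 0 < expR (gam * h) - 1 by rewrite subr_gt0 expR_gt1.
have egh1 : gam * h <= expR (gam * h) - 1 by rewrite lerBrDl expR_ge1Dx.
set X := expR (gam * h) in Uh Vh egh0 egh1.
have X0 : 0 < X by exact: expR_gt0.
pose e3 := Num.min (e / 2 * (gam * h) / X) (e / 2 * (X - 1)).
have e30 : 0 < e3 by rewrite lt_min !mulr_gt0 ?invr_gt0.
have incr := increment_limits h0 hm e30.
have incr' : \forall t \near +oo,
    K * h / (mean + h) - e3 <= w (t - h + h) - w (t - h) <= K * h / (mean - h) + e3.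
  have /(_ _ incr) := cvg_addrr (- h) : forall A, nbhs +oo A -> _.
  done.
near=> t.
have /andP[_ up] : K * h / (mean + h) - e3 <= w (t - h + h) - w (t - h) <= K * h / (mean - h) + e3.
  by near: t.
have /andP[lo _] : K * h / (mean + h) - e3 <= w (t + h) - w t <= K * h / (mean - h) + e3.
  by near: t.
set g := expR (gam * t) * p t.
have g_up : (X - 1) / X * g <= K * h / (mean - h) + e / 2 * (gam * h) / X.
  have := w_incr_ge (t - h) (ltW h0); rewrite subrK in up *.
  rewrite mulrBr expRB -/X => /le_trans/(_ up).
  have -> : (X - 1) * (expR (gam * t) / X) * p t = (X - 1) / X * g by rewrite /g; ring.
  by move=> /le_trans; apply; rewrite lerD2l ge_min lexx.
have g_lo : K * h / (mean + h) - e / 2 * (X - 1) <= (X - 1) * g.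
  have := w_incr_le t (ltW h0); rewrite -/X -mulrA -/g; apply: le_trans.
  by apply: le_trans lo; rewrite lerD2l lerN2 ge_min lexx orbT.
have hm' : 0 < mean - h by rewrite subr_gt0.
have mh : 0 < mean + h by rewrite addr_gt0.
have g0 : 0 <= g by rewrite mulr_ge0// expR_ge0.
have X1 : X - 1 <= gam * h * X.
  have := expR_ge1Dx (- (gam * h)); rewrite expRN -/X -(ler_pM2r X0) mulVf ?gt_eqF//.
  by lra.
rewrite ler_distlC; apply/andP; split.
  rewrite -(ler_pM2l egh0); apply: le_trans g_lo.
  have -> : c - e = (c - e / 2) - e / 2 by field.
  rewrite mulrBr (mulrC (X - 1) (e / 2)) lerD2r.
  have [c0|c0] := leP 0 (c - e / 2); last first.
    apply: le_trans (_ : _ <= 0) _; first by rewrite pmulr_rle0// ltW.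
    by rewrite divr_ge0 ?ltW// mulr_gt0.
  apply: le_trans (ler_pM (ltW egh0) c0 X1 Vh) _.
  rewrite le_eqVlt; apply/orP; left; apply/eqP.
  by field; rewrite !gt_eqF// mulr_gt0.
have : gam * h / X * g <= gam * h / X * (c + e); last by rewrite ler_pM2l// divr_gt0.
apply: le_trans (_ : _ <= (X - 1) / X * g) _.
  by rewrite ler_wpM2r// ler_wpM2r// ?invr_ge0 ltW.
apply: le_trans g_up _.
have -> : c + e = (c + e / 2) + e / 2 by field.
have -> : K * h / (mean - h) + e / 2 * (gam * h) / X =
   gam * h / X * (X * (K / (gam * (mean - h))) + e / 2).
  by field; rewrite !gt_eqF.
by rewrite ler_wpM2l ?lerD2r// ltW// divr_gt0.
Unshelve. all: by end_near. Qed.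

End RenewalTheorem.

(** * Laws of random vectors and of their linear forms *)

Section StepPolynomials.
Context (R : realType).

(** These polynomials in [z] tend to the step function at [1/2] on the unit
interval; the factor [n] in the exponent forces the limit 1 at [1/2] itself. *)
Definition step_poly (n : nat) (z : R) : R := 1 - (1 - z ^+ n) ^+ (n * 2 ^ n).

Lemma cvg_mulrn_expr (r : R) : 0 <= r -> r < 1 -> n%:R * r ^+ n @[n --> \oo] --> 0.
Proof.
move=> r0 r1; have [->|rn0] := eqVneq r 0.
  apply/cvgrPdist_le => e e0; near=> n.
  by rewrite expr0n gtn_eqF ?mulr0 ?subrr ?normr0 ?ltW//; near: n; exact: nbhs_infty_gt.
have {}r0 : 0 < r by rewrite lt_def rn0.
pose s := Num.sqrt r.
have s0 : 0 < s by rewrite sqrtr_gt0.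
have sE : s * s = r by rewrite -expr2 sqr_sqrtr// ltW.
have s1 : s < 1 by rewrite -sqrtr1 ltr_sqrt.
have bound n : n%:R * s ^+ n <= (s^-1 - 1)^-1.
  have d0 : 0 < s^-1 - 1 by rewrite subr_gt0 invf_gt1.
  have H : 1 + n%:R * (s^-1 - 1) <= s^-1 ^+ n.
    elim: n => [|n IH]; first by rewrite mul0r addr0 expr0.
    rewrite exprS; apply: le_trans (ler_wpM2l _ IH); last by rewrite invr_ge0 ltW.
    have nn : 0 <= n%:R * (s^-1 - 1) ^+ 2 by rewrite mulr_ge0// sqr_ge0.
    rewrite -natr1; move: nn; rewrite expr2; nra.
  have sn0 : 0 < s ^+ n by rewrite exprn_gt0.
  rewrite -(ler_pM2r d0) mulVf ?gt_eqF//.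
  have : n%:R * (s^-1 - 1) <= s^-1 ^+ n by lra.
  by rewrite exprVn -(ler_pM2r sn0) mulVf ?gt_eqF// mulrAC.
have b0 : 0 <= (s^-1 - 1)^-1 by rewrite invr_ge0 subr_ge0 ltW// invf_gt1.
apply: (@squeeze_cvgr _ _ _ _ (cst 0) (fun n => (s^-1 - 1)^-1 * s ^+ n)).
- apply: nearW => n /=; rewrite mulr_ge0 ?exprn_ge0 ?(ltW r0)//= -sE exprMn mulrA.
  by rewrite ler_wpM2r ?exprn_ge0 ?(ltW s0).
- exact: cvg_cst.
- rewrite -[X in _ --> X](mulr0 (s^-1 - 1)^-1); apply: cvgMr; apply: cvg_expr.
  by rewrite ger0_norm// ltW.
Unshelve. all: by end_near. Qed.

Lemma step_poly_cvg (z : R) : 0 <= z <= 1 ->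
  step_poly n z @[n --> \oo] --> ((2^-1 <= z)%R%:R : R).
Proof.
move=> /andP[z0 z1].
have zn n : 0 <= z ^+ n <= 1 by rewrite exprn_ge0//= exprn_ile1.
have [zh|zh] := leP 2^-1 z.
- rewrite -[X in _ --> X]subr0 /step_poly; apply: cvgB; first exact: cvg_cst.
  apply: (@squeeze_cvgr _ _ _ _ (cst 0) (fun n => expR (- n%:R))).
  + apply: nearW => n /=; have /andP[zn0 zn1] := zn n.
    rewrite exprn_ge0 ?subr_ge0//=.
    have -> : expR (- n%:R) = expR (- 2^-1 ^+ n) ^+ (n * 2 ^ n) :> R.
      rewrite -expRM_natl natrM natrX exprVn mulrN -mulrA mulfV ?mulr1// expf_neq0.
    rewrite lerXn2r ?nnegrE ?expR_ge0 ?subr_ge0//.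
    apply: le_trans (expR_ge1Dx _); rewrite lerD2l lerN2.
    by rewrite lerXn2r ?nnegrE.
  + exact: cvg_cst.
  + exact: cvgn_expR.
- have z2 : 2 * z < 1 by rewrite mulrC -ltr_pdivlMr// mul1r.
  apply: (@squeeze_cvgr _ _ _ _ (cst 0) (fun n => n%:R * (2 * z) ^+ n)).
  + apply: nearW => n /=; have /andP[zn0 zn1] := zn n.
    rewrite /step_poly subr_ge0 exprn_ile1 ?subr_ge0 ?gerBl//=.
    rewrite exprMn mulrA -natrX -natrM lerBlDl -lerBlDr.
    have bern k : 1 - k%:R * z ^+ n <= (1 - z ^+ n) ^+ k.
      elim: k => [|k IH]; first by rewrite mul0r subr0 expr0.
      rewrite exprS; apply: le_trans (ler_wpM2l _ IH); last by rewrite subr_ge0.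
      have nn : 0 <= k%:R * (z ^+ n) ^+ 2 by rewrite mulr_ge0// sqr_ge0.
      by rewrite -natr1; move: nn; rewrite expr2; nra.
    exact: bern.
  + exact: cvg_cst.
  + by apply: cvg_mulrn_expr => //; rewrite mulr_ge0.
Qed.

Lemma step_poly_itv n (z : R) : 0 <= z <= 1 -> 0 <= step_poly n z <= 1.
Proof.
move=> /andP[z0 z1].
have /andP[zn0 zn1] : 0 <= z ^+ n <= 1 by rewrite exprn_ge0//= exprn_ile1.
rewrite /step_poly subr_ge0 exprn_ile1 ?subr_ge0 ?gerBl//=.
by rewrite exprn_ge0// subr_ge0.
Qed.

End StepPolynomials.

Section CramerWold.
Context (dT : measure_display) (T : measurableType dT) (R : realType).
Variables (Pr : probability T R) (d : nat).
Implicit Types u v x : 'cV[R]_d.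

Definition dotv u x : R := (u^T *m x) 0 0.

Lemma dotvDl u v x : dotv (u + v) x = dotv u x + dotv v x.
Proof. by rewrite /dotv linearD/= mulmxDl mxE. Qed.

Lemma dotvBl u v x : dotv (u - v) x = dotv u x - dotv v x.
Proof. by rewrite /dotv linearB/= mulmxBl !mxE. Qed.

Lemma dotvZl a u x : dotv (a *: u) x = a * dotv u x.
Proof. by rewrite /dotv linearZ/= -scalemxAl mxE. Qed.

Lemma dotv_delta i x : dotv (delta_mx i 0) x = x i 0.
Proof. by rewrite /dotv trmx_delta -rowE mxE. Qed.

Lemma dotvE u x : dotv u x = \sum_i u i 0 * x i 0.
Proof. by rewrite /dotv mxE; apply: eq_bigr => i _; rewrite mxE. Qed.

Variables X X' : T -> 'cV[R]_d.
Hypothesis mX : forall i, measurable_fun setT (fun w => X w i 0).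
Hypothesis mX' : forall i, measurable_fun setT (fun w => X' w i 0).
Hypothesis XX' : forall u, u != 0 -> forall B : set R, measurable B ->
  Pr ((fun w => dotv u (X w)) @^-1` B) = Pr ((fun w => dotv u (X' w)) @^-1` B).

(** A test function [f] is in the class if [X] and [X'] give the same mean to all
its products with trigonometric functions of linear forms.  This class is
stable under products with such functions and under bounded limits. *)
Definition wold_class (f : 'cV[R]_d -> R) : Prop :=
  [/\ measurable_fun setT (f \o X), measurable_fun setT (f \o X'),
      exists M, forall x, `|f x| <= M &
      forall u c, (\int[Pr]_w (f (X w) * cos (dotv u (X w) + c)))%R =
                  (\int[Pr]_w (f (X' w) * cos (dotv u (X' w) + c)))%R].

Let mdot (Y : T -> 'cV[R]_d) u : (forall i, measurable_fun setT (fun w => Y w i 0)) ->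
  measurable_fun setT (fun w : T => dotv u (Y w)).
Proof.
move=> mY; under eq_fun do rewrite dotvE.
by apply: measurable_sum => i; exact: measurable_funM.
Qed.

Let mcosd (Y : T -> 'cV[R]_d) u c : (forall i, measurable_fun setT (fun w => Y w i 0)) ->
  measurable_fun setT (fun w : T => cos (dotv u (Y w) + c)).
Proof.
move=> mY; apply: measurableT_comp; last by apply: measurable_funD => //; exact: mdot.
by apply: continuous_measurable_fun; exact: continuous_cos.
Qed.

Let icos (f : 'cV[R]_d -> R) (Y : T -> 'cV[R]_d) u c M : measurable_fun setT (f \o Y) ->
  (forall i, measurable_fun setT (fun w => Y w i 0)) -> (forall x, `|f x| <= M) ->
  Pr.-integrable setT (EFin \o (fun w : T => f (Y w) * cos (dotv u (Y w) + c))).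
Proof.
move=> mf mY fM; apply: (@bounded_integrable _ _ _ Pr _ M).
  by apply: measurable_funM => //; exact: mcosd.
move=> w; rewrite normrM -[leRHS]mulr1; apply: ler_pM => //.
exact: cos_max.
Qed.

Lemma wold_class1 : wold_class (cst 1).
Proof.
split.
- exact: (measurable_cst (1 : R)).
- exact: (measurable_cst (1 : R)).
- by exists 1 => x; rewrite normr1.
move=> u c.
have E (Y : T -> 'cV[R]_d) : (\int[Pr]_w (cst 1 (Y w) * cos (dotv u (Y w) + c)))%R =
    (\int[Pr]_w cos (dotv u (Y w) + c))%R.
  by apply: eq_Rintegral => w _; rewrite mul1r.
rewrite !E.
have [->|u0] := eqVneq u 0.
  have z x : dotv 0 x = 0 by rewrite /dotv trmx0 mul0mx mxE.
  by apply: eq_Rintegral => w _; rewrite !z.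
have mY := mdot u mX; have mY' := mdot u mX'.
pose Y1 : {mfun T >-> R} := HB.pack (fun w => dotv u (X w)) (isMeasurableFun.Build _ _ _ _ _ mY).
pose Y2 : {mfun T >-> R} := HB.pack (fun w => dotv u (X' w)) (isMeasurableFun.Build _ _ _ _ _ mY').
have mc : measurable_fun setT (fun y : R => (cos (y + c))%:E).
  apply/measurable_EFinP; apply: measurableT_comp; last exact: measurable_funD.
  by apply: continuous_measurable_fun; exact: continuous_cos.
have b1 (Y : T -> R) : measurable_fun setT Y -> Pr.-integrable setT (EFin \o (fun w => cos (Y w + c))).
  move=> mYY; apply: (@bounded_integrable _ _ _ Pr _ 1) => [|w]; last exact: cos_max.
  apply: measurableT_comp; last exact: measurable_funD.
  by apply: continuous_measurable_fun; exact: continuous_cos.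
rewrite /Rintegral; congr fine.
have := integral_distribution (P := Pr) (X := Y1) mc (b1 _ mY).
have := integral_distribution (P := Pr) (X := Y2) mc (b1 _ mY').
move=> <- <-; apply: eq_measure_integral => B mB _.
exact: XX'.
Qed.

Lemma wold_class_lin (a b : R) f g : wold_class f -> wold_class g ->
  wold_class (fun x => a * f x + b * g x).
Proof.
move=> [mf mf' [M fM] Ef] [mg mg' [N gN] Eg]; split.
- by apply: measurable_funD; exact: measurable_funM.
- by apply: measurable_funD; exact: measurable_funM.
- exists (`|a| * M + `|b| * N) => x; rewrite (le_trans (ler_normD _ _))//.
  by rewrite !normrM lerD// ler_wpM2l.
- move=> u c; have expand (Y : T -> 'cV[R]_d) w : (a * f (Y w) + b * g (Y w)) * cos (dotv u (Y w) + c) =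
      a * (f (Y w) * cos (dotv u (Y w) + c)) + b * (g (Y w) * cos (dotv u (Y w) + c)).
    by rewrite mulrDl !mulrA.
  under eq_Rintegral do rewrite expand; under [RHS]eq_Rintegral do rewrite expand.
  rewrite !RintegralD//; try by apply: integrable_scale; exact: icos fM || exact: icos gN.
  by rewrite !RintegralZl ?Ef ?Eg//; (exact: icos fM || exact: icos gN).
Qed.

(** By the product formula for cosines. *)
Lemma wold_class_cos f v b : wold_class f ->
  wold_class (fun x => f x * cos (dotv v x + b)).
Proof.
move=> [mf mf' [M fM] Ef]; split.
- by apply: measurable_funM => //; exact: mcosd.
- by apply: measurable_funM => //; exact: mcosd.
- exists M => x; rewrite normrM -[leRHS]mulr1; apply: ler_pM => //.
  exact: cos_max.
- move=> u c; have expand (Y : T -> 'cV[R]_d) w :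
      f (Y w) * cos (dotv v (Y w) + b) * cos (dotv u (Y w) + c) =
      2^-1 * (f (Y w) * cos (dotv (v + u) (Y w) + (b + c))) +
      2^-1 * (f (Y w) * cos (dotv (v - u) (Y w) + (b - c))).
    rewrite dotvDl dotvBl.
    have -> : dotv v (Y w) + dotv u (Y w) + (b + c) =
      (dotv v (Y w) + b) + (dotv u (Y w) + c) by ring.
    have -> : dotv v (Y w) - dotv u (Y w) + (b - c) =
      (dotv v (Y w) + b) - (dotv u (Y w) + c) by ring.
    move: (dotv v (Y w) + b) (dotv u (Y w) + c) => p q.
    by rewrite cosD cosB; field.
  under eq_Rintegral do rewrite expand; under [RHS]eq_Rintegral do rewrite expand.
  rewrite !RintegralD//; try by apply: integrable_scale; exact: icos fM.
  by rewrite !RintegralZl ?Ef//; exact: icos fM.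
Qed.

Lemma wold_class_lim (f_ : nat -> 'cV[R]_d -> R) f M :
  (forall n, wold_class (f_ n)) -> (forall n x, `|f_ n x| <= M) ->
  (forall x, f_ n x @[n --> \oo] --> f x) -> wold_class f.
Proof.
move=> Wf fM ff.
have mfY (Y : T -> 'cV[R]_d) : (forall n, measurable_fun setT (f_ n \o Y)) ->
    measurable_fun setT (f \o Y).
  move=> mf_; apply: (@measurable_fun_cvg _ _ _ setT (fun n => f_ n \o Y)) => //.
  by move=> w _; exact: ff.
have f_M x : `|f x| <= M.
  by apply: cvgr_to_le (cvg_norm (ff x)) _; exact: nearW.
split.
- by apply: mfY => n; have [] := Wf n.
- by apply: mfY => n; have [] := Wf n.
- by exists M.
- move=> u c.
  have cv (Y : T -> 'cV[R]_d) : (forall n, measurable_fun setT (f_ n \o Y)) ->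
      (forall i, measurable_fun setT (fun w => Y w i 0)) ->
      (\int[Pr]_w (f_ n (Y w) * cos (dotv u (Y w) + c)))%R @[n --> \oo] -->
      (\int[Pr]_w (f (Y w) * cos (dotv u (Y w) + c)))%R.
    move=> mf_ mY; apply: (@Rintegral_dominated_cvg _ _ _ _ _ _ (cst M)).
    + by move=> n; apply: measurable_funM => //; [exact: mf_|exact: mcosd].
    + by apply: measurable_funM => //; [exact: mfY|exact: mcosd].
    + apply: (@bounded_integrable _ _ _ Pr _ `|M|) => //.
    + move=> n w; rewrite normrM -[leRHS]mulr1; apply: ler_pM => //.
      exact: cos_max.
    + by move=> w; apply: cvgMl; exact: ff.
  have c1 := cv X (fun n => let: And4 h _ _ _ := Wf n in h) mX.
  have c2 := cv X' (fun n => let: And4 _ h _ _ := Wf n in h) mX'.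
  have c1' : (\int[Pr]_w (f_ n (X' w) * cos (dotv u (X' w) + c)))%R @[n --> \oo] -->
      (\int[Pr]_w (f (X w) * cos (dotv u (X w) + c)))%R.
    rewrite (_ : (fun n : nat => _) = (fun n : nat =>
      (\int[Pr]_w (f_ n (X w) * cos (dotv u (X w) + c)))%R)); first exact: c1.
    by apply/funext => n; have [_ _ _ ->] := Wf n.
  exact: cvg_unique c1' c2.
Qed.

(** The function [z k], an affine image of a slow sine of [dotv v x - b],
compares with [1/2] as [dotv v x] does with [b], once [k] is large; the step
polynomials in [z k] tend to the indicator of [1/2 <= z k]. *)
Lemma wold_class_halfspace f v b : wold_class f ->
  wold_class (fun x => f x * (b <= dotv v x)%R%:R).
Proof.
move=> Wf.
have [_ _ [M fM] _] := Wf.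
pose z (k : nat) x := (1 + cos (dotv (k.+1%:R^-1 *: v) x + (- (b / k.+1%:R) - pi / 2))) / 2.
have zE k x : z k x = (1 + sin ((dotv v x - b) / k.+1%:R)) / 2.
  rewrite /z dotvZl; congr ((1 + _) / 2).
  rewrite (_ : _ + _ = (dotv v x - b) / k.+1%:R - pi / 2); last by ring.
  by rewrite cosB cos_pihalf sin_pihalf mulr0 add0r mulr1.
have z01 k x : 0 <= z k x <= 1.
  have := cos_max (dotv (k.+1%:R^-1 *: v) x + (- (b / k.+1%:R) - pi / 2)).
  rewrite ler_norml /z => /andP[h1 h2].
  by rewrite divr_ge0// ?ler_pdivrMr// ?mul1r; lra.
have Wz k g : wold_class g -> wold_class (fun x => g x * z k x).
  move=> Wg; rewrite (_ : (fun x => _) = (fun x => 2^-1 * g x + 2^-1 *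
    (g x * cos (dotv (k.+1%:R^-1 *: v) x + (- (b / k.+1%:R) - pi / 2))))).
    by apply: wold_class_lin => //; exact: wold_class_cos.
  by apply/funext => x; rewrite /z; field.
have Wzn k n g : wold_class g -> wold_class (fun x => g x * z k x ^+ n).
  move=> Wg; elim: n => [|n IH].
    by under eq_fun do rewrite expr0 mulr1.
  by under eq_fun do rewrite exprSr mulrA; exact: Wz.
have Wznm k n m g : wold_class g -> wold_class (fun x => g x * (1 - z k x ^+ n) ^+ m).
  move=> Wg; elim: m => [|m IH].
    by under eq_fun do rewrite expr0 mulr1.
  rewrite (_ : (fun x => _) = (fun x => 1 * (g x * (1 - z k x ^+ n) ^+ m) +
     (-1) * ((g x * (1 - z k x ^+ n) ^+ m) * z k x ^+ n))).
    by apply: wold_class_lin => //; exact: Wzn.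
  by apply/funext => x; rewrite exprSr; ring.
have Wq k n : wold_class (fun x => f x * step_poly n (z k x)).
  rewrite (_ : (fun x => _) = (fun x => 1 * f x +
    (-1) * (f x * (1 - z k x ^+ n) ^+ (n * 2 ^ n)))).
    by apply: wold_class_lin => //; exact: Wznm.
  by apply/funext => x; rewrite /step_poly; ring.
have fb x (t : R) : `|t| <= 1 -> `|f x * t| <= M.
  by move=> t1; rewrite normrM -[leRHS]mulr1; apply: ler_pM.
have Wk k : wold_class (fun x => f x * (2^-1 <= z k x)%R%:R).
  apply: (wold_class_lim (Wq k)) => [n x|x].
    apply: fb; have /andP[h1 h2] := step_poly_itv n (z01 k x).
    by rewrite ger0_norm.
  by apply: cvgMr; exact: step_poly_cvg.
apply: (wold_class_lim Wk) => [k x|x].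
  by apply: fb; case: (2^-1 <= _); rewrite ?normr1 ?normr0.
apply: cvgMr; apply: cvg_near_cst.
near=> k => /=; congr (_ %:R); congr nat_of_bool.
have k0 : 0 < k.+1%:R :> R by [].
set y := dotv v x - b.
have yk : `|y / k.+1%:R| < pi.
  rewrite normrM normfV (gtr0_norm k0) ltr_pdivrMr//.
  apply: le_lt_trans (_ : _ <= k%:R) _; first by near: k; exact: nbhs_infty_ger.
  rewrite -[ltLHS]mul1r; apply: ltr_pM => //; rewrite ?ltr_nat//.
  by apply: lt_le_trans (_ : 1 < 2) (pi_ge2 _); rewrite ltr1n.
rewrite zE ler_pdivlMr// mulVf// lerDl -/y -[RHS]subr_ge0 -/y.
have [y0|y0] := leP 0 y.
  rewrite sin_ge0_pi// divr_ge0//=.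
  by apply/ltW; apply: le_lt_trans (ler_norm _) yk.
apply/negbTE; rewrite -ltNge -(opprK (y / _)) sinN oppr_lt0 sin_gt0_pi//.
rewrite -mulNr divr_gt0 ?oppr_gt0//=.
by apply: le_lt_trans yk; rewrite mulNr -normrN ler_norm.
Unshelve. all: by end_near. Qed.

(** The theorem of Cramer and Wold: by [wold_class_halfspace] the two laws agree
on finite intersections of half-spaces, a pi-system that generates the Borel
sets. *)
Theorem cramer_wold B : vec_borel B -> Pr (X @^-1` B) = Pr (X' @^-1` B).
Proof.
move=> sB.
pose gen := \bigcup_(i : 'I_d) preimage_set_system setT (fun x : 'cV[R]_d => x i 0)
          (measurable : set (set R)).
have mvec (Y : T -> 'cV[R]_d) : (forall i, measurable_fun setT (fun w => Y w i 0)) ->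
    measurable_fun setT (Y : T -> g_sigma_algebraType gen).
  move=> mY; apply: (@measurability _ _ _ (g_sigma_algebraType gen) _ _ gen) => //.
  by move=> _ [_ [i _ [C mC <-]] <-]; rewrite !setTI; have := mY i measurableT C mC; rewrite setTI.
pose S := g_sigma_algebraType gen.
pose n1 : {mfun T >-> S} := HB.pack (X : T -> S) (isMeasurableFun.Build _ _ _ _ _ (mvec _ mX)).
pose n2 : {mfun T >-> S} := HB.pack (X' : T -> S) (isMeasurableFun.Build _ _ _ _ _ (mvec _ mX')).
pose H (s : seq ('cV[R]_d * R)) := [set x | all (fun vb => vb.2 <= dotv vb.1 x) s].
pose G : set_system 'cV[R]_d := range H.
have HI s s' : H s `&` H s' = H (s ++ s').
  apply/seteqP; split => x; rewrite /H /= all_cat; first by move=> [-> ->].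
  by move=> /andP.
have mcoord i : measurable_fun setT (fun x : S => x i 0 : R).
  by move=> _ C mC; apply: sub_sigma_algebra; exists i => //; exists C.
have mdotS v : measurable_fun setT (fun x : S => dotv v x).
  under eq_fun do rewrite dotvE.
  by apply: measurable_sum => i; exact: measurable_funM.
have HE s vb : H (vb :: s) = H [:: vb] `&` H s by rewrite HI.
have mH s : measurable (H s : set S).
  elim: s => [|vb s IH]; first by rewrite (_ : H _ = setT)//; apply/seteqP.
  rewrite HE; apply: measurableI => //.
  rewrite (_ : H _ = setT `&` dotv vb.1 @^-1` `[vb.2, +oo[%classic).
    by apply: mdotS => //; exact: measurable_itv.
  by rewrite setTI; apply/seteqP; split => x; rewrite /H /= in_itv/= !andbT.
have WH s : wold_class (\1_(H s)).
  elim: s => [|vb s IH].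
    rewrite (_ : \1_(H [::]) = cst 1); first exact: wold_class1.
    by apply/funext => x; rewrite indicE mem_set.
  rewrite (_ : \1_(H _) = (fun x => \1_(H s) x * (vb.2 <= dotv vb.1 x)%R%:R)).
    exact: wold_class_halfspace.
  apply/funext => x; rewrite !indicE -natrM mulnb; congr (_%:R); congr nat_of_bool.
  by apply/idP/andP; rewrite !inE /H /=; [move=> /andP[]|move=> [-> ->]].
have PG s : Pr (X @^-1` H s) = Pr (X' @^-1` H s).
  have PE (n : {mfun T >-> S}) : Pr (n @^-1` H s) = (\int[Pr]_w \1_(H s) (n w))%R%:E.
    have mn : measurable (n @^-1` H s) by exact: measurable_funPTI.
    have E : (\int[Pr]_w (\1_(H s) (n w))%:E = Pr (n @^-1` H s))%E.
      rewrite (_ : (fun w => _) = (fun w => (\1_(n @^-1` H s) w)%:E))//.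
      by rewrite integral_indic ?setIT.
    by rewrite /Rintegral E fineK// fin_num_measure.
  rewrite (PE n1) (PE n2); congr EFin.
  have [_ _ _ /(_ 0 0)] := WH s.
  have z Y (w : T) : \1_(H s) (Y w) * cos (dotv 0 (Y w) + 0) = \1_(H s) (Y w).
    by rewrite /dotv trmx0 mul0mx mxE addr0 cos0 mulr1.
  by under eq_Rintegral do rewrite z; under [RHS]eq_Rintegral do rewrite z.
have genG : <<s gen >> `<=` <<s G >>.
  apply: smallest_sub; first exact: smallest_sigma_algebra.
  move=> _ [i _ [C mC <-]]; rewrite setTI.
  pose S' := g_sigma_algebraType G.
  have : measurable_fun setT (fun x : S' => x i 0 : R).
    apply: (measurability _ (RGenCInfty.measurableE R)) => //.
    move=> _ [_ [b ->] <-]; rewrite setTI; apply: sub_sigma_algebra.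
    exists [:: (delta_mx i 0, b)] => //.
    apply/seteqP; split => x; rewrite /H /= in_itv/= dotv_delta !andbT//.
  by move=> /(_ measurableT _ mC); rewrite setTI.
apply: (@g_sigma_algebra_measure_unique _ R S G _ (fun=> setT) _ _ (distribution Pr n1) (distribution Pr n2)).
- by move=> _ [s _ <-]; exact: mH.
- by move=> _; exists [::] => //; apply/seteqP; split.
- by rewrite bigcup_const.
- by move=> _ _ [s _ <-] [s' _ <-]; exists (s ++ s').
- by move=> _ [s _ <-]; exact: PG.
- by move=> _; rewrite /= probability_setT ltry.
- exact: genG.
Qed.

End CramerWold.

(** * Centred normal variables *)

Section Density.
Import HBNNSimple.
Context d (E : measurableType d) (R : realType).
Variables (mu nu : {measure set E -> \bar R}) (f : E -> R).
Hypothesis mf : measurable_fun setT f.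
Hypothesis f0 : forall x, 0 <= f x.
Hypothesis nuE : forall A, measurable A -> (nu A = \int[mu]_(x in A) (f x)%:E)%E.

Local Open Scope ereal_scope.

Lemma integral_density (h : E -> \bar R) :
  measurable_fun setT h -> (forall x, 0 <= h x) ->
  \int[nu]_x h x = \int[mu]_x (h x * (f x)%:E).
Proof.
move=> mh h0.
pose h_ := nnsfun_approx measurableT mh.
have h_cvg x : EFin \o h_ ^~ x @ \oo --> h x by exact: cvg_nnsfun_approx.
have mfE : measurable_fun setT (EFin \o f) by exact/measurable_EFinP.
transitivity (limn (fun n => \int[nu]_x (h_ n x)%:E)).
  rewrite -monotone_convergence//.
  - by apply: eq_integral => y _; apply/esym/cvg_lim => //; exact: h_cvg.
  - by move=> n; exact/measurable_EFinP.
  - by move=> n y _; rewrite lee_fin.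
  - by move=> y _ m n mn; rewrite lee_fin; exact/lefP/nd_nnsfun_approx.
rewrite [X in limn X](_ : _ = (fun n => \int[mu]_x ((h_ n x)%:E * (f x)%:E))).
  rewrite -monotone_convergence//; last 3 first.
  - by move=> n; apply: emeasurable_funM => //; exact/measurable_EFinP.
  - by move=> n x _; rewrite mule_ge0 ?lee_fin.
  - move=> x _ m n mn; rewrite lee_wpmul2r ?lee_fin//.
    exact/lefP/nd_nnsfun_approx.
  apply: eq_integral => x _; apply/cvg_lim => //.
  by apply: cvgeZr => //; exact: h_cvg.
apply/funext => n.
transitivity (\sum_(k \in range (h_ n)) (k%:E * nu (h_ n @^-1` [set k]))).
  by rewrite integralT_nnsfun sintegralE.
transitivity (\sum_(k \in range (h_ n))
    \int[mu]_x ((k * \1_(h_ n @^-1` [set k]) x)%:E * (f x)%:E)); last first.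
  rewrite -ge0_integral_fsum//; last 2 first.
  - move=> y; apply: emeasurable_funM => //.
    exact/measurable_EFinP/measurable_funM.
  - by move=> y x _; rewrite mule_ge0 ?nnfun_muleindic_ge0 ?lee_fin.
  apply: eq_integral => x _.
  rewrite [in RHS]fimfunE -fsumEFin// ge0_mule_fsuml// => y.
  by rewrite nnfun_muleindic_ge0.
apply: eq_fsbigr => k; rewrite inE => -[x _ <-].
rewrite nuE//.
transitivity (\int[mu]_y ((h_ n x)%:E * (\1_(h_ n @^-1` [set h_ n x]) y * f y)%:E)).
  have m1 : measurable_fun setT (fun y => (\1_(h_ n @^-1` [set h_ n x]) y * f y)%:E).
    by apply/measurable_EFinP; apply: measurable_funM => //; exact: measurable_indic.
  rewrite ge0_integralZl//; last 2 first.
  - by move=> y _; rewrite lee_fin mulr_ge0.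
  - by rewrite lee_fin.
  congr (_ * _); rewrite integral_mkcond; apply: eq_integral => y _.
  rewrite patchE indicE; case: ifP => _; by rewrite ?mul1r ?mul0r.
by apply: eq_integral => y _; rewrite -!EFinM mulrA.
Qed.

End Density.

Section LebesgueAffine.
Context (R : realType).
Local Notation mu := (@lebesgue_measure R).
Local Open Scope ereal_scope.

Let mshift (a : R) : measurable_fun setT (fun x : R => (a + x)%R : measurableTypeR R).
Proof. exact: measurable_funD. Qed.

Let mscal (a : R) : measurable_fun setT (fun x : R => (a * x)%R : measurableTypeR R).
Proof. exact: measurable_funM. Qed.

Lemma lebesgue_measure_shift (a : R) (A : set R) : measurable A ->
  mu ((fun x => (a + x)%R) @^-1` A) = mu A.
Proof.
pose phi := fun x : R => (a + x)%R : measurableTypeR R.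
move=> mA; rewrite -[LHS]/(pushforward mu phi A).
apply/esym/lebesgue_measure_unique => //=; first exact: mshift.
move=> _ _ [[x y]] _ <-.
rewrite /pushforward/= (_ : _ @^-1` _ = `](x - a)%R, (y - a)%R]%classic); last first.
  by apply/seteqP; split => z; rewrite /= !in_itv/= ltrBlDl lerBrDl.
rewrite !lebesgue_measure_itv/= !lte_fin ltrD2r.
by case: ifP => // _; rewrite -!EFinD; congr EFin; ring.
Qed.

Lemma integral_shift (a : R) (f : R -> \bar R) : measurable_fun setT f ->
  (forall x, 0 <= f x) -> \int[mu]_x f (a + x)%R = \int[mu]_x f x.
Proof.
move=> mf f0.
pose phi := fun x : R => (a + x)%R : measurableTypeR R.
transitivity (\int[pushforward mu phi]_x f x).
  by rewrite ge0_integral_pushforward//; exact: mshift.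
by apply: eq_measure_integral => //=; [exact: mshift|move=> m1 A mA _; exact: lebesgue_measure_shift].
Qed.

Lemma lebesgue_measure_scale (a : R) (A : set R) : a != 0%R -> measurable A ->
  `|a|%:E * mu ((fun x => (a * x)%R) @^-1` A) = mu A.
Proof.
move=> a0 mA.
have [nu nuE] : exists nu : {measure set (measurableTypeR R) -> \bar R},
    forall B, nu B = mu ((fun x => (a * x)%R) @^-1` B).
  unshelve eexists (pushforward mu (fun x : R => (a * x)%R : measurableTypeR R)).
    exact: mscal.
  by [].
rewrite -nuE -[LHS]/(mscale (NngNum (normr_ge0 a)) nu A).
apply/esym/lebesgue_measure_unique => //= _ [[x y]] _ <-.
rewrite /mscale/= nuE.
have [a1|a1] := ltP 0%R a.
  rewrite (_ : _ @^-1` _ = `](x / a)%R, (y / a)%R]%classic); last first.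
    by apply/seteqP; split => z; rewrite /= !in_itv/= ltr_pdivrMr// ler_pdivlMr// mulrC.
  rewrite !lebesgue_measure_itv/= !lte_fin ltr_pM2r ?invr_gt0//.
  case: ifP => _; last by rewrite mule0.
  by rewrite -!EFinD -EFinM gtr0_norm//; congr EFin; field.
have {}a1 : (a < 0)%R by rewrite lt_neqAle a0.
rewrite (_ : _ @^-1` _ = `[(y / a)%R, (x / a)%R[%classic); last first.
  by apply/seteqP; split => z; rewrite /= !in_itv/= ltr_ndivlMr// ler_ndivrMr// mulrC andbC.
rewrite !lebesgue_measure_itv/= !lte_fin ltr_nM2r ?invr_lt0//.
case: ifP => _; last by rewrite mule0.
by rewrite -!EFinD -EFinM ltr0_norm//; congr EFin; field.
Qed.

Lemma integral_scale (a : R) (f : R -> \bar R) : a != 0%R -> measurable_fun setT f ->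
  (forall x, 0 <= f x) ->
  `|a|%:E * \int[mu]_x f (a * x)%R = \int[mu]_x f x.
Proof.
move=> a0 mf f0.
have [nu nuE] : exists nu : {measure set (measurableTypeR R) -> \bar R},
    nu = pushforward mu (fun x : R => (a * x)%R : measurableTypeR R) :> (set _ -> _).
  unshelve eexists (pushforward mu (fun x : R => (a * x)%R : measurableTypeR R)).
    exact: mscal.
  by [].
transitivity (\int[mscale (NngNum (normr_ge0 a)) nu]_x f x).
  rewrite ge0_integral_mscale//=; congr (_ * _); rewrite nuE.
  by rewrite ge0_integral_pushforward//; exact: mscal.
apply: eq_measure_integral => //= A mA _.
by rewrite /mscale/= nuE; exact: lebesgue_measure_scale.
Qed.

End LebesgueAffine.

Section NormalDensity.
Context (R : realType).
Local Notation mu := (@lebesgue_measure R).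

Lemma normal_pdf_scale (c s y : R) : c != 0 -> s != 0 ->
  `|c| * normal_pdf 0 (`|c| * s) (c * y) = normal_pdf 0 s y.
Proof.
move=> c0 s0; have cs0 : `|c| * s != 0 by rewrite mulf_neq0// normr_eq0.
rewrite !normal_pdfE// /normal_peak /normal_fun !subr0 mulrA; congr (_ * _).
  have -> : (`|c| * s) ^+ 2 * pi *+ 2 = `|c| ^+ 2 * (s ^+ 2 * pi *+ 2).
    by rewrite exprMn; ring.
  by rewrite sqrtrM ?sqr_ge0// sqrtr_sqr normr_id invfM mulrA divff ?mul1r ?normr_eq0.
congr expR; rewrite !exprMn real_normK ?num_real//.
by field; rewrite c0 s0.
Qed.

Lemma normal_pdf_shift (x t y : R) : normal_pdf x t (x + y) = normal_pdf 0 t y \/ t = 0.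
Proof.
have [->|t0] := eqVneq t 0; [by right|left].
by rewrite !normal_pdfE// /normal_fun subr0 addrAC subrr add0r.
Qed.

(** Completing the square. *)
Lemma normal_pdf_mul (s t x z : R) : 0 < s -> 0 < t ->
  let r := Num.sqrt (s ^+ 2 + t ^+ 2) in
  normal_pdf 0 s x * normal_pdf x t z =
  normal_pdf 0 r z * normal_pdf (z * s ^+ 2 / r ^+ 2) (s * t / r) x.
Proof.
move=> s0 t0 r.
have r2 : r ^+ 2 = s ^+ 2 + t ^+ 2 by rewrite sqr_sqrtr// addr_ge0// sqr_ge0.
have r0 : 0 < r by rewrite sqrtr_gt0 addr_gt0// exprn_gt0.
have str0 : 0 < s * t / r by rewrite divr_gt0// mulr_gt0.
rewrite !normal_pdfE ?gt_eqF// mulrACA [RHS]mulrACA; congr (_ * _).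
  rewrite /normal_peak -!invfM; congr (_^-1).
  have pos a : 0 <= a ^+ 2 * pi *+ 2 :> R.
    by rewrite mulrn_wge0// mulr_ge0 ?sqr_ge0// pi_ge0.
  rewrite -!sqrtrM//; congr Num.sqrt.
  by field; rewrite gt_eqF.
rewrite /normal_fun -!expRD; congr expR.
rewrite subr0 !exprMn exprVn r2.
field; rewrite !gt_eqF//= -r2 exprn_gt0//.
Qed.

Lemma measurable_normal_pdf2 (t : R) : t != 0 ->
  measurable_fun setT (fun xz : R * R => normal_pdf xz.1 t xz.2).
Proof.
move=> t0; under eq_fun do rewrite normal_pdfE//.
apply: measurable_funM => //; apply: measurableT_comp => //.
apply: measurable_funM => //; apply: measurableT_comp => //.
by apply: measurable_funX; exact: measurable_funB.
Qed.

Local Open Scope ereal_scope.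

Lemma normal_probE (m s : R) (B : set R) :
  normal_prob m s B = \int[mu]_x (\1_B x * normal_pdf m s x)%:E.
Proof.
rewrite /normal_prob integral_mkcond; apply: eq_integral => x _.
by rewrite patchE indicE; case: ifP => _; rewrite ?mul1r ?mul0r.
Qed.

Lemma normal_prob_scale (c s : R) (B : set R) : c != 0%R -> (0 < s)%R -> measurable B ->
  normal_prob 0 s ((fun y => c * y)%R @^-1` B) = normal_prob 0 (`|c| * s)%R B.
Proof.
move=> c0 s0 mB; have mI : measurable_fun setT (\1_B : R -> R) by exact: measurable_indic.
rewrite !normal_probE -[RHS](integral_scale c0); last 2 first.
- apply/measurable_EFinP; apply: measurable_funM; first exact: measurable_indic.
  exact: measurable_normal_pdf.
- by move=> x; rewrite lee_fin mulr_ge0// normal_pdf_ge0.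
rewrite -ge0_integralZl//; last 2 first.
- apply/measurable_EFinP; apply: measurable_funM.
    apply: (measurableT_comp mI); exact: measurable_funM.
  apply: (measurableT_comp (measurable_normal_pdf _ _)); exact: measurable_funM.
- by move=> x _; rewrite lee_fin mulr_ge0// normal_pdf_ge0.
apply: eq_integral => x _; rewrite -EFinM; congr EFin.
by rewrite [RHS]mulrCA normal_pdf_scale// gt_eqF.
Qed.

Lemma normal_prob_shift (x t : R) (B : set R) : (0 < t)%R -> measurable B ->
  normal_prob 0 t ((fun y => x + y)%R @^-1` B) = normal_prob x t B.
Proof.
move=> t0 mB; rewrite !normal_probE -[RHS](integral_shift x); last 2 first.
- apply/measurable_EFinP; apply: measurable_funM; first exact: measurable_indic.
  exact: measurable_normal_pdf.
- by move=> y; rewrite lee_fin mulr_ge0// normal_pdf_ge0.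
apply: eq_integral => y _; congr EFin; congr (_ * _)%R.
by case: (normal_pdf_shift x t y) => // t00; rewrite t00 ltxx in t0.
Qed.

Lemma integral_normal_prob (m s : R) (f : R -> \bar R) : measurable_fun setT f ->
  (forall x, 0 <= f x) ->
  \int[normal_prob m s]_x f x = \int[mu]_x (f x * (normal_pdf m s x)%:E).
Proof.
move=> mf f0; apply: (integral_density (mu := mu)) => //.
- exact: measurable_normal_pdf.
- by move=> x; exact: normal_pdf_ge0.
Qed.

Lemma measurable_normal_prob (t : R) (B : set R) : (0 < t)%R -> measurable B ->
  measurable_fun setT (fun x => normal_prob x t B).
Proof.
move=> t0 mB; have mI : measurable_fun setT (\1_B : R -> R) by exact: measurable_indic.
have mk : measurable_fun setT (fun xz : R * R => (\1_B xz.2 * normal_pdf xz.1 t xz.2)%:E).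
  apply/measurable_EFinP; apply: measurable_funM.
    by apply: (measurableT_comp mI).
  by apply: measurable_normal_pdf2; rewrite gt_eqF.
under eq_fun do rewrite normal_probE.
apply: (measurable_fun_fubini_tonelli_F (m2 := mu) _ mk).
by move=> x; rewrite lee_fin mulr_ge0// normal_pdf_ge0.
Qed.

Lemma normal_prob_convolution (s t : R) (B : set R) :
  (0 < s)%R -> (0 < t)%R -> measurable B ->
  \int[normal_prob 0 s]_x normal_prob x t B =
  normal_prob 0 (Num.sqrt (s ^+ 2 + t ^+ 2)) B.
Proof.
move=> s0 t0 mB.
have mI : measurable_fun setT (\1_B : R -> R) by exact: measurable_indic.
have mk : measurable_fun setT (fun xz : R * R => (\1_B xz.2 * normal_pdf xz.1 t xz.2)%:E).
  apply/measurable_EFinP; apply: measurable_funM.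
    by apply: (measurableT_comp mI).
  by apply: measurable_normal_pdf2; rewrite gt_eqF.
have mF := measurable_normal_prob t0 mB.
rewrite integral_normal_prob//.
rewrite [RHS]normal_probE.
transitivity (\int[mu]_x \int[mu]_z ((\1_B z * normal_pdf x t z)%:E * (normal_pdf 0 s x)%:E)).
  apply: eq_integral => x _; rewrite normal_probE ge0_integralZr//.
  - by apply/measurable_EFinP; apply: measurable_funM => //; exact: measurable_normal_pdf.
  - by move=> z _; rewrite lee_fin mulr_ge0// normal_pdf_ge0.
  - by rewrite lee_fin normal_pdf_ge0.
rewrite (fubini_tonelli (m1 := mu) (m2 := mu) (fun xz => (\1_B xz.2 * normal_pdf xz.1 t xz.2)%:E * (normal_pdf 0 s xz.1)%:E))/=; last 2 first.
- apply: emeasurable_funM => //; apply/measurable_EFinP.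
  by apply: (measurableT_comp (measurable_normal_pdf _ _)).
- by move=> x; rewrite mule_ge0// lee_fin ?mulr_ge0// normal_pdf_ge0.
apply: eq_integral => z _.
under eq_integral => x _.
  rewrite -EFinM -mulrA (mulrC (normal_pdf x t z)) normal_pdf_mul// mulrA EFinM.
  over.
rewrite ge0_integralZl//.
- by rewrite integral_normal_pdf mule1.
- by apply/measurable_EFinP; exact: measurable_normal_pdf.
- by move=> x _; rewrite lee_fin normal_pdf_ge0.
- by rewrite lee_fin mulr_ge0// normal_pdf_ge0.
Qed.

End NormalDensity.

Section NormalVariables.
Context (dT : measure_display) (T : measurableType dT) (R : realType).
Variable Pr : probability T R.
Local Notation mu := (@lebesgue_measure R).

Let measurable_preimageR (f : R -> R) B : measurable_fun setT f -> measurable B ->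
  measurable (f @^-1` B).
Proof. by move=> mf mB; rewrite -[X in measurable X]setTI; exact: mf. Qed.

Lemma integral_centered_normal (s : R) (Y : T -> R) (f : R -> \bar R) :
  measurable_fun setT Y -> centered_normal Pr s Y ->
  measurable_fun setT f -> (forall x, 0 <= f x)%E ->
  (\int[Pr]_w f (Y w) = \int[normal_prob 0 s]_x f x)%E.
Proof.
move=> mY Ns mf f0.
have mY' : measurable_fun setT (Y : T -> measurableTypeR R) := mY.
pose Y1 : {mfun T >-> measurableTypeR R} :=
  HB.pack (Y : T -> measurableTypeR R) (isMeasurableFun.Build _ _ _ _ _ mY').
rewrite -[LHS](@ge0_integral_distribution _ _ _ _ _ Pr Y1 f)//.
by apply: eq_measure_integral => B mB _; exact: Ns.
Qed.

Lemma centered_normal_scale (c s : R) (Y : T -> R) : c != 0 -> 0 < s ->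
  centered_normal Pr s Y -> centered_normal Pr (`|c| * s) (fun w => c * Y w).
Proof.
move=> c0 s0 Ns B mB; rewrite -normal_prob_scale// -Ns//.
by apply: measurable_preimageR => //; exact: measurable_funM.
Qed.

Lemma centered_normal_add (s t : R) (X Y : {RV Pr >-> R}) : 0 < s -> 0 < t ->
  (forall A B, measurable A -> measurable B ->
     Pr (X @^-1` A `&` Y @^-1` B) = (Pr (X @^-1` A) * Pr (Y @^-1` B))%E) ->
  centered_normal Pr s X -> centered_normal Pr t Y ->
  centered_normal Pr (Num.sqrt (s ^+ 2 + t ^+ 2)) (fun w => X w + Y w).
Proof.
move=> s0 t0 ind NX NY B mB.
have mXY : measurable_fun setT (fun w => X w + Y w) by exact: measurable_funD.
have mXYB : measurable ((fun w => X w + Y w) @^-1` B).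
  by rewrite -[X in measurable X]setTI; exact: mXY.
have -> : Pr ((fun w => X w + Y w) @^-1` B) = (\int[Pr]_w (\1_B (X w + Y w))%:E)%E.
  rewrite (_ : (fun w => _) = (fun w => (\1_((fun w => X w + Y w) @^-1` B) w)%:E))//.
  by rewrite integral_indic ?setIT.
have mI : measurable_fun setT (\1_B : R -> R) by exact: measurable_indic.
have mh : measurable_fun setT (fun z : R * R => (\1_B (z.1 + z.2))%:E : \bar R).
  apply/measurable_EFinP; apply: (measurableT_comp mI).
  exact: measurable_funD.
rewrite (@integral_independent _ T R Pr _ _ R R X Y (fun z : R * R => (\1_B (z.1 + z.2))%:E) ind mh)//=.
have mF := measurable_normal_prob t0 mB.
rewrite -normal_prob_convolution// -(@integral_centered_normal s X)//.
apply: eq_integral => w _; rewrite -normal_prob_shift//.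
have mB' : measurable ((fun y : R => X w + y) @^-1` B).
  by apply: measurable_preimageR => //; exact: measurable_funD.
rewrite -NY//.
rewrite (_ : (fun y => _) = (fun y => (\1_(Y @^-1` ((fun y => X w + y) @^-1` B)) y)%:E))//.
by rewrite integral_indic ?setIT//; exact: measurable_funPTI.
Qed.

Lemma centered_normal_moment (s p : R) (Y : T -> R) : 0 < s -> 0 <= p ->
  measurable_fun setT Y -> centered_normal Pr s Y ->
  (\int[Pr]_w (`|Y w| `^ p)%:E < +oo)%E.
Proof.
move=> s0 p0 mY NY.
have mp : measurable_fun setT (fun x : R => (`|x| `^ p)%:E).
  apply/measurable_EFinP; apply: (measurableT_comp (measurable_powR p)).
  exact: normr_measurable.
rewrite (integral_centered_normal mY NY mp)//.
rewrite integral_normal_prob//.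
(* With this [a], the product of [exp (a x ^ 2)] and of the density of deviation
   [s] is a multiple of the density of deviation [2 s]. *)
pose a : R := 3 / (8 * s ^+ 2).
have a0 : 0 < a by rewrite divr_gt0// mulr_gt0// exprn_gt0.
pose C := expR (p ^+ 2 / (4 * a)) * 2.
apply: (@le_lt_trans _ _ (\int[mu]_x (C * normal_pdf 0 (2 * s) x)%:E)%E); last first.
  under eq_integral do rewrite EFinM.
  rewrite ge0_integralZl//.
  - by rewrite integral_normal_pdf mule1 ltry.
  - by apply/measurable_EFinP; exact: measurable_normal_pdf.
  - by move=> x _; rewrite lee_fin normal_pdf_ge0.
  - by rewrite lee_fin mulr_ge0// expR_ge0.
apply: ge0_le_integral => //.
- by move=> x _; rewrite mule_ge0// lee_fin ?powR_ge0// normal_pdf_ge0.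
- by apply: emeasurable_funM => //; apply/measurable_EFinP; exact: measurable_normal_pdf.
- by apply/measurable_EFinP; apply: measurable_funM => //; exact: measurable_normal_pdf.
move=> x _; rewrite -EFinM lee_fin.
have s20 : 0 < 2 * s by rewrite mulr_gt0.
rewrite !normal_pdfE ?gt_eqF// /normal_peak /normal_fun !subr0.
have -> : (2 * s) ^+ 2 * pi *+ 2 = 2 ^+ 2 * (s ^+ 2 * pi *+ 2) by rewrite exprMn; ring.
rewrite sqrtrM// sqrtr_sqr (ger0_norm (ler0n R 2)) invfM.
rewrite mulrCA [leRHS]mulrCA (mulrC 2^-1) -!mulrA ler_wpM2l ?invr_ge0// /C.
have bound : `|x| `^ p <= expR (p ^+ 2 / (4 * a)) * expR (a * x ^+ 2).
  apply: (@le_trans _ _ (expR (p * `|x|))).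
    have [->|x0] := eqVneq `|x| 0.
      rewrite mulr0 expR0; have [->|p1] := eqVneq p 0; first by rewrite powRr0.
      by rewrite powR0.
    rewrite /powR (negbTE x0) ler_expR ler_wpM2l// ltW// ln_sublinear//.
    by rewrite lt_def x0 normr_ge0.
  rewrite -expRD ler_expR.
  have -> : x ^+ 2 = `|x| ^+ 2 by rewrite real_normK// num_real.
  have : 0 <= (2 * a * `|x| - p) ^+ 2 / (4 * a) by rewrite divr_ge0 ?sqr_ge0// mulr_ge0// ltW.
  have -> : (2 * a * `|x| - p) ^+ 2 / (4 * a) = p ^+ 2 / (4 * a) + a * `|x| ^+ 2 - p * `|x|.
    by field; rewrite gt_eqF.
  by rewrite subr_ge0.
apply: le_trans (ler_wpM2r (expR_ge0 _) bound) _.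
have half (u v : R) : 2^-1 * (u * (2 * v)) = u * v by field.
rewrite half -!expRD ler_expR (mulrA p) -expr2 -addrA lerD2l /a exprMn.
have : s ^+ 2 != 0 by rewrite expf_neq0// gt_eqF.
move: (s ^+ 2) (x ^+ 2) => q y q0.
by rewrite le_eqVlt; apply/orP; left; apply/eqP; field.
Qed.

Lemma centered_normal_support (s a b : R) (Y : T -> R) : 0 < s -> 0 <= a -> a < b ->
  centered_normal Pr s Y -> (0 < Pr (Y @^-1` `]a, b[))%E.
Proof.
move=> s0 a0 ab NY; rewrite NY; last exact: measurable_itv.
apply: (@lt_le_trans _ _ (\int[mu]_(x in `]a, b[) (normal_pdf 0 s b)%:E)%E).
  rewrite integral_cst//= lebesgue_measure_itv/= lte_fin ab.
  rewrite -EFinD -EFinM lte_fin mulr_gt0 ?subr_gt0//.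
  by rewrite normal_pdfE ?gt_eqF// mulr_gt0 ?expR_gt0// normal_peak_gt0// gt_eqF.
apply: ge0_le_integral => //=.
- by move=> x _; rewrite lee_fin normal_pdf_ge0.
- by apply/measurable_EFinP; apply: measurable_funTS; exact: measurable_normal_pdf.
move=> x; rewrite in_itv/= => /andP[ax xb].
rewrite lee_fin !normal_pdfE ?gt_eqF// ler_wpM2l ?normal_peak_ge0//.
rewrite /normal_fun !subr0 ler_expR ler_wpM2r ?invr_ge0 ?mulrn_wge0 ?sqr_ge0//.
by rewrite lerN2 lerXn2r ?nnegrE; lra.
Qed.

End NormalVariables.

(** * Scalar random recurrences *)

Section Perpetuity.
Context (R : realType).
Implicit Types (a b : int -> R) (t : int).

(** [rterm a b t k] is the product [a t * ... * a (t - k + 1) * b (t - k)], the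
contribution of time [t - k] to the value at time [t] of a solution of
[y t = a t * y (t - 1) + b t]. *)
Fixpoint rterm a b t (k : nat) : R :=
  if k is j.+1 then a t * rterm a b (t - 1) j else b t.

Definition rsum a b t (n : nat) : R := \sum_(0 <= k < n) rterm a b t k.

(** The upper limit makes the value measurable in [(a, b)] even where the
series diverges. *)
Definition perp a b t : R := fine (limn_esup (fun n => (rsum a b t n)%:E)).

Lemma rsumS a b t n : rsum a b t n.+1 = b t + a t * rsum a b (t - 1) n.
Proof.
rewrite /rsum big_nat_recl//=; congr (_ + _).
by rewrite mulr_sumr.
Qed.

Lemma perp_cvg a b t y : rsum a b t n @[n --> \oo] --> y -> perp a b t = y.
Proof.
move=> ab_y; rewrite /perp.
have cv : (rsum a b t n)%:E @[n --> \oo] --> y%:E by apply: cvg_EFin => //; exact: nearW.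
by rewrite is_cvg_limn_esupE; [rewrite (cvg_lim _ cv)|apply/cvg_ex; exists y%:E].
Qed.

Lemma perp_rec a b t : cvgn (rsum a b (t - 1)) ->
  perp a b t = a t * perp a b (t - 1) + b t.
Proof.
move=> /cvg_ex[y cy]; rewrite (perp_cvg cy) addrC; apply: perp_cvg.
rewrite -cvg_shiftS; under eq_fun do rewrite rsumS.
by apply: cvgD; [exact: cvg_cst|exact: cvgMr].
Qed.

Lemma rsum_bounded a b t (x r : R) : 0 < r -> r < 1 ->
  (forall k, `|rterm a b t k| <= x * (1 - r) * r ^+ k) ->
  cvgn (rsum a b t) /\ `|perp a b t| <= x.
Proof.
move=> r0 r1 bnd.
have x0 : 0 <= x * (1 - r) by have := le_trans (normr_ge0 _) (bnd 0%N); rewrite expr0 mulr1.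
have rn : `|r| < 1 by rewrite ger0_norm// ltW.
have gc := @cvg_geometric_series R (x * (1 - r)) r rn.
have nc : cvgn [normed series (rterm a b t)].
  have gcc : cvgn (series (geometric (x * (1 - r)) r)).
    by apply/cvg_ex; eexists; exact: gc.
  apply: series_le_cvg gcc => [n|n|n]; first exact: normr_ge0.
  - by rewrite /= mulr_ge0// exprn_ge0// ltW.
  - exact: bnd.
have cs := normed_cvg nc.
split; first exact: cs.
rewrite (perp_cvg cs); apply: le_trans (lim_series_norm nc) _.
apply: limr_le => //; apply: nearW => n.
have -> : x = x * (1 - r) * (1 - r)^-1 by rewrite mulfK// gt_eqF// subr_gt0.
rewrite -(cvg_lim _ gc)//; apply: le_trans (_ : series (geometric (x * (1 - r)) r) n <= _).
  by apply: ler_sum => k _; exact: bnd.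
apply: nondecreasing_cvgn_le; last by apply/cvg_ex; eexists; exact: gc.
apply: nondecreasing_series => k _ _ /=.
by rewrite mulr_ge0// exprn_ge0 ?(ltW r0).
Qed.

Lemma rtermM a b t k : rterm a b t k = rterm a (cst 1) t k * b (t - k%:Z).
Proof.
elim: k t => [|k IH] t /=; first by rewrite mul1r subr0.
rewrite IH mulrA; congr (_ * b _).
by rewrite -addn1 PoszD opprD addrA addrAC.
Qed.

Lemma rterm_shift a b t h k :
  rterm a b (t + h) k = rterm (fun s => a (s + h)) (fun s => b (s + h)) t k.
Proof. by elim: k t => [//|k IH] t /=; rewrite -IH addrAC. Qed.

Lemma perp_shift a b t h :
  perp a b (t + h) = perp (fun s => a (s + h)) (fun s => b (s + h)) t.
Proof.
rewrite /perp; congr (fine (limn_esup _)); apply/funext => n.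
by congr EFin; apply: eq_bigr => k _; exact: rterm_shift.
Qed.

Lemma rtermN a b t k : rterm a (fun s => - b s) t k = - rterm a b t k.
Proof. by elim: k t => [//|k IH] t /=; rewrite IH mulrN. Qed.

Lemma perpN a b t : cvgn (rsum a b t) -> perp a (fun s => - b s) t = - perp a b t.
Proof.
move=> /cvg_ex[y cy]; rewrite (perp_cvg cy); apply: perp_cvg.
rewrite (_ : rsum _ _ _ = (fun n => - rsum a b t n)); first exact: cvgN.
by apply/funext => n; rewrite /rsum -sumrN; apply: eq_bigr => k _; exact: rtermN.
Qed.

End Perpetuity.

Section MeasurablePerpetuity.
Context (R : realType) (d : measure_display) (Om : measurableType d).
Variables (a b : int -> Om -> R) (t0 : int).
Hypothesis ma : forall t, t <= t0 -> measurable_fun setT (a t).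
Hypothesis mb : forall t, t <= t0 -> measurable_fun setT (b t).

Lemma measurable_rterm t k : t <= t0 ->
  measurable_fun setT (fun w => rterm (a^~ w) (b^~ w) t k).
Proof.
elim: k t => [|k IH] t tt0 /=; first exact: mb.
by apply: measurable_funM; [exact: ma|apply: IH; lia].
Qed.

Lemma measurable_perp t : t <= t0 ->
  measurable_fun setT (fun w => perp (a^~ w) (b^~ w) t).
Proof.
move=> tt0; apply: measurableT_comp => //.
apply: (measurable_fun_limn_esup (f := fun n w => (rsum (a^~ w) (b^~ w) t n)%:E)) => n.
apply/measurable_EFinP; apply: measurable_sum => k; exact: measurable_rterm.
Qed.

End MeasurablePerpetuity.

Section SubSigmaAlgebra.
Context (dT : measure_display) (T : measurableType dT) (R : realType).
Variable Pr : probability T R.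

Definition sub_measurable (G : set_system T) d (E : measurableType d) (f : T -> E) :=
  measurable_fun setT (f : g_sigma_algebraType G -> E).

Lemma sub_measurable_preimage (G : set_system T) d (E : measurableType d) (f : T -> E) B :
  sub_measurable G f -> measurable B -> <<s G >> (f @^-1` B).
Proof. by move=> mf mB; have := mf measurableT B mB; rewrite setTI. Qed.

Lemma sub_measurable_sub (G G' : set_system T) d (E : measurableType d) (f : T -> E) :
  G `<=` <<s G' >> -> sub_measurable G f -> sub_measurable G' f.
Proof.
move=> GG' mf _ B mB; rewrite setTI.
suff : <<s G >> `<=` <<s G' >> by apply; exact: sub_measurable_preimage.
by apply: smallest_sub => //; exact: smallest_sigma_algebra.
Qed.

Lemma sub_measurableW (G : set_system T) d (E : measurableType d) (f : T -> E) :
  G `<=` measurable -> sub_measurable G f -> measurable_fun setT f.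
Proof.
move=> Gm mf _ B mB; rewrite setTI.
suff : <<s G >> `<=` measurable by apply; exact: sub_measurable_preimage.
by apply: smallest_sub => //; exact: sigma_algebra_measurable.
Qed.

Variables G G' : set_system T.
Hypotheses (Gm : G `<=` measurable) (Gm' : G' `<=` measurable).
Hypothesis GG' : forall A B, <<s G >> A -> <<s G' >> B ->
  Pr (A `&` B) = (Pr A * Pr B)%E.

Lemma integral_sub_independent d1 d2 (E1 : measurableType d1) (E2 : measurableType d2)
    (X : T -> E1) (Y : T -> E2) (h : E1 * E2 -> \bar R) :
  sub_measurable G X -> sub_measurable G' Y ->
  measurable_fun setT h -> (forall z, 0 <= h z)%E ->
  (\int[Pr]_w h (X w, Y w) = \int[Pr]_w \int[Pr]_w' h (X w, Y w'))%E.
Proof.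
move=> sX sY mh h0.
pose X1 : {mfun T >-> E1} := HB.pack X (isMeasurableFun.Build _ _ _ _ _ (sub_measurableW Gm sX)).
pose Y1 : {mfun T >-> E2} := HB.pack Y (isMeasurableFun.Build _ _ _ _ _ (sub_measurableW Gm' sY)).
apply: (@integral_independent _ T R Pr _ _ E1 E2 X1 Y1) => // A B mA mB.
by apply: GG'; exact: sub_measurable_preimage.
Qed.

End SubSigmaAlgebra.

Lemma geometric_sum_le (R : realType) (z : R) n : 0 <= z -> z < 1 ->
  \sum_(0 <= k < n) z ^+ k <= (1 - z)^-1.
Proof.
move=> z0 z1; have z1' : 0 < 1 - z by rewrite subr_gt0.
have -> : \sum_(0 <= k < n) z ^+ k = (1 - z ^+ n) / (1 - z).
  elim: n => [|n IH]; first by rewrite big_geq// expr0 subrr mul0r.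
  by rewrite big_nat_recr//= IH exprSr; field; rewrite gt_eqF.
apply: ler_piMl; first by rewrite invr_ge0 ltW.
by rewrite gerBl exprn_ge0.
Qed.

Section AbsoluteMoments.
Context (dT : measure_display) (T : measurableType dT) (R : realType).
Variable Pr : probability T R.

Definition amoment (p : R) (f : T -> R) : \bar R := (\int[Pr]_w (`|f w| `^ p)%:E)%E.

Lemma measurable_apow d (E : measurableType d) (p : R) (f : E -> R) :
  measurable_fun setT f -> measurable_fun setT (fun w => `|f w| `^ p).
Proof.
move=> mf; apply: (measurableT_comp (measurable_powR p)).
by apply: measurableT_comp.
Qed.

Lemma amoment_ge0 p f : (0 <= amoment p f)%E.
Proof. by apply: integral_ge0 => w _; rewrite lee_fin powR_ge0. Qed.

Lemma markov_amoment (p x : R) (f : T -> R) : 0 <= p -> 0 < x -> measurable_fun setT f ->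
  ((x `^ p)%:E * Pr [set w | (x < `|f w|)%R] <= amoment p f)%E.
Proof.
move=> p0 x0 mf.
have mn : measurable_fun setT (fun w => `|f w|) by exact: measurableT_comp.
have mA := measurable_gtr x mn.
rewrite -(setIT [set w | _]) -integral_indic// -ge0_integralZl//; last 2 first.
- by apply/measurable_EFinP; exact: measurable_indic.
- by rewrite lee_fin powR_ge0.
apply: ge0_le_integral => //.
- by move=> w _; rewrite -EFinM lee_fin mulr_ge0// powR_ge0.
- by apply/measurable_EFinP; apply: measurable_funM => //; exact: measurable_indic.
- by apply/measurable_EFinP; exact: measurable_apow.
move=> w _; rewrite -EFinM lee_fin indicE.
have [|] := boolP (w \in _); last by rewrite mulr0 powR_ge0.
rewrite inE/= mulr1 => xf; apply: ge0_ler_powR => //; rewrite ?nnegrE ?(ltW x0)//.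
exact: ltW.
Qed.

(** By Young's inequality [y `^ beta] is at most a convex combination of
[y `^ alpha] and 1, and the inequality is strict for [y] near 0. *)
Lemma amoment_lt1 (alpha beta : R) (f : T -> R) : 0 < beta -> beta < alpha ->
  measurable_fun setT f -> amoment alpha f = 1%E ->
  (forall e, 0 < e -> (0 < Pr [set w | (`|f w| < e)%R])%E) ->
  (amoment beta f < 1)%E.
Proof.
move=> b0 ba mf f1 fsmall.
have a0 : 0 < alpha by exact: lt_trans ba.
pose th := beta / alpha.
have th0 : 0 < th by rewrite divr_gt0.
have th1 : th < 1 by rewrite ltr_pdivrMr// mul1r.
(* Where [`|f w| `^ beta <= c], the inequality holds with a margin [c]. *)
pose c := (1 - th) / 2.
have c0 : 0 < c by rewrite divr_gt0// subr_gt0.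
pose e := c `^ (beta^-1).
have e0 : 0 < e by rewrite powR_gt0.
pose A := [set w | `|f w| < e].
have mA : measurable A.
  have mn : measurable_fun setT (fun w => `|f w|) by exact: measurableT_comp.
  have := mn measurableT `]-oo, e[%classic (measurable_itv _).
  by rewrite setTI; congr measurable; apply/seteqP; split => w /=; rewrite in_itv.
have key w : `|f w| `^ beta + c * \1_A w <= th * `|f w| `^ alpha + (1 - th).
  have Hb : `|f w| `^ beta <= th * `|f w| `^ alpha + (1 - th).
    have := @conjugate_powR R (`|f w| `^ beta) 1 th^-1 (1 - th)^-1 (powR_ge0 _ _) ler01.
    rewrite !invr_gt0 subr_gt0 !invrK => /(_ th0 th1).
    rewrite addrC subrK mulr1 powR1 mul1r => /(_ erefl).
    have E : beta * th^-1 = alpha by rewrite /th; field; rewrite !gt_eqF.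
    rewrite -powRrM E.
    by rewrite [X in _ <= X + _]mulrC.
  rewrite indicE; have [|_] := boolP (w \in A); last by rewrite mulr0 addr0.
  rewrite inE/= mulr1 => fe.
  have fb : `|f w| `^ beta <= c.
    have -> : c = e `^ beta.
      by rewrite /e -powRrM mulVf ?powRr1 ?gt_eqF// ltW.
    by apply: ge0_ler_powR => //; rewrite ?nnegrE ?(ltW b0) ?(ltW e0) ?(ltW fe).
  apply: le_trans (_ : 1 - th <= _); last by rewrite lerDr mulr_ge0 ?powR_ge0 ?(ltW th0).
  have -> : 1 - th = c + c by rewrite /c; field.
  by rewrite lerD2r.
have mfb := measurable_apow beta mf; have mfa := measurable_apow alpha mf.
have : (amoment beta f + c%:E * Pr A <= 1)%E.
  rewrite -(setIT A) -integral_indic// -ge0_integralZl//; last 2 first.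
  - by apply/measurable_EFinP; exact: measurable_indic.
  - by rewrite lee_fin ltW.
  have mfbE : measurable_fun setT (fun w => (`|f w| `^ beta)%:E) by exact/measurable_EFinP.
  have mcA : measurable_fun setT (fun w => (c%:E * (\1_A w)%:E)%E).
    by apply/measurable_EFinP; apply: measurable_funM => //; exact: measurable_indic.
  rewrite -ge0_integralD//; last first.
    by move=> w _; rewrite -EFinM lee_fin mulr_ge0// ltW.
  apply: (@le_trans _ _ (\int[Pr]_w (th%:E * (`|f w| `^ alpha)%:E + (1 - th)%:E))%E).
    apply: ge0_le_integral => //.
    - by move=> w _; rewrite -EFinM -EFinD lee_fin addr_ge0 ?powR_ge0// mulr_ge0// ltW.
    - apply/measurable_EFinP; apply: measurable_funD => //.
      by apply: measurable_funM => //; exact: measurable_indic.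
    - by apply/measurable_EFinP; apply: measurable_funD => //; exact: measurable_funM.
    - by move=> w _; rewrite -!EFinM -!EFinD lee_fin; exact: key.
  rewrite ge0_integralD//; last 3 first.
  - by move=> w _; rewrite -EFinM lee_fin mulr_ge0 ?powR_ge0// ltW.
  - by apply/measurable_EFinP; exact: measurable_funM.
  - by move=> w _; rewrite lee_fin subr_ge0 ltW.
  have mfaE : measurable_fun setT (fun w => (`|f w| `^ alpha)%:E) by exact/measurable_EFinP.
  rewrite ge0_integralZl//; last by rewrite lee_fin ltW.
  rewrite -/(amoment alpha f) f1 mule1 integral_cst//= probability_setT mule1.
  by rewrite -EFinD lee_fin addrC subrK.
have PA : (Pr A = (fine (Pr A))%:E) by rewrite fineK// fin_num_measure.
have cPA : 0 < c * fine (Pr A).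
  by rewrite mulr_gt0// fine_gt0// fsmall//= ltey_eq fin_num_measure.
rewrite PA -EFinM; have := amoment_ge0 beta f.
case: (amoment beta f) => [r|//|//] _.
rewrite -EFinD !lee_fin lte_fin; lra.
Qed.

End AbsoluteMoments.

(** The coefficient [a t] depends on [pres t], which is independent of the past
up to [t - 1]; so moments of products of coefficients are products of moments. *)
Section ScalarRecursion.
Context (dT : measure_display) (T : measurableType dT) (R : realType).
Variable Pr : probability T R.
Variables (past pres : int -> set_system T) (a : int -> T -> R).
Hypothesis past_meas : forall t, past t `<=` measurable.
Hypothesis pres_past : forall t, pres t `<=` past t.
Hypothesis past_mono : forall s t, s <= t -> past s `<=` past t.
Hypothesis indep : forall t A B, <<s past (t - 1) >> A -> <<s pres t >> B ->
  Pr (A `&` B) = (Pr A * Pr B)%E.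
Hypothesis sa : forall t, sub_measurable (pres t) (a t).

Let sa_past s t : s <= t -> sub_measurable (past t) (a s).
Proof.
move=> st; apply: (sub_measurable_sub _ (@sa s)) => A pA; apply: sub_sigma_algebra.
by apply: (past_mono st); exact: pres_past.
Qed.

Section Terms.
Variable b : int -> T -> R.
Hypothesis sb : forall t, sub_measurable (past t) (b t).

Let sb_past s t : s <= t -> sub_measurable (past t) (b s).
Proof.
move=> st; apply: (sub_measurable_sub _ (@sb s)) => A pA; apply: sub_sigma_algebra.
exact: (past_mono st).
Qed.

Lemma sub_measurable_rterm t k :
  sub_measurable (past t) (fun w => rterm (a^~ w) (b^~ w) t k).
Proof.
exact: (measurable_rterm (Om := g_sigma_algebraType (past t))
  (fun s => @sa_past s t) (fun s => @sb_past s t)).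
Qed.

Lemma sub_measurable_perp t :
  sub_measurable (past t) (fun w => perp (a^~ w) (b^~ w) t).
Proof.
exact: (measurable_perp (Om := g_sigma_algebraType (past t))
  (fun s => @sa_past s t) (fun s => @sb_past s t)).
Qed.

Lemma measurable_rtermT t k : measurable_fun setT (fun w => rterm (a^~ w) (b^~ w) t k).
Proof. exact: sub_measurableW (@past_meas t) (@sub_measurable_rterm t k). Qed.

Lemma measurable_perpT t : measurable_fun setT (fun w => perp (a^~ w) (b^~ w) t).
Proof. exact: sub_measurableW (@past_meas t) (@sub_measurable_perp t). Qed.

Variables (beta rho q : R).
Hypotheses (a_beta : forall t, amoment Pr beta (a t) = rho%:E).
Hypotheses (b_beta : forall t, amoment Pr beta (b t) = q%:E).

Let mpow : measurable_fun setT (fun x : R => (`|x| `^ beta)%:E : \bar R).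
Proof. by apply/measurable_EFinP; apply: measurable_apow. Qed.

Lemma amoment_rterm t k :
  amoment Pr beta (fun w => rterm (a^~ w) (b^~ w) t k) = (rho ^+ k * q)%:E.
Proof.
elim: k t => [|k IH] t; first by rewrite expr0 mul1r b_beta.
rewrite /amoment/=.
under eq_integral do rewrite normrM powRM// mulrC EFinM.
have sY := @sub_measurable_rterm (t - 1) k.
have pm : pres t `<=` measurable by apply: subset_trans (@past_meas t); exact: pres_past.
rewrite (integral_sub_independent (@past_meas (t - 1)) pm (@indep t)
  (h := fun z : R * R => ((`|z.1| `^ beta)%:E * (`|z.2| `^ beta)%:E)%E) sY (@sa t))/=.
- have maE : measurable_fun setT (fun w => (`|a t w| `^ beta)%:E).
    exact: measurableT_comp mpow (sub_measurableW pm (@sa t)).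
  have myE : measurable_fun setT (fun w => (`|rterm (a^~ w) (b^~ w) (t - 1) k| `^ beta)%:E).
    exact: measurableT_comp mpow (@measurable_rtermT _ _).
  transitivity (\int[Pr]_w ((`|rterm (a^~ w) (b^~ w) (t - 1) k| `^ beta)%:E * rho%:E))%E.
    apply: eq_integral => w _; rewrite ge0_integralZl//; try by move=> *; rewrite lee_fin powR_ge0.
    by rewrite -/(amoment Pr beta (a t)) a_beta.
  rewrite ge0_integralZr//; try by move=> *; rewrite -?(a_beta t) ?amoment_ge0// lee_fin powR_ge0.
  by rewrite -/(amoment _ _ _) IH -EFinM exprS mulrC mulrA.
- by apply: emeasurable_funM; apply: (measurableT_comp mpow).
- by move=> z; rewrite mule_ge0// lee_fin powR_ge0.
Qed.

Hypotheses (beta0 : 0 < beta) (rho1 : rho < 1).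

Let rho0 : 0 <= rho. Proof. by rewrite -lee_fin -(a_beta 0) amoment_ge0. Qed.
Let q0 : 0 <= q. Proof. by rewrite -lee_fin -(b_beta 0) amoment_ge0. Qed.

(** Off this event, the series has a geometric majorant of sum [x]. *)
Definition excess (r x : R) t : set T :=
  \bigcup_k [set w | x * (1 - r) * r ^+ k < `|rterm (a^~ w) (b^~ w) t k|].

Lemma measurable_excess r x t : measurable (excess r x t).
Proof.
apply: bigcup_measurable => k _; apply: measurable_gtr.
by apply: measurableT_comp => //; exact: measurable_rtermT.
Qed.

Lemma notin_excess r x t w : 0 < r -> r < 1 -> ~ excess r x t w ->
  cvgn (rsum (a^~ w) (b^~ w) t) /\ `|perp (a^~ w) (b^~ w) t| <= x.
Proof.
move=> r0 r1 nw; apply: (rsum_bounded r0 r1) => k; rewrite leNgt; apply/negP => h.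
by apply: nw; exists k.
Qed.

(** Comparing the series with a geometric one of ratio [r], where
[rho < r `^ beta], the Markov inequalities of its terms sum up. *)
Lemma excess_tail : exists2 r : R, 0 < r < 1 & exists2 C : R, 0 <= C &
  forall t x, 0 < x -> (Pr (excess r x t) <= (C * x `^ (- beta))%:E)%E.
Proof.
have [v [v0 v1 rv]] : exists v : R, [/\ 0 < v, v < 1 & rho < v].
  exists ((1 + rho) / 2); split; first by rewrite divr_gt0// ltr_pwDl.
  - by rewrite ltr_pdivrMr// mul1r; have := rho1; lra.
  - by rewrite ltr_pdivlMr//; have := rho1; lra.
pose r := v `^ beta^-1.
have r0 : 0 < r by rewrite powR_gt0.
have rb : r `^ beta = v by rewrite /r -powRrM mulVf ?powRr1 ?gt_eqF// ltW.
have r1 : r < 1.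
  rewrite ltNge; apply/negP => /(ge0_ler_powR (ltW beta0)).
  by rewrite !nnegrE ler01 (ltW r0) => /(_ isT isT); rewrite powR1 rb leNgt v1.
exists r; first by rewrite r0.
pose z := rho / v.
have z0 : 0 <= z by rewrite divr_ge0// ltW.
have z1 : z < 1 by rewrite /z ltr_pdivrMr// mul1r.
exists (q / (1 - r) `^ beta / (1 - z)).
  by rewrite !divr_ge0 ?powR_ge0// subr_ge0 ltW.
move=> t x x0.
apply: le_trans (generalized_Boole_inequality _ _ _) _.
- move=> k; apply: measurable_gtr.
  by apply: measurableT_comp => //; exact: measurable_rtermT.
- exact: measurable_excess.
set D := q / (1 - r) `^ beta * x `^ (- beta).
have D0 : 0 <= D by rewrite !mulr_ge0 ?invr_ge0 ?powR_ge0.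
have -> : q / (1 - r) `^ beta / (1 - z) * x `^ (- beta) = D / (1 - z).
  by rewrite /D mulrAC.
have term k : (Pr [set w | (x * (1 - r) * r ^+ k < `|rterm (a^~ w) (b^~ w) t k|)%R] <=
    (D * z ^+ k)%:E)%E.
  have y0 : 0 < x * (1 - r) * r ^+ k.
    by rewrite !mulr_gt0 ?exprn_gt0// subr_gt0.
  have := markov_amoment Pr (ltW beta0) y0 (@measurable_rtermT t k).
  rewrite amoment_rterm.
  have -> : (x * (1 - r) * r ^+ k) `^ beta = x `^ beta * (1 - r) `^ beta * v ^+ k.
    rewrite !powRM ?mulr_ge0 ?exprn_ge0 ?subr_ge0 ?(ltW x0) ?(ltW r0) ?(ltW r1)//.
    congr (_ * _); rewrite -rb -(powR_mulrn k (ltW r0)) -(powR_mulrn k (powR_ge0 r beta)).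
    exact: powRAC.
  have w0 : 0 < x `^ beta * (1 - r) `^ beta * v ^+ k.
    by rewrite !mulr_gt0 ?exprn_gt0 ?powR_gt0// subr_gt0.
  rewrite muleC -lee_pdivlMr// -EFinM => /le_trans; apply.
  rewrite lee_fin /D /z powRN exprMn exprVn le_eqVlt; apply/orP; left; apply/eqP.
  have : v ^+ k != 0 by rewrite expf_neq0// gt_eqF.
  have : x `^ beta != 0 by rewrite gt_eqF// powR_gt0.
  have : (1 - r) `^ beta != 0 by rewrite gt_eqF// powR_gt0// subr_gt0.
  move: (v ^+ k) (x `^ beta) ((1 - r) `^ beta) => A1 A2 A3 n1 n2 n3.
  by field; rewrite n1 n2 n3.
apply: lime_le.
  by apply: is_cvg_nneseries => n _ _; exact: measure_ge0.
apply: nearW => n.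
apply: le_trans (lee_sum _ (fun k _ => term k)) _.
rewrite sumEFin lee_fin -mulr_sumr ler_wpM2l//.
exact: geometric_sum_le.
Qed.

Lemma perp_tail : exists2 C : R, 0 <= C &
  forall t x, 0 < x -> (Pr [set w | (x < `|perp (a^~ w) (b^~ w) t|)%R] <=
                        (C * x `^ (- beta))%:E)%E.
Proof.
have [r /andP[r0 r1] [C C0 hC]] := excess_tail; exists C => // t x x0.
apply: le_trans (hC t x x0); apply: le_measure; rewrite ?inE.
- by apply: measurable_gtr; apply: measurableT_comp => //; exact: measurable_perpT.
- exact: measurable_excess.
move=> w /= xw; apply: contrapT => /(notin_excess r0 r1)[_].
by rewrite leNgt xw.
Qed.

Lemma rsum_ae_cvg t : {ae Pr, forall w, cvgn (rsum (a^~ w) (b^~ w) t)}.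
Proof.
have [r /andP[r0 r1] [C C0 hC]] := excess_tail.
exists (\bigcap_n excess r n.+1%:R t); split.
- by apply: bigcapT_measurable => n; exact: measurable_excess.
- have mb : measurable (\bigcap_n excess r n.+1%:R t).
    by apply: bigcapT_measurable => n; exact: measurable_excess.
  apply/eqP; rewrite eq_le measure_ge0 andbT.
  have le n : (Pr (\bigcap_n excess r n.+1%:R t) <= (C * n.+1%:R `^ (- beta))%:E)%E.
    apply: le_trans (hC t _ _) => //; apply: le_measure; rewrite ?inE//.
      exact: measurable_excess.
    exact: bigcap_inf.
  have fin : Pr (\bigcap_n excess r n.+1%:R t) \is a fin_num by rewrite fin_num_measure.
  move: le; rewrite -(fineK fin) => le; rewrite lee_fin.
  apply/ler_addgt0Pr => e e0; rewrite add0r.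
  pose n := Num.truncn (((C + 1) / e) `^ beta^-1).
  have := le n; rewrite lee_fin => /le_trans; apply.
  rewrite powRN ler_pdivrMr ?powR_gt0//.
  have Ce : 0 <= (C + 1) / e by rewrite divr_ge0 ?(ltW e0)// addr_ge0.
  have : (C + 1) / e <= n.+1%:R `^ beta.
    apply: (@le_trans _ _ ((((C + 1) / e) `^ beta^-1) `^ beta)).
      by rewrite -powRrM mulVf ?powRr1 ?gt_eqF.
    apply: ge0_ler_powR; rewrite ?nnegrE ?powR_ge0 ?(ltW beta0)//.
    by rewrite ltW// /n Num.Theory.truncnS_gt.
  rewrite ler_pdivrMr// mulrC; lra.
- move=> w /= nc n _ /=; apply: contrapT => /(notin_excess r0 r1)[cv _].
  exact: nc.
Qed.

End Terms.
End ScalarRecursion.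

(** * Tails of scalar recurrences with normal coefficients *)

Section PowerBounds.
Context (R : realType).
Implicit Types (u v g c x : R).

Lemma powR_add1_le g : 0 <= g ->
  exists2 c, 0 <= c & forall v, 0 <= v <= 1 -> (1 + v) `^ g <= 1 + c * v.
Proof.
move=> g0; pose n := (Num.truncn g).+1.
exists (2 ^+ n - 1); first by rewrite subr_ge0 exprn_ege1// ler1n.
move=> v /andP[v0 v1].
apply: (@le_trans _ _ ((1 + v) `^ n%:R)).
  by apply: ler_powR; [rewrite lerDl|rewrite ltW// truncnS_gt].
rewrite powR_mulrn ?addr_ge0//; elim: n => [|n IH].
  by rewrite !expr0 subrr mul0r addr0.
rewrite exprSr; apply: le_trans (ler_wpM2r _ IH) _; first by rewrite addr_ge0.
have p1 : 1 <= 2 ^+ n :> R by rewrite exprn_ege1// ler1n.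
have : 0 <= (2 ^+ n - 1) * (v * (1 - v)).
  by rewrite !mulr_ge0 ?subr_ge0.
by rewrite exprS; move: (2 ^+ n) p1 => p p1; nra.
Qed.

(** For large [u] the increment is of the order of [u `^ (g - 1)]. *)
Lemma powR_shift_bound g k : 0 < g -> 0 < k ->
  exists s c, [/\ 0 < s, s < g, 0 <= c &
    forall u, 0 <= u -> (u + k) `^ g - u `^ g <= c * (1 + u `^ s)].
Proof.
move=> g0 k0.
have [c c0 hc] := powR_add1_le (ltW g0).
pose s := Num.max (g - 1) (g / 2).
have s0 : 0 < s by rewrite lt_max divr_gt0// orbT.
have sg : s < g by rewrite gt_max; apply/andP; split; lra.
pose C := (k + k) `^ g + c * k * k `^ (g - 1 - s).
exists s, C; split => //; first by rewrite addr_ge0 ?powR_ge0// !mulr_ge0 ?powR_ge0// ltW.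
move=> u u0; have us0 : 0 <= u `^ s by exact: powR_ge0.
have C1 : 0 <= (k + k) `^ g by exact: powR_ge0.
have C2 : 0 <= c * k * k `^ (g - 1 - s) by rewrite !mulr_ge0 ?powR_ge0// ltW.
have [uk|uk] := ltP u k.
  apply: (@le_trans _ _ ((k + k) `^ g)).
    rewrite lerBlDr -[leLHS]addr0 lerD ?powR_ge0//.
    by apply: ge0_ler_powR; rewrite ?nnegrE ?addr_ge0 ?lerD ?(ltW g0) ?(ltW k0) ?(ltW uk).
  by rewrite /C mulrDl mulrDr mulr1 -addrA lerDl addr_ge0// mulr_ge0// addr_ge0.
have ugt0 : 0 < u by exact: lt_le_trans uk.
have -> : u + k = u * (1 + k / u) by field; rewrite gt_eqF.
have ku : 0 <= k / u <= 1.
  by rewrite divr_ge0 ?(ltW k0) ?(ltW ugt0)//= ler_pdivrMr// mul1r.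
rewrite powRM ?addr_ge0//; last by case/andP: ku.
apply: (@le_trans _ _ (u `^ g * (1 + c * (k / u)) - u `^ g)).
  by rewrite lerD2r ler_wpM2l ?powR_ge0// hc.
have -> : u `^ g * (1 + c * (k / u)) - u `^ g = c * k * (u `^ g / u) by field; rewrite gt_eqF.
have -> : u `^ g / u = u `^ s * u `^ (g - 1 - s).
  have u_neq0 : u != 0 by rewrite gt_eqF.
  rewrite -powRD; last exact/implyP.
  have -> : s + (g - 1 - s) = g - 1 by ring.
  by rewrite powRB ?powRr1//; exact/implyP.
have le1 : u `^ (g - 1 - s) <= k `^ (g - 1 - s).
  have e0 : 0 <= s - (g - 1) by rewrite subr_ge0 le_max lexx.
  have -> : g - 1 - s = - (s - (g - 1)) by ring.
  rewrite !powRN lef_pV2 ?posrE ?powR_gt0//.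
  by apply: ge0_ler_powR; rewrite ?nnegrE ?(ltW k0).
apply: (@le_trans _ _ (c * k * k `^ (g - 1 - s) * u `^ s)).
  rewrite (mulrC (u `^ s)) !mulrA ler_wpM2r//.
  by rewrite -!mulrA !ler_wpM2l// ltW.
rewrite /C mulrDl; apply: ler_wpDl; first by rewrite mulr_ge0// addr_ge0.
by rewrite mulrDr mulr1 lerDr.
Qed.

End PowerBounds.

Section Clip.
Context (R : realType) (gam : R).
Hypothesis gam0 : 0 < gam.
Implicit Types s u v : R.

(** As [s] increases, this truncated power of [u] grows only while
[exp s < u]; so means of [clip] carry the tail of [u] in their increments. *)
Definition clip s u : R := Num.min u (expR s) `^ gam.

Lemma clipE s u : 0 <= u -> clip s u = Num.min (u `^ gam) (expR (gam * s)).
Proof.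
move=> u0; rewrite /clip mulrC expRM.
have mono := ge0_ler_powR (ltW gam0).
have [us|us] := leP u (expR s).
  by rewrite min_l// mono ?nnegrE ?expR_ge0.
by rewrite min_r// mono ?nnegrE ?expR_ge0 ?(ltW us).
Qed.

Lemma clip_ge0 s u : 0 <= clip s u. Proof. exact: powR_ge0. Qed.

Lemma clip_le s u : 0 <= u -> clip s u <= expR (gam * s).
Proof. by move=> u0; rewrite clipE// ge_min lexx orbT. Qed.

Lemma clip_scale s u v : 0 <= u -> 0 < v ->
  clip s (u * v) = v `^ gam * clip (s - ln v) u.
Proof.
move=> u0 v0; rewrite /clip expRB lnK ?posrE//.
have -> : Num.min (u * v) (expR s) = v * Num.min u (expR s / v).
  by rewrite minr_pMr ?(ltW v0)// mulrC (mulrC v (_ / _)) divfK ?gt_eqF.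
rewrite powRM ?(ltW v0)// le_min u0 divr_ge0 ?expR_ge0 ?(ltW v0)//.
Qed.

Lemma clip_nd s s' u : 0 <= u -> s <= s' -> clip s u <= clip s' u.
Proof.
move=> u0 ss'; rewrite !clipE// le_min ge_min lexx/= ge_min orbC.
by rewrite ler_expR ler_wpM2l// ltW.
Qed.

Let powR_shift_ge u k : 0 <= u -> 0 <= k -> u `^ gam <= (u + k) `^ gam.
Proof.
move=> u0 k0; apply: (ge0_ler_powR (ltW gam0)); rewrite ?nnegrE ?addr_ge0//.
by rewrite lerDl.
Qed.

Lemma clip_shift_ge0 s u k : 0 <= u -> 0 <= k -> 0 <= clip s (u + k) - clip s u.
Proof.
move=> u0 k0; rewrite subr_ge0 !clipE ?addr_ge0// le_min ge_min.
rewrite (ge0_ler_powR (ltW gam0)) ?nnegrE ?addr_ge0 ?lerDl//=.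
by rewrite ge_min lexx orbT.
Qed.

Lemma clip_shift_le s u k : 0 <= u -> 0 <= k ->
  clip s (u + k) - clip s u <= (u + k) `^ gam - u `^ gam.
Proof.
move=> u0 k0; have := powR_shift_ge u0 k0.
rewrite !clipE ?addr_ge0//; move: (u `^ gam) ((u + k) `^ gam) (expR _) => x y z xy.
by rewrite /Num.min; case: ifPn; case: ifPn; rewrite -?leNgt => h1 h2; lra.
Qed.

Lemma clip_shift_nd s s' u k : 0 <= u -> 0 <= k -> s <= s' ->
  clip s (u + k) - clip s u <= clip s' (u + k) - clip s' u.
Proof.
move=> u0 k0 ss'; have := powR_shift_ge u0 k0.
have : expR (gam * s) <= expR (gam * s') by rewrite ler_expR ler_wpM2l// ltW.
rewrite !clipE ?addr_ge0//.
move: (u `^ gam) ((u + k) `^ gam) (expR (gam * s)) (expR (gam * s')) => x y z z'.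
rewrite /Num.min => zz' xy.
by do 4 (case: ifPn; rewrite -?leNgt => ?); lra.
Qed.

Lemma clip_incr_ge s h u : 0 <= u -> 0 <= h ->
  (expR (gam * h) - 1) * expR (gam * s) * (expR (s + h) < u)%R%:R <=
  clip (s + h) u - clip s u.
Proof.
move=> u0 h0; have := clip_nd u0 (_ : s <= s + h); rewrite lerDl => /(_ h0) nd.
case: ltP => us; last by rewrite mulr0 subr_ge0.
have us' : expR s <= u.
  by apply: le_trans (ltW us); rewrite ler_expR lerDl.
have E x : expR x <= u -> clip x u = expR (gam * x).
  by move=> xu; rewrite /clip min_r// -expRM mulrC.
by rewrite mulr1 !E ?(ltW us)// mulrDr expRD; rewrite le_eqVlt; apply/orP; left; apply/eqP; ring.
Qed.

Lemma clip_incr_le s h u : 0 <= u -> 0 <= h ->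
  clip (s + h) u - clip s u <=
  (expR (gam * h) - 1) * expR (gam * s) * (expR s < u)%R%:R.
Proof.
move=> u0 h0; case: ltP => us; last first.
  have us' : u <= expR (s + h) by apply: le_trans us _; rewrite ler_expR lerDl.
  by rewrite mulr0 /clip !min_l// subrr.
rewrite mulr1 {2}/clip min_r ?(ltW us)// -expRM (mulrC s) mulrBl mul1r -expRD -mulrDr.
by rewrite lerD2r (addrC h) clip_le.
Qed.

End Clip.

Section MomentsFromTails.
Context (dT : measure_display) (T : measurableType dT) (R : realType).
Variable Pr : probability T R.

(** The integral is compared with a sum over dyadic levels. *)
Lemma moment_of_tail (f : T -> R) (C beta s : R) : measurable_fun setT f ->
  (forall w, 0 <= f w) -> 0 <= C -> 0 < s -> s < beta ->
  (forall x, 0 < x -> (Pr [set w | (x < f w)%R] <= (C * x `^ (- beta))%:E)%E) ->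
  (\int[Pr]_w (f w `^ s)%:E < +oo)%E.
Proof.
move=> mf f0 C0 s0 sb tail.
pose A (k : nat) := [set w | 2 ^+ k < f w].
have mA k : measurable (A k) by exact: measurable_gtr.
pose c (k : nat) : R := (2 ^+ k.+1) `^ s.
have c0 k : 0 <= c k by exact: powR_ge0.
have bound w : ((f w `^ s)%:E <= 1%:E + \sum_(0 <= k <oo) (c k * \1_(A k) w)%:E)%E.
  pose n := (Num.truncn (f w)).+1.
  have fn : f w <= 2 ^+ n.
    apply: (@le_trans _ _ n%:R); first by rewrite ltW// Num.Theory.truncnS_gt.
    by rewrite -natrX ler_nat ltnW// ltn_expl.
  have part m : (Num.min (f w) (2 ^+ m)) `^ s <= 1 + \sum_(0 <= k < m) c k * \1_(A k) w.
    elim: m => [|m IH].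
      rewrite big_geq// addr0 expr0; apply: (@le_trans _ _ (1 `^ s)); last by rewrite powR1.
      by apply: ge0_ler_powR; rewrite ?nnegrE ?le_min ?f0 ?ler01 ?(ltW s0) ?ge_min ?lexx ?orbT.
    rewrite big_nat_recr//= addrA indicE.
    have [|nA] := boolP (w \in A m).
      rewrite inE /A/= mulr1 => fm; apply: ler_wpDl; first by rewrite addr_ge0// sumr_ge0// => i _; rewrite mulr_ge0.
      by apply: ge0_ler_powR; rewrite ?nnegrE ?le_min ?f0 ?exprn_ge0 ?(ltW s0) ?ge_min ?lexx ?orbT.
    have fm : f w <= 2 ^+ m.
      by rewrite leNgt; apply/negP => h; move/negP : nA; apply; rewrite inE.
    rewrite mulr0 addr0; apply: le_trans IH.
    rewrite !min_l//; apply: le_trans fm _.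
    by rewrite ler_eXn2l// ltr1n.
  have := part n; rewrite min_l// => pn.
  apply: (@le_trans _ _ (1 + \sum_(0 <= k < n) c k * \1_(A k) w)%:E).
    by rewrite lee_fin.
  rewrite EFinD leeD2l// -sumEFin.
  by apply: nneseries_lim_ge => k _; rewrite lee_fin mulr_ge0.
have mterm k : measurable_fun setT (fun w => (c k * \1_(A k) w)%:E).
  by apply/measurable_EFinP; apply: measurable_funM => //; exact: measurable_indic.
have msum : measurable_fun setT (fun w => \sum_(0 <= k <oo) (c k * \1_(A k) w)%:E)%E.
  by apply: ge0_emeasurable_sum => // k w _ _; rewrite lee_fin mulr_ge0.
apply: (@le_lt_trans _ _ (\int[Pr]_w (1%:E + \sum_(0 <= k <oo) (c k * \1_(A k) w)%:E))%E).
  apply: ge0_le_integral => //.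
  - by move=> w _; rewrite lee_fin powR_ge0.
  - apply/measurable_EFinP; exact: (measurableT_comp (measurable_powR s)).
  - by apply: emeasurable_funD.
rewrite ge0_integralD//; last first.
  by move=> w _; apply: nneseries_ge0 => k _ _; rewrite lee_fin mulr_ge0.
rewrite integral_cst//= probability_setT mule1.
rewrite integral_nneseries//; last by move=> k w _; rewrite lee_fin mulr_ge0.
pose z : R := 2 `^ (s - beta).
have z0 : 0 <= z by exact: powR_ge0.
have z1 : z < 1.
  rewrite /z /powR; case: ifPn => [/eqP|_]; first by move=> /eqP; rewrite pnatr_eq0.
  rewrite -[ltRHS]expR0.
  by rewrite ltr_expR nmulr_rlt0 ?subr_lt0// ln_gt0// ltr1n.
pose D := C * 2 `^ s.
have D0 : 0 <= D by rewrite mulr_ge0// powR_ge0.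
have term k : (\int[Pr]_w (c k * \1_(A k) w)%:E <= (D * z ^+ k)%:E)%E.
  under eq_integral do rewrite EFinM.
  have mAE : measurable_fun setT (fun w => (\1_(A k) w)%:E : \bar R).
    by apply/measurable_EFinP; exact: measurable_indic.
  rewrite ge0_integralZl//; try by move=> *; rewrite lee_fin ?c0.
  rewrite integral_indic// setIT.
  have cP : ((c k)%:E * Pr (A k) <= (c k)%:E * (C * (2 ^+ k) `^ (- beta))%:E)%E.
    by apply: lee_wpmul2l; [by rewrite lee_fin c0|apply: tail; rewrite exprn_gt0].
  apply: le_trans cP _.
  rewrite -EFinM lee_fin le_eqVlt; apply/orP; left; apply/eqP.
  rewrite /c /D /z -!powR_mulrn// -!powRrM mulrA (mulrC (2 `^ _)) -!mulrA; congr (C * _).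
  have p2 x y : 2 `^ x * 2 `^ y = 2 `^ (x + y) :> R.
    by rewrite powRD//; apply/implyP.
  by rewrite !p2; congr (2 `^ _); rewrite -natr1; ring.
apply: (@le_lt_trans _ _ (1%:E + (D / (1 - z))%:E)%E); last by rewrite -EFinD ltry.
apply: leeD2l; apply: lime_le.
  by apply: is_cvg_nneseries => n _ _; apply: integral_ge0 => w _; rewrite lee_fin mulr_ge0.
apply: nearW => n.
apply: le_trans (lee_sum _ (fun k _ => term k)) _.
by rewrite sumEFin lee_fin -mulr_sumr ler_wpM2l// geometric_sum_le.
Qed.

End MomentsFromTails.

Section NormalRecursion.
Context (dT : measure_display) (T : measurableType dT) (R : realType).
Variable Pr : probability T R.
Variables (past pres : int -> set_system T) (a b : int -> T -> R).
Variables (alpha sigma tau : R).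
Hypothesis past_meas : forall t, past t `<=` measurable.
Hypothesis pres_past : forall t, pres t `<=` past t.
Hypothesis past_mono : forall s t, s <= t -> past s `<=` past t.
Hypothesis indep : forall t A B, <<s past (t - 1) >> A -> <<s pres t >> B ->
  Pr (A `&` B) = (Pr A * Pr B)%E.
Hypothesis sa : forall t, sub_measurable (pres t) (a t).
Hypothesis sb : forall t, sub_measurable (pres t) (b t).
Hypotheses (alpha0 : 0 < alpha) (sigma0 : 0 < sigma) (tau0 : 0 < tau).
Hypothesis a_normal : forall t, centered_normal Pr sigma (a t).
Hypothesis b_normal : forall t, centered_normal Pr tau (b t).
Hypothesis ab_indep : forall t A B, measurable A -> measurable B ->
  Pr (a t @^-1` A `&` b t @^-1` B) = (Pr (a t @^-1` A) * Pr (b t @^-1` B))%E.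
Hypothesis a_alpha : forall t, amoment Pr alpha (a t) = 1%E.

Let pres_meas t : pres t `<=` measurable.
Proof. by apply: subset_trans (@past_meas t); exact: pres_past. Qed.

Let ma t : measurable_fun setT (a t).
Proof. exact: sub_measurableW (@pres_meas t) (@sa t). Qed.

Let mb t : measurable_fun setT (b t).
Proof. exact: sub_measurableW (@pres_meas t) (@sb t). Qed.

Let sb_past t : sub_measurable (past t) (b t).
Proof.
apply: (sub_measurable_sub _ (@sb t)) => A pA; apply: sub_sigma_algebra.
exact: pres_past.
Qed.

Lemma normal_amoment (f : int -> T -> R) s p : 0 < s -> 0 <= p ->
  (forall t, measurable_fun setT (f t)) -> (forall t, centered_normal Pr s (f t)) ->
  exists2 c : R, 0 <= c & forall t, amoment Pr p (f t) = c%:E.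
Proof.
move=> s0 p0 mf Nf.
have mp : measurable_fun setT (fun x : R => (`|x| `^ p)%:E : \bar R).
  by apply/measurable_EFinP; apply: measurable_apow.
have p_ge0 (x : R) : (0 <= (`|x| `^ p)%:E)%E by rewrite lee_fin powR_ge0.
exists (fine (amoment Pr p (f 0))); first by rewrite fine_ge0// amoment_ge0.
move=> t; rewrite fineK; last first.
  rewrite ge0_fin_numE ?amoment_ge0//.
  exact: (centered_normal_moment s0 p0 (mf 0) (Nf 0)).
rewrite /amoment (integral_centered_normal (mf t) (Nf t) mp p_ge0).
by rewrite (integral_centered_normal (mf 0) (Nf 0) mp p_ge0).
Qed.

Let a_small t e : 0 < e -> (0 < Pr [set w | (`|a t w| < e)%R])%E.
Proof.
move=> e0; apply: lt_le_trans (centered_normal_support sigma0 (lexx 0) e0 (a_normal t)) _.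
have man : measurable_fun setT (fun w => `|a t w|) by exact: measurableT_comp.
apply: le_measure; rewrite ?inE.
- by rewrite -[X in measurable X]setTI; apply: ma => //; exact: measurable_itv.
- have := man measurableT `]-oo, e[%classic (measurable_itv _).
  by rewrite setTI; congr measurable; apply/seteqP; split => w /=; rewrite in_itv.
- by move=> w /=; rewrite in_itv/= => /andP[w0 we]; rewrite gtr0_norm.
Qed.

Lemma a_amoment_lt1 beta : 0 < beta -> beta < alpha ->
  exists2 rho : R, rho < 1 & forall t, amoment Pr beta (a t) = rho%:E.
Proof.
move=> b0 ba; have [rho _ ha] := normal_amoment sigma0 (ltW b0) ma a_normal.
exists rho => //; rewrite -lte_fin -(ha 0).
by apply: (amoment_lt1 b0 ba) => // e; exact: a_small.
Qed.

Local Notation y := (fun t w => perp (a^~ w) (b^~ w) t).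

Lemma perp_tail_alpha beta : 0 < beta -> beta < alpha -> exists2 C : R, 0 <= C &
  forall t x, 0 < x -> (Pr [set w | (x < `|y t w|)%R] <= (C * x `^ (- beta))%:E)%E.
Proof.
move=> b0 ba; have [rho rho1 ha] := a_amoment_lt1 b0 ba.
have [q _ hb] := normal_amoment tau0 (ltW b0) mb b_normal.
exact: (perp_tail past_meas pres_past past_mono indep sa sb_past ha hb b0 rho1).
Qed.

Lemma perp_ae_cvg t : {ae Pr, forall w, cvgn (rsum (a^~ w) (b^~ w) t)}.
Proof.
have a2 : alpha / 2 < alpha by rewrite ltr_pdivrMr// ltr_pMr// ltr1n.
have b0 : 0 < alpha / 2 by rewrite divr_gt0.
have [rho rho1 ha] := a_amoment_lt1 b0 a2.
have [q _ hb] := normal_amoment tau0 (ltW b0) mb b_normal.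
exact: (rsum_ae_cvg past_meas pres_past past_mono indep sa sb_past ha hb b0 rho1).
Qed.

Lemma perp_ae_rec t : {ae Pr, forall w, y t w = a t w * y (t - 1) w + b t w}.
Proof. by apply: filterS (perp_ae_cvg (t - 1)) => w /perp_rec. Qed.

Let my t : measurable_fun setT (y t).
Proof. exact: (measurable_perpT past_meas pres_past past_mono sa sb_past). Qed.

Let sy t : sub_measurable (past t) (y t).
Proof. exact: (sub_measurable_perp pres_past past_mono sa sb_past). Qed.

Let k2 := (tau / sigma) ^+ 2.

Let linear_law t (x : R) : centered_normal Pr (Num.sqrt (x ^+ 2 + k2) * sigma)
  (fun w => a t w * x + b t w).
Proof.
have [->|x0] := eqVneq x 0.
  rewrite expr0n add0r sqrtr_sqr gtr0_norm ?divr_gt0// divfK ?gt_eqF//.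
  by under eq_fun do rewrite mulr0 add0r; exact: b_normal.
have xs0 : 0 < `|x| * sigma by rewrite mulr_gt0// normr_gt0.
have mxa : measurable_fun setT (fun w => x * a t w) by exact: measurable_funM.
pose X1 : {mfun T >-> R} := HB.pack (fun w => x * a t w) (isMeasurableFun.Build _ _ _ _ _ mxa).
pose Y1 : {mfun T >-> R} := HB.pack (b t) (isMeasurableFun.Build _ _ _ _ _ (@mb t)).
have ind A B : measurable A -> measurable B ->
    Pr (X1 @^-1` A `&` Y1 @^-1` B) = (Pr (X1 @^-1` A) * Pr (Y1 @^-1` B))%E.
  move=> mA mB; apply: (@ab_indep t ((fun z => x * z) @^-1` A) B) => //.
  have mx : measurable_fun setT (fun z : R => x * z) by exact: measurable_funM.
  by have := mx measurableT A mA; rewrite setTI.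
have := @centered_normal_add _ _ _ Pr _ _ X1 Y1 xs0 tau0 ind
  (centered_normal_scale x0 sigma0 (a_normal t)) (b_normal t).
have -> : Num.sqrt ((`|x| * sigma) ^+ 2 + tau ^+ 2) = Num.sqrt (x ^+ 2 + k2) * sigma.
  rewrite -[X in _ = _ * X](gtr0_norm sigma0) -(sqrtr_sqr sigma) -sqrtrM ?addr_ge0 ?sqr_ge0//.
  congr Num.sqrt; rewrite exprMn real_normK ?num_real// /k2; field.
  by rewrite gt_eqF.
rewrite (_ : (fun w => X1 w + Y1 w) = (fun w => a t w * x + b t w))//.
by apply/funext => w /=; rewrite mulrC.
Qed.

Let scaled_law t (x : R) : centered_normal Pr (Num.sqrt (x ^+ 2 + k2) * sigma)
  (fun w => Num.sqrt (x ^+ 2 + k2) * a t w).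
Proof.
have s0 : 0 < Num.sqrt (x ^+ 2 + k2).
  by rewrite sqrtr_gt0 ltr_wpDl ?sqr_ge0// exprn_gt0// divr_gt0.
have := centered_normal_scale (lt0r_neq0 s0) sigma0 (a_normal t).
by rewrite (gtr0_norm s0).
Qed.

(** Given the past [y], the variable [a y + b] is normal, with the same law as
[a * sqrt (y ^ 2 + k2)].  So the squares solve, in law, a recurrence with
nonnegative terms. *)
Lemma square_law t (phi : R -> \bar R) : measurable_fun setT phi ->
  (forall x, 0 <= phi x)%E ->
  (\int[Pr]_w phi (y t w ^+ 2)%R =
   \int[Pr]_w \int[Pr]_w' phi ((y (t - 1) w ^+ 2 + k2) * a t w' ^+ 2)%R)%E.
Proof.
move=> mphi phi0.
have msq : measurable_fun setT (fun x : R => phi (x ^+ 2)).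
  by apply: (measurableT_comp mphi); exact: measurable_funX.
transitivity (\int[Pr]_w phi ((a t w * y (t - 1) w + b t w) ^+ 2)%R)%E.
  apply: ae_eq_integral => //.
  - by apply: (measurableT_comp msq); exact: my.
  - apply: (measurableT_comp msq); apply: measurable_funD => //.
    by apply: measurable_funM => //; exact: my.
  - by apply: filterS (perp_ae_rec t) => w /= ->.
have sab : sub_measurable (pres t) (fun w => (a t w, b t w)).
  by apply/measurable_fun_pairP; split; [exact: sa|exact: sb].
have mh : measurable_fun setT (fun z : R * (R * R) => phi ((z.2.1 * z.1 + z.2.2) ^+ 2)).
  apply: (measurableT_comp msq); apply: measurable_funD.
    apply: measurable_funM => //.
    exact: (measurableT_comp measurable_fst measurable_snd).
  exact: (measurableT_comp measurable_snd measurable_snd).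
rewrite (integral_sub_independent (@past_meas (t - 1)) (@pres_meas t) (@indep t)
  (h := fun z : R * (R * R) => phi ((z.2.1 * z.1 + z.2.2) ^+ 2)) (@sy (t - 1)) sab mh)//=.
apply: eq_integral => w _.
set x := perp _ _ _.
have m1 : measurable_fun setT (fun w' => a t w' * x + b t w').
  by apply: measurable_funD => //; exact: measurable_funM.
have m2 : measurable_fun setT (fun w' => Num.sqrt (x ^+ 2 + k2) * a t w').
  exact: measurable_funM.
transitivity (\int[normal_prob 0 (Num.sqrt (x ^+ 2 + k2) * sigma)]_z phi (z ^+ 2)%R)%E.
  by rewrite -(integral_centered_normal m1 (linear_law t x) msq).
rewrite -(integral_centered_normal m2 (scaled_law t x) msq)//.
apply: eq_integral => w' _; congr phi.
by rewrite exprMn sqr_sqrtr// addr_ge0// sqr_ge0.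
Qed.

Hypothesis y_stat : forall t s B, measurable B ->
  Pr (y t @^-1` B) = Pr (y s @^-1` B).

(** By [square_law], [U] solves [U = (U + k2) * a ^ 2] in law.  Truncating its
power of order [gam] at the level [exp s] yields a renewal equation for the
means [W s], with density [Z], step [L] and forcing term [G]. *)
Section TailLimit.
Variable t : int.
Let gam := alpha / 2.
Let gam0 : 0 < gam. Proof. by rewrite divr_gt0. Qed.
Let U w := y (t - 1) w ^+ 2.
Let Z w := `|a t w| `^ alpha.
Let L w := ln (a t w ^+ 2).
Let W s := (\int[Pr]_x clip gam s (U x))%R.
Let Wk s := (\int[Pr]_x clip gam s (U x + k2))%R.
Let G s := (\int[Pr]_x (clip gam s (U x + k2) - clip gam s (U x)))%R.
Let K := (\int[Pr]_x ((U x + k2) `^ gam - U x `^ gam))%R.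
Let p s := fine (Pr [set x | expR s < U x]).

Let k20 : 0 < k2. Proof. by rewrite exprn_gt0// divr_gt0. Qed.
Let U0 w : 0 <= U w. Proof. exact: sqr_ge0. Qed.
Let Uk0 w : 0 <= U w + k2. Proof. by rewrite addr_ge0// ltW. Qed.
Let mU : measurable_fun setT U.
Proof. by apply: measurable_funX; exact: my. Qed.
Let mUk : measurable_fun setT (fun x => U x + k2).
Proof. exact: measurable_funD. Qed.
Let mZ : measurable_fun setT Z. Proof. exact: measurable_apow. Qed.
Let mL : measurable_fun setT L.
Proof. by apply: (measurableT_comp (@measurable_ln R)); exact: measurable_funX. Qed.
Let Z0 w : 0 <= Z w. Proof. exact: powR_ge0. Qed.

Let mclip s : measurable_fun setT (clip gam s : R -> R).
Proof.
by apply: (measurableT_comp (measurable_powR gam)); apply: measurable_minr.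
Qed.

Let iclip s (f : T -> R) : measurable_fun setT f -> (forall x, 0 <= f x) ->
  Pr.-integrable setT (EFin \o (fun x => clip gam s (f x))).
Proof.
move=> mf f0; apply: (@bounded_integrable _ _ _ Pr _ (expR (gam * s))).
  exact: (measurableT_comp (mclip s)).
by move=> x; rewrite ger0_norm ?clip_ge0// clip_le.
Qed.

Let GE s : G s = Wk s - W s.
Proof. by rewrite /G RintegralB//; exact: iclip. Qed.

Let W_nd s s' : s <= s' -> W s <= W s'.
Proof.
move=> ss'; apply: (le_Rintegral measurableT (iclip s mU U0) (iclip s' mU U0)) => x _.
exact: clip_nd.
Qed.

Let W_ge0 s : 0 <= W s.
Proof. by apply: Rintegral_ge0 => x _; exact: clip_ge0. Qed.

Let iG s : Pr.-integrable setT (EFin \o (fun x => clip gam s (U x + k2) - clip gam s (U x))).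
Proof. by apply: integrable_sub; exact: iclip. Qed.

Let G_nd s s' : s <= s' -> G s <= G s'.
Proof.
move=> ss'; apply: (le_Rintegral measurableT (iG s) (iG s')) => x _.
by apply: clip_shift_nd => //; exact: ltW.
Qed.

Let G_ge0 s : 0 <= G s.
Proof. by apply: Rintegral_ge0 => x _; apply: clip_shift_ge0 => //; exact: ltW. Qed.

Let U_tail beta : 0 < beta -> beta < gam -> exists2 C : R, 0 <= C &
  forall x, 0 < x -> (Pr [set w | (x < U w)%R] <= (C * x `^ (- beta))%:E)%E.
Proof.
move=> b0 bg.
have b1 : 0 < 2 * beta by rewrite mulr_gt0.
have b2 : 2 * beta < alpha by rewrite mulrC -ltr_pdivlMr.
have [C C0 hC] := perp_tail_alpha b1 b2; exists C => // x x0.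
have -> : [set w | x < U w] = [set w | Num.sqrt x < `|y (t - 1) w|].
  have E w : (x < U w) = (Num.sqrt x < `|y (t - 1) w|).
    rewrite -[RHS](@ltr_pXn2r _ 2)// ?nnegrE ?sqrtr_ge0// sqr_sqrtr ?(ltW x0)//.
    by rewrite real_normK ?num_real.
  by apply/seteqP; split => w /=; rewrite E.
have := hC (t - 1) (Num.sqrt x); rewrite sqrtr_gt0 => /(_ x0).
rewrite -powR12_sqrt ?(ltW x0)// -powRrM.
by have -> : 2^-1 * - (2 * beta) = - beta by field.
Qed.

(** A power of order [gam] of [U] need not be integrable, but its increment over
[k2] grows like a smaller power. *)
Let iK : Pr.-integrable setT (EFin \o (fun x => (U x + k2) `^ gam - U x `^ gam)).
Proof.
have [s [c [s0 sg c0 hs]]] := powR_shift_bound gam0 k20.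
pose beta := (s + gam) / 2.
have sbe : s < beta by rewrite /beta; lra.
have bg : beta < gam by rewrite /beta; lra.
have [C C0 hC] := U_tail (lt_trans s0 sbe) bg.
have fin := moment_of_tail mU U0 C0 s0 sbe hC.
have mUs : measurable_fun setT (fun x => U x `^ s).
  exact: (measurableT_comp (measurable_powR s)).
apply: (@integrable_le _ _ _ _ _ (fun x => c * (1 + U x `^ s))).
- by apply: measurable_funB; exact: (measurableT_comp (measurable_powR gam)).
- apply: integrable_scale; apply: integrable_add.
    by apply: (@bounded_integrable _ _ _ Pr _ 1) => // x; rewrite normr1.
  apply/integrableP; split; first exact/measurable_EFinP.
  by under eq_integral do rewrite /= ger0_norm ?powR_ge0//.
- move=> x; rewrite ger0_norm ?hs// subr_ge0.
  apply: ge0_ler_powR; rewrite ?nnegrE ?(ltW gam0) ?U0 ?Uk0//.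
  by rewrite lerDl ltW.
Qed.

Let G_le s : G s <= K.
Proof.
by apply: (le_Rintegral measurableT (iG s) iK) => x _; apply: clip_shift_le => //; exact: ltW.
Qed.

Let clip_cvg u : 0 <= u -> clip gam n%:R u @[n --> \oo] --> u `^ gam.
Proof.
move=> u0; apply: cvg_near_cst; near=> n.
rewrite /clip min_l//; apply: (@le_trans _ _ (1 + n%:R)); last exact: expR_ge1Dx.
by rewrite ler_wpDl//; near: n; exact: nbhs_infty_ger.
Unshelve. all: by end_near. Qed.

Let G_cvg : G s @[s --> +oo] --> K.
Proof.
have Gn : G n%:R @[n --> \oo] --> K.
  apply: (Rintegral_dominated_cvg _ _ iK) => //.
  - by move=> n; apply: measurable_funB; exact: (measurableT_comp (mclip _)).
  - by apply: measurable_funB; exact: (measurableT_comp (measurable_powR gam)).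
  - move=> n x; rewrite ger0_norm; first by apply: clip_shift_le => //; exact: ltW.
    by apply: clip_shift_ge0 => //; exact: ltW.
  - by move=> x; apply: cvgB; exact: clip_cvg.
apply/cvgrPdist_le => e e0; move/cvgrPdist_le : Gn => /(_ e e0)[n _ /(_ n (leqnn n))] /= hn.
near=> s; rewrite ger0_norm ?subr_ge0//.
apply: le_trans (le_trans (ler_norm _) hn); rewrite lerD2l lerN2; apply: G_nd.
by near: s; apply: nbhs_pinfty_ge; rewrite num_real.
Unshelve. all: by end_near. Qed.

Let K0 : 0 < K.
Proof.
have pos x : 0 < (U x + k2) `^ gam - U x `^ gam.
  by rewrite subr_gt0 gt0_ltr_powR ?nnegrE ?U0 ?Uk0// ltrDl.
apply: Rintegral_gt0 => // [x|]; first exact: ltW.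
rewrite (_ : [set x | _] = setT) ?probability_setT ?lte01//.
by apply/seteqP; split => x //= _; exact: pos.
Qed.

Let WE s : ((W s)%:E = \int[Pr]_x (clip gam s (U x))%:E)%E.
Proof. by rewrite /W /Rintegral fineK// integrable_fin_num//; exact: iclip. Qed.

Let WkE s : ((Wk s)%:E = \int[Pr]_x (clip gam s (U x + k2))%:E)%E.
Proof. by rewrite /Wk /Rintegral fineK// integrable_fin_num//; exact: iclip. Qed.

Let clip0 s : clip gam s 0 = 0.
Proof. by rewrite /clip min_l ?expR_ge0// powR0// gt_eqF. Qed.

Let W_renew s :
  ((W s)%:E = \int[Pr]_x (Z x * (W (s - L x) + G (s - L x)))%:E)%E.
Proof.
have mcs : measurable_fun setT (fun u : R => (clip gam s u)%:E : \bar R).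
  exact/measurable_EFinP.
have cs0 u : (0 <= (clip gam s u)%:E)%E by rewrite lee_fin clip_ge0.
have -> : ((W s)%:E = \int[Pr]_w (clip gam s (y t w ^+ 2)%R)%:E)%E.
  rewrite WE; apply: (@eq_law_integral _ _ _ _ (y (t - 1)) (y t)
    (fun u => (clip gam s (u ^+ 2))%:E)) => //.
    by move=> B mB; exact: y_stat.
  by apply: (measurableT_comp mcs); exact: measurable_funX.
rewrite (square_law t mcs cs0).
have mh : measurable_fun setT (fun z : T * T =>
    (clip gam s ((U z.1 + k2) * a t z.2 ^+ 2))%:E : \bar R).
  apply: (measurableT_comp mcs); apply: measurable_funM.
    exact: (measurableT_comp mUk measurable_fst).
  by apply: measurable_funX; exact: (measurableT_comp (ma t) measurable_snd).
have := fubini_tonelli (m1 := Pr) (m2 := Pr) _ mh (fun z => cs0 _) => /= ->.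
apply: eq_integral => x _.
have [ax|ax] := eqVneq (a t x) 0.
  rewrite /Z ax normr0 powR0 ?gt_eqF// mul0r.
  under eq_integral do rewrite expr0n mulr0 clip0.
  by rewrite integral0.
have a20 : 0 < a t x ^+ 2 by rewrite exprn_even_gt0.
have ZE : (a t x ^+ 2) `^ gam = Z x.
  rewrite /Z /gam -[a t x ^+ 2]real_normK ?num_real// -powR_mulrn// -powRrM.
  by congr (_ `^ _); field.
have -> : W (s - L x) + G (s - L x) = Wk (s - L x) by rewrite GE addrC subrK.
rewrite EFinM WkE -ge0_integralZl//.
- apply: eq_integral => x' _; rewrite clip_scale// ZE EFinM.
  by [].
- apply/measurable_EFinP; exact: (measurableT_comp (mclip _)).
- by move=> x' _; rewrite lee_fin clip_ge0.
- by rewrite lee_fin.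
Qed.

Let Z1 : (\int[Pr]_x (Z x)%:E = 1)%E.
Proof. exact: (a_alpha t). Qed.

Let iZ : Pr.-integrable setT (EFin \o Z).
Proof.
apply/integrableP; split; first exact/measurable_EFinP.
under eq_integral do rewrite /= ger0_norm//.
by rewrite Z1 ltry.
Qed.

Let mind (B : set T) : measurable B ->
  measurable_fun setT (fun x => (x \in B)%:R : R).
Proof. by move=> mB; exact: measurable_indic. Qed.

(** A normal law charges every interval. *)
Let Z_support s r : 0 < r ->
  0 < (\int[Pr]_x (Z x * (`|L x - s| < r)%R%:R))%R.
Proof.
move=> r0; have mI : measurable [set x | `|L x - s| < r].
  have mLs : measurable_fun setT (fun x => `|L x - s|).
    by apply: measurableT_comp => //; exact: measurable_funB.
  have := mLs measurableT `]-oo, r[%classic (measurable_itv _).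
  by rewrite setTI; congr measurable; apply/seteqP; split => w /=; rewrite in_itv.
have mf : measurable_fun setT (fun x => Z x * (`|L x - s| < r)%R%:R).
  apply: measurable_funM => //.
  rewrite (_ : (fun x => _) = (fun x => (x \in [set x | `|L x - s| < r])%:R)); first exact: mind.
  by apply/funext => x; rewrite mem_setE.
apply: Rintegral_gt0 => [|x|].
- apply: (integrable_le mf iZ) => x; rewrite normrM ger0_norm// ler_piMr//.
  by rewrite ger0_norm ?ler0n// lern1 leq_b1.
- by rewrite mulr_ge0// ler0n.
have lt_e : expR ((s - r) / 2) < expR ((s + r) / 2).
  by rewrite ltr_expR; lra.
apply: lt_le_trans (centered_normal_support sigma0 (expR_ge0 _) lt_e (a_normal t)) _.
apply: le_measure; rewrite ?inE.
- by rewrite -[X in measurable X]setTI; apply: ma => //; exact: measurable_itv.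
- exact: measurable_gtr.
move=> w /=; rewrite in_itv/= => /andP[al au].
have a0 : 0 < a t w by apply: lt_trans al; exact: expR_gt0.
rewrite mulr_gt0// /Z ?powR_gt0 ?normr_gt0 ?gt_eqF//.
have [ln1 ln2] : (s - r) / 2 < ln (a t w) /\ ln (a t w) < (s + r) / 2.
  by split; rewrite -ltr_expR lnK// ?posrE.
by rewrite ltr0n lt0b ltr_norml /L lnXn// mulr2n; apply/andP; split; lra.
Qed.

Let iZL : Pr.-integrable setT (EFin \o (fun x => Z x * L x)).
Proof.
pose g x := 2 * `|a t x| `^ (alpha + 1) + 2 / alpha.
apply: (@integrable_le _ _ _ _ _ g); first exact: measurable_funM.
  apply: integrable_add; last first.
    by apply: (@bounded_integrable _ _ _ Pr _ `|2 / alpha|) => // x.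
  apply: integrable_scale; apply/integrableP; split.
    by apply/measurable_EFinP; exact: measurable_apow.
  under eq_integral do rewrite /= ger0_norm ?powR_ge0//.
  by apply: (centered_normal_moment sigma0 _ (ma t) (a_normal t)); rewrite addr_ge0 ?ltW.
have al2 : 0 <= 2 / alpha by rewrite divr_ge0// ltW.
move=> x; rewrite /g /Z /L; have [->|a0] := eqVneq (a t x) 0.
  rewrite normr0 powR0 ?gt_eqF// mul0r normr0 addr_ge0// mulr_ge0// powR_ge0//.
have v0 : 0 < `|a t x| by rewrite normr_gt0.
rewrite -[a t x ^+ 2]real_normK ?num_real//.
move: `|a t x| v0 => v v0; rewrite lnXn// normrM ger0_norm ?powR_ge0//.
suff key : v `^ alpha * `|ln v| <= v `^ (alpha + 1) + 1 / alpha.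
  by rewrite normrMn mulr2n; move: key; lra.
have [v1|v1] := leP 1 v.
  apply: (@le_trans _ _ (v `^ (alpha + 1))); last by rewrite lerDl divr_ge0// ltW.
  rewrite ger0_norm ?ln_ge0// powRD ?(gt_eqF v0) ?implybT// powRr1 ?(ltW v0)//.
  by rewrite ler_wpM2l ?powR_ge0// ltW// ln_sublinear.
apply: (@le_trans _ _ (1 / alpha)); last by rewrite lerDr powR_ge0.
rewrite ltr0_norm ?ln_lt0 ?v0//.
have := ln_sublinear (powR_gt0 (- alpha) v0); rewrite ln_powR => /ltW.
move=> /(ler_wpM2l (powR_ge0 v alpha)); rewrite powRN divff ?gt_eqF ?powR_gt0// => h.
by rewrite ler_pdivlMr//; move: h; lra.
Qed.

Let Zlam rho : amoment Pr (alpha / 2) (a t) = rho%:E ->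
  (\int[Pr]_x (Z x * expR (- (alpha / 4 * L x)))%:E = rho%:E)%E.
Proof.
move=> <-; apply: eq_integral => x _; congr EFin; rewrite /Z /L.
have [->|a0] := eqVneq (a t x) 0.
  by rewrite normr0 !powR0 ?mul0r// gt_eqF// divr_gt0.
have v0 : 0 < `|a t x| by rewrite normr_gt0.
rewrite -[a t x ^+ 2]real_normK ?num_real// lnXn// mulr2n.
rewrite /powR !gt_eqF// -expRD; congr expR; by field.
Qed.

Let mI s : measurable_fun setT (fun x => (expR s < U x)%R%:R : R).
Proof.
have mA : measurable [set x | expR s < U x] by exact: measurable_gtr.
rewrite (_ : (fun x => _) = (fun x => (x \in [set x | expR s < U x])%:R)); first exact: mind.
by apply/funext => x; rewrite mem_setE.
Qed.

Let iI s c : Pr.-integrable setT (EFin \o (fun x => c * (expR s < U x)%R%:R)).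
Proof.
apply: integrable_scale; apply: (@bounded_integrable _ _ _ Pr _ 1) => // x.
by rewrite ger0_norm ?ler0n// lern1 leq_b1.
Qed.

Let pE c s : c * p s = (\int[Pr]_x (c * (expR s < U x)%R%:R))%R.
Proof.
have mA : measurable [set x | expR s < U x] by exact: measurable_gtr.
rewrite RintegralZl//; last first.
  by have := iI s 1; congr integrable; apply/funext => x /=; rewrite mul1r.
congr (_ * _); rewrite /p /Rintegral -(setIT [set x | _]) -integral_indic//.
by congr fine; apply: eq_integral => x _; rewrite indicE mem_setE.
Qed.

Let WB s s' : W s - W s' = (\int[Pr]_x (clip gam s (U x) - clip gam s' (U x)))%R.
Proof. by rewrite /W RintegralB//; exact: iclip. Qed.

Let iWB s s' : Pr.-integrable setT (EFin \o (fun x => clip gam s (U x) - clip gam s' (U x))).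
Proof. by apply: integrable_sub; exact: iclip. Qed.

Let W_incr_ge s h : 0 <= h ->
  (expR (gam * h) - 1) * expR (gam * s) * p (s + h) <= W (s + h) - W s.
Proof.
move=> h0; rewrite pE WB; apply: (le_Rintegral measurableT (iI _ _) (iWB _ _)) => x _.
exact: clip_incr_ge.
Qed.

Let W_incr_le s h : 0 <= h ->
  W (s + h) - W s <= (expR (gam * h) - 1) * expR (gam * s) * p s.
Proof.
move=> h0; rewrite pE WB; apply: (le_Rintegral measurableT (iWB _ _) (iI _ _)) => x _.
exact: clip_incr_le.
Qed.

Let p_ge0 s : 0 <= p s. Proof. by rewrite fine_ge0. Qed.

Let p_le1 s : p s <= 1.
Proof.
rewrite -lee_fin /p fineK ?fin_num_measure//; last exact: measurable_gtr.
by apply: probability_le1; exact: measurable_gtr.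
Qed.

Let p_growth e : 0 < e -> e <= gam ->
  exists C, forall s, expR (gam * s) * p s <= C * expR (e * s).
Proof.
move=> e0; rewrite le_eqVlt => /predU1P[->|eg].
  by exists 1 => s; rewrite mul1r ler_piMr ?expR_ge0.
have b0 : 0 < gam - e by rewrite subr_gt0.
have bg : gam - e < gam by rewrite gtrBl.
have [C C0 hC] := U_tail b0 bg; exists C => s.
have : p s <= C * expR s `^ (- (gam - e)).
  rewrite -lee_fin /p fineK ?fin_num_measure//; last exact: measurable_gtr.
  exact/hC/expR_gt0.
move=> /(ler_wpM2l (expR_ge0 (gam * s))) /le_trans; apply.
rewrite mulrCA ler_wpM2l// -expRM -expRD ler_expR; lra.
Qed.

Lemma square_tail_limit :
  exists2 c : R, 0 < c & expR (gam * s) * p s @[s --> +oo] --> c.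
Proof.
have a2 : alpha / 2 < alpha by rewrite ltr_pdivrMr// ltr_pMr// ltr1n.
have [rho rho1 ha] := a_amoment_lt1 gam0 a2.
have lam0 : 0 < alpha / 4 by rewrite divr_gt0.
exact: (@renewal_tail _ _ _ Pr Z L W G p K (alpha / 4) gam rho mZ mL Z0 Z1
  Z_support iZL lam0 gam0 rho1 (Zlam (ha t)) W_nd W_ge0 G_nd G_ge0 G_le G_cvg K0
  W_renew p_ge0 p_le1 W_incr_ge W_incr_le p_growth).
Qed.

End TailLimit.

Let ln_cvg : (fun x : R => 2 * ln x) @ +oo --> +oo.
Proof.
apply/cvgryPge => A; near=> x.
have x0 : 0 < x by near: x; apply: nbhs_pinfty_gt; rewrite num_real.
have h : expR (A / 2) <= x by near: x; apply: nbhs_pinfty_ge; rewrite num_real.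
by rewrite mulrC -ler_pdivrMr// -ler_expR lnK ?posrE.
Unshelve. all: by end_near. Qed.

(** The tail of [y] is that of its square at the level [x ^ 2 = exp (2 ln x)];
stationarity makes the constant the same at all times. *)
Lemma perp_tail_limit : exists2 c : R, 0 < c & forall t,
  x `^ alpha * fine (Pr [set w | x < `|y t w|]) @[x --> +oo] --> c.
Proof.
have [c c0 hc] := square_tail_limit 0; exists c => // t.
have := cvg_comp _ _ ln_cvg hc; apply: cvg_trans; apply: near_eq_cvg; near=> x.
have x0 : 0 < x by near: x; apply: nbhs_pinfty_gt; rewrite num_real.
rewrite /comp; congr (_ * _).
  rewrite /powR gt_eqF//; congr expR; by field.
have mA : measurable [set z : R | x < `|z|] by exact: measurable_gtr.
rewrite (_ : [set w | x < _] = y t @^-1` [set z | x < `|z|])//.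
rewrite (y_stat t (0 - 1) mA); congr (fine (Pr _)).
have E w : (expR (2 * ln x) < y (0 - 1) w ^+ 2) = (x < `|y (0 - 1) w|).
  rewrite mulrC expRM_natr lnK ?posrE//.
  rewrite -[y _ _ ^+ 2]real_normK ?num_real//.
  by rewrite ltr_pXn2r ?nnegrE ?(ltW x0).
by apply/seteqP; split => w /=; rewrite E.
Unshelve. all: by end_near. Qed.

End NormalRecursion.

(** * The space of noise paths *)

Lemma preimage_g_sigma (U V : Type) (f : U -> V) (S : set_system U) (G : set_system V) :
  sigma_algebra setT S -> (forall B, G B -> S (f @^-1` B)) ->
  forall B, <<s G >> B -> S (f @^-1` B).
Proof.
move=> sS GS B sB.
have sI : sigma_algebra setT (image_set_system setT f S) by exact: sigma_algebra_image.
have := smallest_sub sI _ sB; rewrite /image_set_system/= setTI; apply.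
by move=> A GA; rewrite /= setTI; exact: GS.
Qed.

Section VectorBorel.
Context (R : realType) (d : nat).

Lemma vec_borel_coord i (B : set R) : measurable B ->
  vec_borel [set x : 'cV[R]_d | B (x i 0)].
Proof.
move=> mB; apply: sub_sigma_algebra; exists i => //; exists B => //.
by rewrite setTI.
Qed.

Lemma random_vectorP dT (T : measurableType dT) (Y : T -> 'cV[R]_d) :
  random_vector Y <-> forall i, measurable_fun setT (fun w => Y w i 0).
Proof.
split=> [rY i _ B mB|mY B vB]; first by rewrite setTI; exact: (rY _ (vec_borel_coord i mB)).
apply: (preimage_g_sigma (@sigma_algebra_measurable _ T) _ vB).
move=> {vB}B [i _ [A mA <-]]; rewrite setTI.
by have := mY i measurableT A mA; rewrite setTI.
Qed.

End VectorBorel.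

Section NoiseSpace.
Context (R : realType) (d l : nat).

Definition noise_path : Type := (('I_l * int -> R) * (int -> 'cV[R]_d))%type.
HB.instance Definition _ := Pointed.on noise_path.

Definition noise_coord (k : 'I_l * int + int) : set_system noise_path :=
  match k with
  | inl jt => preimage_set_system setT (fun e : noise_path => e.1 jt) measurable
  | inr t => preimage_set_system setT (fun e : noise_path => e.2 t) (@vec_borel R d)
  end.

Definition noise_space := g_sigma_algebraType (\bigcup_k noise_coord k).

Definition index_time (k : 'I_l * int + int) : int :=
  match k with inl jt => jt.2 | inr t => t end.

Definition shift_index (h : int) (k : 'I_l * int + int) : 'I_l * int + int :=
  match k with inl jt => inl (jt.1, jt.2 + h) | inr t => inr (t + h) end.

Definition noise_shift (h : int) (e : noise_path) : noise_path :=
  (fun jt => e.1 (jt.1, jt.2 + h), fun t => e.2 (t + h)).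

Definition noise_flip (e : noise_path) : noise_path := (e.1, fun t => - e.2 t).

Lemma sigma_algebra_noise_coord k : sigma_algebra setT (noise_coord k).
Proof.
case: k => [jt|t]; apply: sigma_algebra_preimage.
  exact: sigma_algebra_measurable.
exact: smallest_sigma_algebra.
Qed.

Lemma noise_coord_setT k : noise_coord k setT.
Proof.
have [h0 hD _] := sigma_algebra_noise_coord k.
by have := hD _ h0; rewrite setTD setC0.
Qed.

Lemma noise_coord_setI k : setI_closed (noise_coord k).
Proof. by have := sigma_algebra_noise_coord k => /sigma_algebraP[] //= _ _ _ ->. Qed.

Lemma noise_coord_measurable k : noise_coord k `<=` (measurable : set_system noise_space).
Proof. by move=> B kB; apply: sub_sigma_algebra; exists k. Qed.

Lemma noise_coord_shift h k B :
  noise_coord k B -> noise_coord (shift_index h k) (noise_shift h @^-1` B).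
Proof. by case: k => [[j t]|t] [A mA <-]; exists A => //. Qed.

Lemma shift_indexK h : cancel (shift_index h) (shift_index (- h)).
Proof. by move=> [[j t]|t] /=; rewrite addrK. Qed.

Lemma index_time_shift h k : index_time (shift_index h k) = index_time k + h.
Proof. by case: k. Qed.

Lemma measurable_noise_shift h :
  measurable_fun setT (noise_shift h : noise_space -> noise_space).
Proof.
move=> _ B mB; rewrite setTI.
apply: (@preimage_g_sigma _ _ _ (measurable : set_system noise_space) _ _ _ _ mB).
  exact: (@sigma_algebra_measurable _ noise_space).
move=> {mB}B [k _ kB]; apply: sub_sigma_algebra; exists (shift_index h k) => //.
exact: noise_coord_shift.
Qed.

Lemma vec_borel_oppr (B : set 'cV[R]_d) : vec_borel B -> vec_borel (-%R @^-1` B).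
Proof.
move=> vB; apply: (preimage_g_sigma (smallest_sigma_algebra _ _) _ vB).
move=> {vB}B [i _ [A mA <-]]; rewrite setTI; apply: sub_sigma_algebra.
exists i => //; exists (-%R @^-1` A); last first.
  by rewrite setTI; apply/seteqP; split => x /=; rewrite mxE.
by have := @oppr_measurable R setT measurableT A mA; rewrite setTI.
Qed.

Lemma noise_coord_flip k B :
  noise_coord k B -> noise_coord k (noise_flip @^-1` B).
Proof.
case: k => [jt|t] [A mA <-]; first by exists A.
by exists (-%R @^-1` A) => //; exact: vec_borel_oppr.
Qed.

Lemma measurable_noise_flip :
  measurable_fun setT (noise_flip : noise_space -> noise_space).
Proof.
move=> _ B mB; rewrite setTI.
apply: (@preimage_g_sigma _ _ _ (measurable : set_system noise_space) _ _ _ _ mB).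
  exact: (@sigma_algebra_measurable _ noise_space).
move=> {mB}B [k _ kB]; apply: sub_sigma_algebra; exists k => //.
exact: noise_coord_flip.
Qed.

Lemma noise_coord_m jt (B : set R) : measurable B ->
  noise_coord (inl jt) [set e : noise_path | B (e.1 jt)].
Proof. by move=> mB; exists B => //; rewrite setTI. Qed.

Lemma noise_coord_Q t i (B : set R) : measurable B ->
  noise_coord (inr t) [set e : noise_path | B (e.2 t i 0)].
Proof.
move=> mB; exists [set x : 'cV[R]_d | B (x i 0)]; first exact: vec_borel_coord.
by rewrite setTI.
Qed.

End NoiseSpace.
Arguments noise_coord {R d l} k.

Section NoiseLaw.
Context (R : realType) (d l : nat) (C : 'M[R]_d).

Definition noise_law (mu : probability (noise_space R d l) R) : Prop :=
  [/\ forall jt, centered_normal mu 1 (fun e => e.1 jt),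
      forall t, centered_normal_vector mu C (fun e => e.2 t) &
      mutually_independent mu noise_coord].

Variable mu : probability (noise_space R d l) R.
Hypothesis muP : noise_law mu.

Let mQ i t : measurable_fun setT (fun e : noise_space R d l => e.2 t i 0).
Proof.
move=> _ B mB; rewrite setTI; apply: noise_coord_measurable.
exact: noise_coord_Q.
Qed.

(** Transformations that permute the coordinates preserve independence, so they
preserve the law as soon as they preserve the law of each coordinate. *)
Let transformed_law (f : noise_space R d l -> noise_space R d l)
    (phi psi : 'I_l * int + int -> 'I_l * int + int) :
  cancel phi psi ->
  (forall k B, noise_coord k B -> noise_coord (phi k) (f @^-1` B)) ->
  (forall k B, noise_coord k B -> mu (f @^-1` B) = mu B) ->
  forall B, measurable B -> mu (f @^-1` B) = mu B.
Proof.
move=> phiK fphi fmu B mB; have [_ _ ind] := muP; symmetry.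
have E0 (S : set_system (noise_space R d l)) : preimage_set_system setT id S = S.
  apply/seteqP; split => [A [A' SA <-]|A SA]; first by rewrite setTI.
  by exists A => //; rewrite setTI.
apply: (@eq_joint_law _ _ _ mu _ (noise_path R d l) (@noise_coord R d l) id f) => //.
- exact: sigma_algebra_noise_coord.
- by move=> k; rewrite E0; exact: noise_coord_measurable.
- move=> k _ [A kA <-]; rewrite setTI.
  by apply: (@noise_coord_measurable _ _ _ (phi k)); exact: fphi.
- by move=> J F JF; apply: ind => k kJ; have := JF k kJ; rewrite E0.
- move=> J F JF.
  pose J' := [fset phi k | k in J]%fset.
  have JE : [set` J'] = phi @` [set` J].
    apply/seteqP; split => [k /= /imfsetP[k' /= k'J ->]|_ /= [k' k'J <-]].
      by exists k'.
    by apply/imfsetP; exists k'.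
  transitivity (mu (\bigcap_(k in [set` J']) F (psi k))).
    congr (mu _); rewrite JE bigcap_image; apply: eq_bigcapr => k _.
    by rewrite phiK.
  rewrite ind => [|k]; last first.
    move=> /imfsetP[k' /= k'J ->]; rewrite phiK.
    by have [A kA <-] := JF _ k'J; rewrite setTI; exact: fphi.
  rewrite /J' big_imfset/=; last by move=> x y _ _ /(can_inj phiK).
  by apply: eq_bigr => k _; rewrite phiK.
- by move=> k A kA; rewrite (fmu k).
Qed.

Lemma noise_law_shift h (B : set (noise_space R d l)) : measurable B ->
  mu (@noise_shift R d l h @^-1` B) = mu B.
Proof.
have [Nm NQ _] := muP.
apply: (transformed_law (@shift_indexK l h) (@noise_coord_shift R d l h)).
case=> [[j t]|t] _ [A mA <-]; rewrite !setTI.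
  exact: etrans (Nm (j, t + h) _ mA) (esym (Nm (j, t) _ mA)).
apply: (@cramer_wold _ _ _ mu _ (fun e => e.2 (t + h)) (fun e => e.2 t)) => //.
by move=> u u0 B' mB'; exact: etrans (NQ (t + h) u u0 _ mB') (esym (NQ t u u0 _ mB')).
Qed.

Lemma noise_law_flip (B : set (noise_space R d l)) : measurable B ->
  mu ((@noise_flip R d l) @^-1` B) = mu B.
Proof.
have [Nm NQ _] := muP.
apply: (@transformed_law (@noise_flip R d l) id id) => //.
  exact: noise_coord_flip.
case=> [[j t]|t] _ [A mA <-]; rewrite !setTI//.
apply: (@cramer_wold _ _ _ mu _ (fun e => - e.2 t) (fun e => e.2 t)) => //.
  move=> i; rewrite (_ : (fun w => _) = (fun w : noise_space R d l => - (w.2 t i 0))).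
    exact: measurableT_comp.
  by apply/funext => e; rewrite mxE.
move=> u u0 B' mB'; apply: etrans (esym (NQ t u u0 _ mB')).
have u0' : - u != 0 by rewrite oppr_eq0.
have := NQ t _ u0' _ mB'.
rewrite linearN/= !mulNmx mulmxN opprK => <-.
by congr (mu _); apply/seteqP; split => e /=; rewrite /dotv mulmxN mulNmx.
Qed.

End NoiseLaw.

(** * Shift invariant events *)

Section SigmaApproximation.
Context (dT : measure_display) (T : measurableType dT) (R : realType).
Variables (Pr : probability T R) (G : nat -> set_system T).
Hypothesis G_meas : forall n, G n `<=` measurable.
Hypothesis G_mono : forall n n', (n <= n')%N -> G n `<=` G n'.

Let approx (B : set T) := measurable B /\
  forall e : R, 0 < e -> exists n A, <<s G n >> A /\ (Pr (B `+` A) <= e%:E)%E.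

Let sG n n' A : (n <= n')%N -> <<s G n >> A -> <<s G n' >> A.
Proof.
move=> nn'; apply: smallest_sub; first exact: smallest_sigma_algebra.
by apply: subset_trans (G_mono nn') _; exact: sub_sigma_algebra.
Qed.

Let sGm n A : <<s G n >> A -> measurable A.
Proof. by apply: smallest_sub => //; exact: sigma_algebra_measurable. Qed.

Let mY (A B : set T) : measurable A -> measurable B -> measurable (A `+` B).
Proof. by move=> mA mB; apply: measurableU; exact: measurableD. Qed.

Let Pr_sub3 (A B D : set T) (x z e : R) : measurable A -> measurable B -> measurable D ->
  A `<=` B `|` D -> (Pr B <= x%:E)%E -> (Pr D <= z%:E)%E -> x + z <= e ->
  (Pr A <= e%:E)%E.
Proof.
move=> mA mB mD ABD PB PD xz.
apply: (@le_trans _ _ (Pr (B `|` D))); first by apply: le_measure; rewrite ?inE//; exact: measurableU.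
apply: le_trans (measureU2 _ mB mD) _.
by apply: le_trans (leeD PB PD) _; rewrite -EFinD lee_fin.
Qed.

Let approxU A B : approx A -> approx B -> approx (A `|` B).
Proof.
move=> [mA hA] [mB hB]; split; first exact: measurableU.
move=> e e0; have e2 : 0 < e / 2 by rewrite divr_gt0.
have [n [A' [sA' PA]]] := hA _ e2; have [k [B' [sB' PB]]] := hB _ e2.
exists (maxn n k), (A' `|` B'); split.
  apply: (@measurableU _ (g_sigma_algebraType (G (maxn n k)))).
    by apply: sG sA'; exact: leq_maxl.
  by apply: sG sB'; exact: leq_maxr.
apply: Pr_sub3 PA PB _.
- by apply: mY; apply: measurableU => //; [exact: sGm sA'|exact: sGm sB'].
- by apply: mY => //; exact: sGm sA'.
- by apply: mY => //; exact: sGm sB'.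
- move=> x [[[Ax|Bx] /not_orP[nA nB]]|[[Ax|Bx] /not_orP[nA nB]]].
  + by left; left.
  + by right; left.
  + by left; right.
  + by right; right.
- lra.
Qed.

(** The sets that can be approximated form a sigma-algebra, since a countable
union is close to a finite one. *)
Lemma sigma_approximation B : <<s \bigcup_n G n >> B -> forall e : R, 0 < e ->
  exists n A, <<s G n >> A /\ (Pr (B `+` A) <= e%:E)%E.
Proof.
move=> sB; suff : approx B by case.
move: sB; apply: smallest_sub => [|A [n _ GA]]; last first.
  split=> [|e e0]; first exact: G_meas GA.
  exists n, A; split; first exact: sub_sigma_algebra.
  by rewrite setYK measure0 lee_fin ltW.
have approx0 : approx set0.
  split=> // e e0; exists 0, set0; split; first by apply: (@measurable0 _ (g_sigma_algebraType (G 0))).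
  by rewrite setYK measure0 lee_fin ltW.
split=> [//|A [mA hA]|F hF].
  split=> [|e e0]; first by rewrite setTD; exact: measurableC.
  have [n [A' [sA' PA]]] := hA _ e0; exists n, (~` A'); split.
    exact: (@measurableC _ (g_sigma_algebraType (G n))).
  rewrite (_ : (setT `\` A) `+` ~` A' = A `+` A')//.
  apply/seteqP; split => x /=.
    by move=> [[[_ nA] /contrapT A'x]|[nA' /not_andP[//|/contrapT Ax]]]; [right|left].
  by move=> [[Ax nA']|[A'x nA]]; [right; split => // -[]|left; split => //].
have mF n : measurable (F n) by have [] := hF n.
have mU : measurable (\bigcup_n F n) by exact: bigcupT_measurable.
split=> // e e0; have e2 : 0 < e / 2 by rewrite divr_gt0.
pose V n := \big[setU/set0]_(i < n.+1) F i.
have aV n : approx (V n).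
  by rewrite /V; elim/big_rec: _ => // i A _ hA; exact: approxU.
have mV n : measurable (V n) by have [] := aV n.
have UV : \bigcup_n V n = \bigcup_n F n by exact: bigcup_bigsetU_bigcup.
have cV : Pr (V n) @[n --> \oo] --> Pr (\bigcup_n F n).
  rewrite -UV; apply: nondecreasing_cvg_mu => //; first by rewrite UV.
  by move=> n n' nn'; apply/subsetPset; exact: subset_bigsetU.
have fE (A : set T) : measurable A -> Pr A = (fine (Pr A))%:E.
  by move=> mA; rewrite fineK// fin_num_measure.
have [n Pn] : exists n, (Pr ((\bigcup_n F n) `\` V n) <= (e / 2)%:E)%E.
  have := cV; rewrite (fE _ mU).
  move=> /fine_cvgP[_ /cvgrPdist_le /(_ _ e2)[n _ /(_ n (leqnn n))] /= hn].
  have VU : V n `<=` \bigcup_n F n by rewrite -UV; exact: bigcup_sup.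
  have PD : (Pr ((\bigcup_n F n) `\` V n) = Pr (\bigcup_n F n) - Pr (V n))%E.
    by rewrite measureD ?setIidr// ltey_eq fin_num_measure.
  exists n; rewrite PD (fE _ mU) (fE _ (mV n)).
  by rewrite -EFinB lee_fin (le_trans (ler_norm _) hn).
have [_ /(_ _ e2)[k [A [sA PA]]]] := aV n; exists k, A; split=> //.
have mA := sGm sA.
apply: Pr_sub3 Pn PA _ => //.
- exact: mY.
- exact: measurableD.
- exact: mY.
- move=> x [[Fx nA]|[Ax nF]].
    by have [Vx|nV] := pselect (V n x); [right; left|left; split].
  by right; right; split => // Vx; apply: nF; rewrite -UV; exists n.
- lra.
Qed.

End SigmaApproximation.

Section ZeroOne.
Context (R : realType) (d l : nat) (C : 'M[R]_d).
Variable mu : probability (noise_space R d l) R.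
Hypothesis muP : noise_law C mu.

Let window (n : nat) (h : int) : set ('I_l * int + int)%type :=
  [set k | `|index_time k - h| <= n%:Z].

Let coords n h : set_system (noise_space R d l) :=
  \bigcup_(k in window n h) noise_coord k.

Let coords_shift n h B : <<s coords n 0 >> B ->
  <<s coords n h >> (@noise_shift R d l h @^-1` B).
Proof.
apply: preimage_g_sigma; first exact: smallest_sigma_algebra.
move=> {}B [k kn kB]; apply: sub_sigma_algebra; exists (shift_index h k).
  by move: kn; rewrite /window/= index_time_shift subr0 addrK.
exact: noise_coord_shift.
Qed.

Lemma noise_shiftD h h' e :
  @noise_shift R d l h (noise_shift h' e) = noise_shift (h + h') e.
Proof.
by congr (_, _); apply/funext; [case=> j t|move=> t]; rewrite /= addrA.
Qed.

Lemma noise_shift0 e : @noise_shift R d l 0 e = e.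
Proof.
by case: e => a b; congr (_, _); apply/funext; [case=> j t|move=> t]; rewrite /= addr0.
Qed.

(** A shift invariant event is nearly an event [A] of a bounded time window, and
also nearly a translate of [A] far away, which is independent of [A]. *)
Lemma shift_invariant_01 (F : set (noise_space R d l)) : measurable F ->
  @noise_shift R d l 1 @^-1` F = F -> mu F = 0%E \/ mu F = 1%E.
Proof.
move=> mF F1; have [_ _ ind] := muP.
have Fh (n : nat) : @noise_shift R d l n%:Z @^-1` F = F.
  elim: n => [|n IH].
    by apply/seteqP; split => e /=; rewrite noise_shift0.
  rewrite -[RHS]IH -{2}F1; apply/seteqP; split => e /=;
    by rewrite noise_shiftD addrC -PoszD addn1.
have coordsE : \bigcup_k noise_coord k = \bigcup_n coords n 0.
  apply/seteqP; split => [A [k _ kA]|A [n _ [k _ kA]]]; last by exists k.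
  by exists `|index_time k|%N => //; exists k => //; rewrite /window/= subr0.
have key (e : R) : 0 < e -> e <= 1 ->
    fine (mu F) <= (fine (mu F) + e) ^+ 2 + 2 * e.
  move=> e0 e1.
  have [|||n [A [sA PA]]] := @sigma_approximation _ _ R mu (fun n => coords n 0) _ _ F _ e e0.
  - by move=> n A [k _ kA]; exact: noise_coord_measurable kA.
  - move=> n n' nn' A [k kn kA]; exists k => //.
    by apply: le_trans kn _; rewrite lez_nat.
  - by rewrite -coordsE.
  have mA : measurable A.
    apply: (smallest_sub _ _ sA); first exact: (@sigma_algebra_measurable _ (noise_space R d l)).
    by move=> A' [k _ kA]; exact: noise_coord_measurable kA.
  pose h := (n.*2.+1)%:Z; pose A' : set (noise_space R d l) := @noise_shift R d l h @^-1` A.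
  have sA' : <<s coords n h >> A' by exact: coords_shift.
  have PA' : (mu (F `+` A') <= e%:E)%E.
    rewrite -(Fh n.*2.+1).
    rewrite (_ : _ `+` _ = @noise_shift R d l h @^-1` (F `+` A))//.
    by rewrite (noise_law_shift muP)//; apply: measurableU; exact: measurableD.
  have mA' : measurable A'.
    by rewrite -[A']setTI; apply: measurable_noise_shift.
  have AA' : (mu (A `&` A') = mu A * mu A)%E.
    rewrite -{2}(noise_law_shift muP h mA).
    apply: (independent_disjoint _ _ _ ind _ sA sA').
    - exact: noise_coord_setT.
    - exact: noise_coord_setI.
    - exact: noise_coord_measurable.
    - by apply/seteqP; split => // k; rewrite /window/=/h subr0; lia.
  have fE (B : set (noise_space R d l)) : measurable B -> mu B = (fine (mu B))%:E.
    by move=> mB; rewrite fineK// fin_num_measure.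
  have mFA : measurable (F `+` A) by apply: measurableU; exact: measurableD.
  have mFA' : measurable (F `+` A') by apply: measurableU; exact: measurableD.
  have mAA' : measurable (A `&` A') by exact: measurableI.
  have h1 : fine (mu A) <= fine (mu F) + e.
    rewrite -lee_fin EFinD -!fE//; apply: le_trans (leeD (lexx _) PA).
    apply: le_trans (measureU2 _ mF mFA); apply: le_measure; rewrite ?inE//.
      exact: measurableU.
    by move=> x Ax; have [Fx|nF] := pselect (F x); [left|right; right].
  have h2 : fine (mu F) <= fine (mu A) * fine (mu A) + (e + e).
    rewrite -lee_fin !EFinD EFinM -!fE// -AA'.
    apply: (@le_trans _ _ (mu ((A `&` A') `|` ((F `+` A) `|` (F `+` A'))))).
      apply: le_measure; [exact: mem_set| |].
        exact: (mem_set (measurableU _ _ mAA' (measurableU _ _ mFA mFA'))).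
      move=> x Fx; have [Ax|nA] := pselect (A x); last by right; left; left.
      by have [A'x|nA'] := pselect (A' x); [left|right; right; left].
    apply: le_trans (measureU2 _ mAA' (measurableU _ _ mFA mFA')) _.
    by apply: leeD => //; apply: le_trans (measureU2 _ mFA mFA') _; exact: leeD.
  have a0 : 0 <= fine (mu A) by rewrite fine_ge0.
  apply: le_trans h2 _; rewrite expr2 -mulr2n mulr_natl lerD2r.
  by apply: ler_pM.
have f0 : 0 <= fine (mu F) by rewrite fine_ge0.
have f1 : fine (mu F) <= 1.
  by rewrite -lee_fin fineK ?fin_num_measure//; exact: probability_le1.
have fE : mu F = (fine (mu F))%:E by rewrite fineK// fin_num_measure.
suff : fine (mu F) = 0 \/ fine (mu F) = 1 by case=> h; rewrite fE h; [left|right].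
move: (fine (mu F)) f0 f1 key => f f0 f1 key.
have : f * (1 - f) <= 0.
  apply/ler_addgt0Pl => e e0.
  have m0 : 0 < Num.min 1 (e / 5) by rewrite lt_min ltr01 divr_gt0.
  have m1 : Num.min 1 (e / 5) <= 1 by rewrite ge_min lexx.
  have m5 : Num.min 1 (e / 5) <= e / 5 by rewrite ge_min lexx orbT.
  have := key _ m0 m1; move: (Num.min _ _) m0 m1 m5 => m m0 m1 m5.
  nra.
have [->|fn0] := eqVneq f 0; first by left.
have fpos : 0 < f by rewrite lt_neqAle eq_sym fn0.
rewrite pmulr_rle0// subr_le0 => f1'; right; apply/eqP.
by rewrite eq_le f1 f1'.
Qed.

End ZeroOne.

(** * The recurrence driven by the noise *)

Section NoiseFiltration.
Context (R : realType) (d l : nat) (C : 'M[R]_d).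
Variable mu : probability (noise_space R d l) R.
Hypothesis muP : noise_law C mu.

Definition noise_at (I : set ('I_l * int + int)%type) : set_system (noise_space R d l) :=
  \bigcup_(k in I) noise_coord k.

Definition noise_past t := noise_at [set k | index_time k <= t].
Definition noise_pres t := noise_at [set k | index_time k = t].

Lemma noise_at_measurable I : noise_at I `<=` measurable.
Proof. by move=> B [k _ kB]; exact: noise_coord_measurable kB. Qed.

Lemma noise_at_sub I J : I `<=` J -> noise_at I `<=` noise_at J.
Proof. by move=> IJ B [k Ik kB]; exists k => //; exact: IJ. Qed.

Lemma noise_at_independent I J A B : I `&` J = set0 ->
  <<s noise_at I >> A -> <<s noise_at J >> B -> mu (A `&` B) = (mu A * mu B)%E.
Proof.
move=> IJ sA sB; have [_ _ ind] := muP.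
apply: (independent_disjoint _ _ _ ind IJ sA sB).
- exact: noise_coord_setT.
- exact: noise_coord_setI.
- exact: noise_coord_measurable.
Qed.

Lemma noise_pres_past t : noise_pres t `<=` noise_past t.
Proof. by apply: noise_at_sub => k /= ->. Qed.

Lemma noise_past_mono s t : s <= t -> noise_past s `<=` noise_past t.
Proof. by move=> st; apply: noise_at_sub => k /= /le_trans; exact. Qed.

Lemma noise_past_pres_independent t A B :
  <<s noise_past (t - 1) >> A -> <<s noise_pres t >> B ->
  mu (A `&` B) = (mu A * mu B)%E.
Proof.
apply: noise_at_independent; apply/seteqP; split => // k [] /= kt kE.
by move: kt; rewrite kE; lia.
Qed.

Lemma sub_measurable_m I j t : I (inl (j, t)) ->
  sub_measurable (noise_at I) (fun e : noise_space R d l => e.1 (j, t)).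
Proof.
move=> It _ B mB; rewrite setTI; apply: sub_sigma_algebra.
by exists (inl (j, t)) => //; exact: noise_coord_m.
Qed.

Lemma sub_measurable_Q I i t : I (inr t) ->
  sub_measurable (noise_at I) (fun e : noise_space R d l => e.2 t i 0).
Proof.
move=> It _ B mB; rewrite setTI; apply: sub_sigma_algebra.
by exists (inr t) => //; exact: noise_coord_Q.
Qed.

Variable c : 'I_l -> R.

Definition noise_comb (r : seq 'I_l) t (e : noise_space R d l) : R :=
  \sum_(j <- r) c j * e.1 (j, t).

Lemma noise_comb_cons j r t :
  noise_comb (j :: r) t = (fun e => c j * e.1 (j, t) + noise_comb r t e).
Proof. by apply/funext => e; rewrite /noise_comb big_cons. Qed.

Lemma sub_measurable_comb I r t : (forall j, j \in r -> I (inl (j, t))) ->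
  sub_measurable (noise_at I) (noise_comb r t).
Proof.
rewrite /sub_measurable; elim: r => [|j r IH] Ir.
  rewrite (_ : noise_comb _ _ = cst 0); first exact: measurable_cst.
  by apply/funext => e; rewrite /noise_comb big_nil.
rewrite noise_comb_cons; apply: measurable_funD.
  by apply: measurable_funM => //; apply: sub_measurable_m; apply: Ir; rewrite mem_head.
by apply: IH => k kr; apply: Ir; rewrite inE kr orbT.
Qed.

Lemma measurable_comb r t : measurable_fun setT (noise_comb r t).
Proof.
apply: (@sub_measurableW _ _ (noise_at setT)); first exact: noise_at_measurable.
exact: sub_measurable_comb.
Qed.

(** Vanishing linear forms are excluded, as [normal_prob 0 0] is not a Dirac
mass. *)
Lemma comb_normal r t : uniq r -> 0 < \sum_(j <- r) c j ^+ 2 ->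
  centered_normal mu (Num.sqrt (\sum_(j <- r) c j ^+ 2)) (noise_comb r t).
Proof.
have [Nm _ _] := muP.
elim: r => [|j r IH]; first by rewrite big_nil ltxx.
move=> /= /andP[jr ur].
have V0 : 0 <= \sum_(k <- r) c k ^+ 2 by apply: sumr_ge0 => k _; exact: sqr_ge0.
rewrite noise_comb_cons big_cons; have [->|cj] := eqVneq (c j) 0.
  rewrite expr0n add0r => Vpos.
  have -> : (fun e : noise_space R d l => 0 * e.1 (j, t) + noise_comb r t e) = noise_comb r t.
    by apply/funext => e; rewrite mul0r add0r.
  exact: IH.
move=> _; have NS := centered_normal_scale cj ltr01 (Nm (j, t)).
rewrite mulr1 in NS; have cj0 : 0 < `|c j| by rewrite normr_gt0.
have [V00|Vn0] := eqVneq (\sum_(k <- r) c k ^+ 2) 0.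
  rewrite V00 addr0 sqrtr_sqr.
  have -> : (fun e : noise_space R d l => c j * e.1 (j, t) + noise_comb r t e) =
      (fun e => c j * e.1 (j, t)).
    apply/funext => e; rewrite -[RHS]addr0; congr (_ + _); rewrite /noise_comb big_seq big1// => k kr.
    have /eqP := V00; rewrite psumr_eq0 => [|? _]; last exact: sqr_ge0.
    by move=> /allP/(_ _ kr); rewrite sqrf_eq0 => /eqP ->; rewrite mul0r.
  exact: NS.
have Vpos : 0 < \sum_(k <- r) c k ^+ 2 by rewrite lt_neqAle eq_sym Vn0.
have m1 : measurable_fun setT (fun e : noise_space R d l => c j * e.1 (j, t)).
  apply: measurable_funM => //.
  by apply: sub_measurableW (@sub_measurable_m setT j t I); exact: noise_at_measurable.
pose X : {mfun (noise_space R d l) >-> R} := HB.pack (fun e : noise_space R d l => c j * e.1 (j, t))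
  (isMeasurableFun.Build _ _ _ _ _ m1).
pose Y : {mfun (noise_space R d l) >-> R} := HB.pack (noise_comb r t)
  (isMeasurableFun.Build _ _ _ _ _ (measurable_comb r t)).
have ind A B : measurable A -> measurable B ->
    mu (X @^-1` A `&` Y @^-1` B) = (mu (X @^-1` A) * mu (Y @^-1` B))%E.
  move=> mA mB.
  apply: (@noise_at_independent [set inl (j, t)] [set inl (k, t) | k in [set` r]]).
  - apply/seteqP; split => // _ [/= -> [k kr [kj]]].
    by move: jr; rewrite -kj kr.
  - apply: sub_measurable_preimage mA.
    by apply: measurable_funM => //; exact: sub_measurable_m.
  - apply: sub_measurable_preimage mB; apply: sub_measurable_comb => k kr.
    by exists k.
have s0 : 0 < Num.sqrt (\sum_(k <- r) c k ^+ 2) by rewrite sqrtr_gt0.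
have V_eq : c j ^+ 2 + \sum_(k <- r) c k ^+ 2 =
    `|c j| ^+ 2 + Num.sqrt (\sum_(k <- r) c k ^+ 2) ^+ 2.
  by rewrite (sqr_sqrtr V0) real_normK// num_real.
rewrite V_eq; exact: (@centered_normal_add _ _ _ mu _ _ X Y cj0 s0 ind NS (IH ur Vpos)).
Qed.

End NoiseFiltration.

(** * Power tails of sums *)

Section PowerTails.
Context (dT : measure_display) (T : measurableType dT) (R : realType).
Variable Pr : probability T R.
Implicit Types (f g : T -> R) (a c x : R).

Definition tail f x : R := fine (Pr [set w | x < `|f w|]).

Definition power_tail f a c := x `^ a * tail f x @[x --> +oo] --> c.

Let mtail f x : measurable_fun setT f -> measurable [set w | x < `|f w|].
Proof. by move=> mf; apply: measurable_gtr; exact: measurableT_comp. Qed.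

Let fineP (B : set T) : measurable B -> Pr B = (fine (Pr B))%:E.
Proof. by move=> mB; rewrite fineK// fin_num_measure. Qed.

Lemma tail_ge0 f x : 0 <= tail f x. Proof. by rewrite fine_ge0. Qed.

Lemma tail_le_add f g (h : T -> R) (x y z : R) : measurable_fun setT f -> measurable_fun setT g ->
  measurable_fun setT h ->
  (forall w, x < `|f w| -> y < `|g w| \/ z < `|h w|) -> tail f x <= tail g y + tail h z.
Proof.
move=> mf mg mh H; rewrite -lee_fin EFinD /tail.
rewrite -(fineP (mtail _ mf)) -(fineP (mtail _ mg)) -(fineP (mtail _ mh)).
apply: le_trans (measureU2 _ (mtail _ mg) (mtail _ mh)).
apply: le_measure; rewrite ?inE; [exact: mtail| |exact: H].
by apply: measurableU; exact: mtail.
Qed.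

Let pinfty_scale (r : R) : 0 < r -> (fun x : R => r * x) @ +oo --> +oo.
Proof.
move=> r0; apply/cvgryPge => A; near=> x.
by rewrite mulrC -ler_pdivrMr.
Unshelve. all: by end_near. Qed.

Lemma power_tail_scale f a c (r : R) : 0 < r -> power_tail f a c ->
  x `^ a * tail f (r * x) @[x --> +oo] --> r `^ (- a) * c.
Proof.
move=> r0 fc; have := cvg_comp _ _ (pinfty_scale r0) fc => h.
have : r `^ (- a) * ((r * x) `^ a * tail f (r * x)) @[x --> +oo] --> r `^ (- a) * c.
  by apply: cvgMr.
apply: cvg_trans; apply: near_eq_cvg; near=> x.
have x0 : 0 < x by near: x; apply: nbhs_pinfty_gt; rewrite num_real.
rewrite powRM ?(ltW r0) ?(ltW x0)// mulrA mulrA -powRD ?addNr ?powRr0 ?mul1r//.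
by rewrite (gt_eqF r0) implybT.
Unshelve. all: by end_near. Qed.

Lemma power_tailZ f a c (k : R) : k != 0 -> power_tail f a c ->
  power_tail (fun w => k * f w) a (`|k| `^ a * c).
Proof.
move=> k0 fc; have nk : 0 < `|k| by rewrite normr_gt0.
have ik : 0 < `|k|^-1 by rewrite invr_gt0.
have := power_tail_scale ik fc.
rewrite (_ : `|k|^-1 `^ (- a) = `|k| `^ a); last first.
  by rewrite -powR_inv1 ?ltW// -powRrM mulN1r opprK.
rewrite /power_tail (_ : tail (fun w => k * f w) = fun x => tail f (`|k|^-1 * x))//.
apply/funext => x; rewrite /tail; congr (fine (Pr _)); apply/seteqP; split => w /=;
  by rewrite normrM [_^-1 * x]mulrC ltr_pdivrMr// mulrC.
Qed.

Lemma power_tail0_add f g a : measurable_fun setT f -> measurable_fun setT g ->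
  power_tail f a 0 -> power_tail g a 0 -> power_tail (fun w => f w + g w) a 0.
Proof.
move=> mf mg f0 g0; have h0 : 0 < 2^-1 :> R by rewrite invr_gt0.
have up : x `^ a * tail f (2^-1 * x) + x `^ a * tail g (2^-1 * x) @[x --> +oo] --> (0 : R).
  rewrite -[X in _ --> X]addr0 -{1}(mulr0 (2^-1 `^ (- a))) -{2}(mulr0 (2^-1 `^ (- a))).
  exact: cvgD (power_tail_scale h0 f0) (power_tail_scale h0 g0).
apply: (@squeeze_cvgr _ _ _ _ (cst 0)
  (fun x => x `^ a * tail f (2^-1 * x) + x `^ a * tail g (2^-1 * x)));
  [|exact: cvg_cst|exact: up].
apply: nearW => x; rewrite mulr_ge0 ?powR_ge0 ?tail_ge0//=.
rewrite -mulrDr ler_wpM2l ?powR_ge0//; apply: tail_le_add => //.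
  exact: measurable_funD.
move=> w xw; have [fx|fx] := ltP (2^-1 * x) `|f w|; first by left.
right; have := le_lt_trans (lexx _) (lt_le_trans xw (ler_normD _ _)); lra.
Qed.

Let powR_cvg0 (p : R) : 0 < p -> x `^ (- p) @[x --> +oo] --> (0 : R).
Proof.
move=> p0; apply/cvgrPdist_le => e e0; near=> x.
have x0 : 0 < x by near: x; apply: nbhs_pinfty_gt; rewrite num_real.
have xe : e^-1 `^ p^-1 <= x by near: x; apply: nbhs_pinfty_ge; rewrite num_real.
rewrite sub0r normrN ger0_norm ?powR_ge0// powRN.
rewrite -[leRHS]invrK lef_pV2 ?posrE ?invr_gt0 ?powR_gt0//.
have := ge0_ler_powR (ltW p0); move=> /(_ _ x); rewrite !nnegrE.
move=> /(_ _ (powR_ge0 _ _) (ltW x0) xe).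
by rewrite -powRrM mulVf ?gt_eqF// powRr1// invr_ge0 ltW.
Unshelve. all: by end_near. Qed.

(* The scaling factor that changes a power tail by the factor [1 + e]. *)
Let root_gt1 (a e : R) : 0 < a -> 0 < e ->
  exists s : R, [/\ 1 < s, s `^ (- a) = (1 + e)^-1 & s^-1 `^ (- a) = 1 + e].
Proof.
move=> a0 e0; pose s := (1 + e) `^ a^-1.
have e1 : 1 < 1 + e by rewrite ltrDl.
have s1 : 1 < s.
  have p1 : 1 `^ a^-1 = 1 :> R by rewrite powR1.
  rewrite -[ltLHS]p1; apply: gt0_ltr_powR => //; rewrite ?invr_gt0 ?nnegrE//.
  exact: le_trans (ltW e1).
have sa : s `^ a = 1 + e.
  by rewrite /s -powRrM mulVf ?gt_eqF// powRr1// ltW// (lt_trans ltr01).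
exists s; split => //; first by rewrite powRN sa.
by rewrite -(powR_inv1 (le_trans ler01 (ltW s1))) -powRrM mulN1r opprK.
Qed.

Lemma power_tail0_cst a : power_tail (fun=> 0) a 0.
Proof.
rewrite /power_tail; apply: cvg_near_cst; near=> x.
have x0 : 0 < x by near: x; apply: nbhs_pinfty_gt; rewrite num_real.
rewrite /tail (_ : [set w | _] = set0) ?measure0 ?mulr0//.
by apply/seteqP; split => // w /=; rewrite normr0 ltNge ltW.
Unshelve. all: by end_near. Qed.

Lemma power_tail0_sum (I : Type) (r : seq I) (p : pred I) (F : I -> T -> R) a :
  (forall j, measurable_fun setT (F j)) -> (forall j, p j -> power_tail (F j) a 0) ->
  power_tail (fun w => \sum_(j <- r | p j) F j w) a 0.
Proof.
move=> mF F0.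
elim: r => [|j r IH].
  rewrite (_ : (fun w => _) = (fun=> 0)); first exact: power_tail0_cst.
  by apply/funext => w; rewrite big_nil.
have E (w : T) : \sum_(i <- j :: r | p i) F i w =
    (if p j then F j w + \sum_(i <- r | p i) F i w else \sum_(i <- r | p i) F i w).
  by rewrite big_cons.
rewrite (_ : (fun w => _) = (fun w => if p j then F j w + \sum_(i <- r | p i) F i w
  else \sum_(i <- r | p i) F i w)); last by apply/funext => w; exact: E.
case pj : (p j); last exact: IH.
exact: (power_tail0_add (mF j) (measurable_sum_cond r p mF) (F0 j pj) IH).
Qed.

Lemma power_tail0_of_bound f a (b K : R) : a < b ->
  (forall x, 0 < x -> (Pr [set w | (x < `|f w|)%R] <= (K * x `^ (- b))%:E)%E) ->
  measurable_fun setT f -> power_tail f a 0.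
Proof.
move=> ab hK mf.
have ba : 0 < b - a by rewrite subr_gt0.
have lim0 : K * x `^ (- (b - a)) @[x --> +oo] --> (0 : R).
  rewrite -(mulr0 K); apply: cvgMr.
  exact: powR_cvg0.
apply: (@squeeze_cvgr _ _ _ _ (cst 0) (fun x => K * x `^ (- (b - a))));
  [|exact: cvg_cst|exact: lim0].
near=> x.
have x0 : 0 < x by near: x; apply: nbhs_pinfty_gt; rewrite num_real.
rewrite mulr_ge0 ?powR_ge0 ?tail_ge0//=.
have : tail f x <= K * x `^ (- b).
  by rewrite -lee_fin /tail -fineP; [exact: hK|exact: mtail].
move=> /(ler_wpM2l (powR_ge0 x a)) /le_trans; apply.
rewrite mulrCA -powRD ?(gt_eqF x0) ?implybT//.
by have -> : a - b = - (b - a) by ring.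
Unshelve. all: by end_near. Qed.

Let power_tail_bounds f g a c (e : R) : 0 < a -> 0 <= c ->
  measurable_fun setT f -> measurable_fun setT g ->
  power_tail f a c -> power_tail g a 0 -> 0 < e -> \forall x \near +oo,
    (1 + e)^-1 * c - e <= x `^ a * tail (fun w => f w + g w) x <= (1 + e) * c + e.
Proof.
move=> a0 c0 mf mg fc g0.
have mfg : measurable_fun setT (fun w => f w + g w) by exact: measurable_funD.
move=> e0; have [s [s1 Es Eis]] := root_gt1 a0 e0.
have s0 : 0 < s by lra.
have is0 : 0 < s^-1 by rewrite invr_gt0.
have is1 : 0 < 1 - s^-1 by rewrite subr_gt0 invf_lt1.
have lo : x `^ a * tail f (s * x) - x `^ a * tail g ((1 - s^-1) * x) @[x --> +oo] -->
    (1 + e)^-1 * c.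
  rewrite -Es -[X in _ --> X]subr0 -(mulr0 ((1 - s^-1) `^ (- a))).
  exact: cvgB (power_tail_scale s0 fc) (power_tail_scale is1 g0).
have up : x `^ a * tail f (s^-1 * x) + x `^ a * tail g ((1 - s^-1) * x) @[x --> +oo] -->
    (1 + e) * c.
  rewrite -Eis -[X in _ --> X]addr0 -(mulr0 ((1 - s^-1) `^ (- a))).
  exact: cvgD (power_tail_scale is0 fc) (power_tail_scale is1 g0).
have e2 : (1 + e)^-1 * c - e < (1 + e)^-1 * c by rewrite gtrBl.
have e3 : (1 + e) * c < (1 + e) * c + e by rewrite ltrDl.
near=> x.
have x0 : 0 < x by near: x; apply: nbhs_pinfty_gt; rewrite num_real.
apply/andP; split.
  apply: (@le_trans _ _ (x `^ a * tail f (s * x) - x `^ a * tail g ((1 - s^-1) * x))).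
    by near: x; exact: (@cvgr_ge _ _ _ _ _ _ lo _ e2).
  rewrite lerBlDr -mulrDr ler_wpM2l ?powR_ge0//; apply: tail_le_add => // w sx.
  have [h1|h1] := ltP x `|f w + g w|; first by left.
  right; have := ler_normB (f w + g w) (g w); rewrite addrK => h2.
  have ss : s * s^-1 = 1 by rewrite divff// gt_eqF.
  have := mulr_ge0 (mulr_ge0 (sqr_ge0 (s - 1)) (ltW is0)) (ltW x0).
  have -> : (s - 1) ^+ 2 * s^-1 * x = (s * (s * s^-1) - 2 * (s * s^-1) + s^-1) * x by ring.
  by rewrite ss; nra.
apply: (@le_trans _ _ (x `^ a * tail f (s^-1 * x) + x `^ a * tail g ((1 - s^-1) * x))).
  rewrite -mulrDr ler_wpM2l ?powR_ge0//; apply: tail_le_add => // w sx.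
  have [h1|h1] := ltP (s^-1 * x) `|f w|; first by left.
  by right; have := lt_le_trans sx (ler_normD (f w) (g w)); nra.
by near: x; exact: (@cvgr_le _ _ _ _ _ _ up _ e3).
Unshelve. all: by end_near. Qed.

(** The tail of the sum at [x] lies between those of [f] at levels slightly below
and above [x], up to the tail of [g] at a fixed fraction of [x]. *)
Lemma power_tail_add f g a c : 0 < a -> 0 <= c ->
  measurable_fun setT f -> measurable_fun setT g ->
  power_tail f a c -> power_tail g a 0 -> power_tail (fun w => f w + g w) a c.
Proof.
move=> a0 c0 mf mg fc g0.
apply/cvgrPdist_le => e e0.
(* The bounds for [e'] are within [e' * (c + 1)] of [c]. *)
pose e' := e / (c + 1).
have c1 : 0 < c + 1 by lra.
have e'0 : 0 < e' by rewrite divr_gt0.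
have ec : e' * (c + 1) = e by rewrite divfK ?gt_eqF.
apply: filterS (power_tail_bounds a0 c0 mf mg fc g0 e'0) => x /andP[lo up].
have il : 1 - e' <= (1 + e')^-1.
  rewrite -[leRHS]mul1r ler_pdivlMr; [nra|lra].
have : (1 - e') * c <= (1 + e')^-1 * c by exact: ler_wpM2r.
by rewrite ler_distlC; nra.
Qed.

(** By symmetry each of the two one-sided tails is half of the tail; the event
[f <= - x] is compared with open events at levels close to [x]. *)
Lemma power_tail_regularly_varying f a c : 0 < a -> 0 < c -> measurable_fun setT f ->
  (forall B, measurable B -> Pr [set w | B (- f w)] = Pr [set w | B (f w)]) ->
  power_tail f a c -> regularly_varying Pr f a.
Proof.
move=> a0 c0 mf sym fc.
have ratio k : 0 < k -> tail f (k * x) / tail f x @[x --> +oo] --> k `^ (- a).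
  move=> k0; have h : (x `^ a * tail f (k * x)) * (x `^ a * tail f x)^-1 @[x --> +oo] --> k `^ (- a).
    rewrite -[X in _ --> X](mulfK (lt0r_neq0 c0)).
    exact: cvgM (power_tail_scale k0 fc) (cvgV (lt0r_neq0 c0) fc).
  move: h; apply: cvg_trans; apply: near_eq_cvg; near=> x.
  have x0 : 0 < x by near: x; apply: nbhs_pinfty_gt; rewrite num_real.
  rewrite invfM mulrACA divff ?mul1r// gt_eqF// powR_gt0//.
have pos : \forall x \near +oo, 0 < tail f x.
  have c2 : c / 2 < c by lra.
  near=> x; have : 0 < x `^ a * tail f x.
    apply: lt_le_trans (_ : c / 2 <= _); first by rewrite divr_gt0.
    by near: x; exact: (@cvgr_ge _ _ _ _ _ _ fc).
  by rewrite pmulr_rgt0// powR_gt0//; near: x; apply: nbhs_pinfty_gt; rewrite num_real.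
have mgt x : measurable [set w | x < f w] by exact: measurable_gtr.
have half x : 0 < x -> fine (Pr [set w | x < f w]) = tail f x / 2.
  move=> x0; have mlt : measurable [set w | x < - f w].
    by apply: measurable_gtr; exact: measurableT_comp.
  have E : Pr [set w | x < - f w] = Pr [set w | x < f w].
    have := sym `]x, +oo[%classic (measurable_itv _).
    have E (g : T -> R) : [set w | `]x, +oo[%classic (g w)] = [set w | x < g w].
      by apply/seteqP; split => w /=; rewrite in_itv/= andbT.
    by rewrite (E (fun w => - f w)) (E f).
  have : (Pr [set w | (x < `|f w|)%R] = Pr [set w | (x < f w)%R] + Pr [set w | (x < - f w)%R])%E.
    rewrite -measureU//; last first.
      by apply/seteqP; split => // w [/= h1 h2]; lra.
    congr (Pr _); apply/seteqP; split => w /=; rewrite ltr_normr.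
      by move=> /orP[]; [left|right].
    by move=> [->|->]; rewrite ?orbT.
  rewrite E /tail => ->; rewrite fineD ?fin_num_measure//.
  by field.
have near_pos : \forall x \near +oo, 0 < x :> R.
  by apply: nbhs_pinfty_gt; rewrite num_real.
split; [exact: ltW|exact: ratio|exists 2^-1, 2^-1; split].
- by rewrite invr_ge0.
- by rewrite invr_ge0.
- by field.
- apply: cvg_near_cst; apply: filterS2 near_pos pos => x x0 tx.
  by rewrite half// mulrAC divff ?mul1r// gt_eqF.
apply/cvgrPdist_le => e e0.
have [s [s1 _ Es]] := root_gt1 a0 e0.
have s0 : 0 < s by lra.
have is0 : 0 < s^-1 by rewrite invr_gt0.
have := ratio _ is0; rewrite Es => rs.
have e1 : 1 + e < 1 + 2 * e by lra.
have h2 : \forall x \near +oo, tail f (s^-1 * x) / tail f x <= 1 + 2 * e.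
  exact: (@cvgr_le _ _ _ _ _ _ rs).
apply: filterS3 near_pos pos h2 => x x0 tx.
rewrite ler_pdivrMr// => h2.
have mge : measurable [set w | x <= f w].
  have := mf measurableT `[x, +oo[%classic (measurable_itv _).
  by rewrite setTI; congr measurable; apply/seteqP; split => w /=; rewrite in_itv/= andbT.
have -> : Pr [set w | f w <= - x] = Pr [set w | x <= f w].
  have := sym `]-oo, - x]%classic (measurable_itv _).
  have E (g : T -> R) : [set w | `]-oo, - x]%classic (g w)] = [set w | g w <= - x].
    by apply/seteqP; split => w /=; rewrite in_itv/=.
  rewrite (E (fun w => - f w)) (E f) => <-; congr (Pr _).
  by apply/seteqP; split => w /=; rewrite lerN2.
have lo : tail f x / 2 <= fine (Pr [set w | x <= f w]).
  rewrite -half// -lee_fin -!fineP//.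
  by apply: le_measure; rewrite ?inE// => w /ltW.
have sx0 : 0 < s^-1 * x by rewrite mulr_gt0.
have sx : s^-1 * x < x by rewrite gtr_pMl// invf_lt1.
have up : fine (Pr [set w | x <= f w]) <= tail f (s^-1 * x) / 2.
  rewrite -half// -lee_fin -!fineP//.
  by apply: le_measure; rewrite ?inE// => w; exact: lt_le_trans.
have et := mulr_gt0 e0 tx.
rewrite -/(tail f x) ler_distlC; apply/andP; split;
  [rewrite ler_pdivlMr//; move: lo up h2 et; lra|rewrite ler_pdivrMr//; move: lo up h2 et; lra].
Unshelve. all: by end_near. Qed.

End PowerTails.

(** * The stationary solution as a function of the noise *)

Section Diagonal.
Context (R : realType) (d l : nat) (C : 'M[R]_d).
Variables (P : 'M[R]_d) (D : 'I_l -> 'M[R]_d).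
Local Notation E := (noise_space R d l).

(** The coordinates of [P X] satisfy scalar recurrences; these are their
coefficients. *)
Definition diag_mult i t (e : E) : R := noise_comb (fun j => D j i i) (index_enum _) t e.
Definition diag_add i t (e : E) : R := (P *m e.2 t) i 0.
Definition diag_coord i t (e : E) : R := perp (diag_mult i ^~ e) (diag_add i ^~ e) t.
Definition path_solution t (e : E) : 'cV[R]_d := invmx P *m \col_i diag_coord i t e.

Lemma diag_coord_shift i t h e :
  diag_coord i (t + h) e = diag_coord i t (noise_shift h e).
Proof. exact: perp_shift. Qed.

Lemma path_solution_shift t h e :
  path_solution (t + h) e = path_solution t (noise_shift h e).
Proof.
rewrite /path_solution; congr (_ *m _); apply/colP => i; rewrite !mxE.
exact: diag_coord_shift.
Qed.

Variable mu : probability E R.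
Hypotheses (muP : noise_law C mu) (C_posdef : posdefmx C) (P_unit : P \in unitmx).
Variable alphaY : 'I_d -> R.
Hypothesis alphaY_gt0 : forall i, 0 < alphaY i.
Hypothesis alphaY_moment : forall i t, amoment mu (alphaY i) (diag_mult i t) = 1%E.

Definition mult_sd i : R := Num.sqrt (\sum_j D j i i ^+ 2).
Definition add_sd i : R := Num.sqrt ((row i P *m C *m (row i P)^T) 0 0).

Lemma sub_measurable_mult I i t : (forall j, I (inl (j, t))) ->
  sub_measurable (noise_at I) (diag_mult i t).
Proof. by move=> It; exact: sub_measurable_comb. Qed.

Lemma sub_measurable_add I i t : I (inr t) ->
  sub_measurable (noise_at I) (diag_add i t).
Proof.
move=> It; rewrite /sub_measurable.
rewrite (_ : diag_add i t = (fun e : E => \sum_j P i j * e.2 t j 0)); last first.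
  by apply/funext => e; rewrite /diag_add mxE.
by apply: measurable_sum => j; apply: measurable_funM => //; exact: sub_measurable_Q.
Qed.

Let sa i t : sub_measurable (noise_pres t) (diag_mult i t).
Proof. exact: sub_measurable_mult. Qed.

Let sb i t : sub_measurable (noise_pres t) (diag_add i t).
Proof. exact: sub_measurable_add. Qed.

Let sd0 i : 0 < \sum_j D j i i ^+ 2.
Proof.
rewrite lt_neqAle sumr_ge0 ?andbT => [|j _]; last exact: sqr_ge0.
apply/eqP => /esym/eqP; rewrite psumr_eq0 => [/allP D0|j _]; last exact: sqr_ge0.
have m0 e : diag_mult i 0 e = 0.
  rewrite /diag_mult /noise_comb big1// => j _.
  by have := D0 j (mem_index_enum j); rewrite sqrf_eq0 => /eqP ->; rewrite mul0r.
have := alphaY_moment i 0; rewrite /amoment.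
under eq_integral => e _ do rewrite m0 normr0 powR0 ?gt_eqF//.
by rewrite integral0 => /eqP; rewrite eq_sym onee_eq0.
Qed.

Lemma mult_sd_gt0 i : 0 < mult_sd i. Proof. by rewrite sqrtr_gt0. Qed.

Let row_neq0 i : (row i P)^T != 0.
Proof.
apply/eqP => r0; have : row i P *m invmx P = 0 by rewrite -[row i P]trmxK r0 trmx0 mul0mx.
rewrite -row_mul mulmxV// row1 => /rowP/(_ i); rewrite !mxE !eqxx => /eqP.
by rewrite oner_eq0.
Qed.

Lemma add_sd_gt0 i : 0 < add_sd i.
Proof.
rewrite sqrtr_gt0; have [_ h] := C_posdef.
by have := h _ (row_neq0 i); rewrite trmxK.
Qed.

Lemma mult_normal i t : centered_normal mu (mult_sd i) (diag_mult i t).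
Proof. exact: (comb_normal muP (c := fun j => D j i i) t (index_enum_uniq _) (sd0 i)). Qed.

Lemma add_normal i t : centered_normal mu (add_sd i) (diag_add i t).
Proof.
have [_ NQ _] := muP; have := NQ t _ (row_neq0 i); rewrite trmxK.
by congr centered_normal; apply/funext => e; rewrite /diag_add -row_mul mxE.
Qed.

Lemma mult_add_independent i t A B : measurable A -> measurable B ->
  mu (diag_mult i t @^-1` A `&` diag_add i t @^-1` B) =
  (mu (diag_mult i t @^-1` A) * mu (diag_add i t @^-1` B))%E.
Proof.
move=> mA mB.
apply: (noise_at_independent muP (I := [set inl (j, t) | j in setT]) (J := [set inr t])).
- by apply/seteqP; split => // _ [/= [j _ <-]].
- by apply: sub_measurable_preimage mA; apply: sub_measurable_mult => j; exists j.
- by apply: sub_measurable_preimage mB; exact: sub_measurable_add.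
Qed.

Let meas t := @noise_at_measurable R d l [set k | index_time k <= t].
Let indep := noise_past_pres_independent muP.
Let pp := @noise_pres_past R d l.
Let pm := @noise_past_mono R d l.

Lemma diag_coord_ae_cvg i t :
  {ae mu, forall e, cvgn (rsum (diag_mult i ^~ e) (diag_add i ^~ e) t)}.
Proof.
exact: (perp_ae_cvg meas pp pm indep (sa i) (sb i) (alphaY_gt0 i) (mult_sd_gt0 i)
  (add_sd_gt0 i) (mult_normal i) (add_normal i) (alphaY_moment i)).
Qed.

Lemma measurable_diag_coord i t : measurable_fun setT (diag_coord i t).
Proof.
apply: (measurable_perpT meas pp pm (sa i)) => s.
exact: (sub_measurable_add (I := [set k | index_time k <= s]) i (lexx s)).
Qed.

Lemma measurable_path_solution t i : measurable_fun setT (fun e => path_solution t e i 0).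
Proof.
rewrite (_ : (fun e => _) = (fun e : E => \sum_j invmx P i j * diag_coord j t e)); last first.
  by apply/funext => e; rewrite mxE; apply: eq_bigr => j _; rewrite mxE.
by apply: measurable_sum => j; apply: measurable_funM => //; exact: measurable_diag_coord.
Qed.

Lemma diag_coord_tail i beta : 0 < beta -> beta < alphaY i ->
  exists2 K : R, 0 <= K & forall t x, 0 < x ->
    (mu [set e | (x < `|diag_coord i t e|)%R] <= (K * x `^ (- beta))%:E)%E.
Proof.
exact: (perp_tail_alpha meas pp pm indep (sa i) (sb i) (mult_sd_gt0 i)
  (add_sd_gt0 i) (mult_normal i) (add_normal i) (alphaY_moment i)).
Qed.

(** Products of many multipliers are small, since their moments of an order below
[alphaY i] decay geometrically. *)
Lemma mult_product_small i (x e : R) : 0 < x -> 0 < e -> exists k, forall t,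
  (mu [set w | (x < `|rterm (diag_mult i ^~ w) (cst 1) t k|)%R] <= e%:E)%E.
Proof.
move=> x0 e0; pose beta := alphaY i / 2.
have b0 : 0 < beta by rewrite divr_gt0.
have ba : beta < alphaY i by rewrite ltr_pdivrMr// ltr_pMr// ltr1n.
have [rho rho1 ha] := a_amoment_lt1 meas pp (sa i) (mult_sd_gt0 i) (mult_normal i)
  (alphaY_moment i) b0 ba.
have rho0 : 0 <= rho by rewrite -lee_fin -(ha 0) amoment_ge0.
have s1 t : sub_measurable (@noise_past R d l t) (fun=> 1 : R) by exact: measurable_cst.
have one (t : int) : amoment mu beta (fun _ : E => 1 : R) = 1%:E.
  by rewrite /amoment normr1 powR1 integral_cst// mul1e; exact: probability_setT.
have xb : 0 < x `^ beta by exact: powR_gt0.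
have xbe : 0 < x `^ beta * e by rewrite mulr_gt0.
have r1 : `|rho| < 1 by rewrite ger0_norm.
have /cvgrPdist_le /(_ _ xbe)[k _ /(_ k (leqnn k))] := cvg_expr r1.
rewrite /= sub0r normrN ger0_norm ?exprn_ge0// => hk.
exists k => t.
have mr := measurable_rtermT meas pp pm (sa i) (b := fun _ _ => 1) s1 t k.
have := markov_amoment mu (ltW b0) x0 mr.
rewrite (amoment_rterm meas pp pm indep (sa i) s1 ha one) mulr1 => h.
rewrite -(lee_pmul2l (x := (x `^ beta)%:E))// ?lte_fin//.
by apply: le_trans h _; rewrite -EFinM lee_fin.
Qed.

Lemma diag_coord_stationary i t s B : measurable B ->
  mu (diag_coord i t @^-1` B) = mu (diag_coord i s @^-1` B).
Proof.
suff h r : measurable B -> mu (diag_coord i r @^-1` B) = mu (diag_coord i 0 @^-1` B).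
  by move=> mB; rewrite (h t mB) (h s mB).
move=> mB; have mY : measurable (diag_coord i 0 @^-1` B).
  by rewrite -[X in measurable X]setTI; apply: measurable_diag_coord.
rewrite -(noise_law_shift muP r mY); congr (mu _); apply/seteqP.
by split => e /=; rewrite -diag_coord_shift add0r.
Qed.

Lemma diag_coord_tail_limit i : exists2 c : R, 0 < c & forall t,
  x `^ alphaY i * fine (mu [set e | x < `|diag_coord i t e|]) @[x --> +oo] --> c.
Proof.
exact: (perp_tail_limit meas pp pm indep (sa i) (sb i) (alphaY_gt0 i) (mult_sd_gt0 i)
  (add_sd_gt0 i) (mult_normal i) (add_normal i) (@mult_add_independent i)
  (alphaY_moment i) (@diag_coord_stationary i)).
Qed.

(** The noise and its reflection [(m, - Q)] have the same law. *)
Lemma path_solution_symmetric t i B : measurable B ->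
  mu [set e | B (- path_solution t e i 0)] = mu [set e | B (path_solution t e i 0)].
Proof.
move=> mB; pose S : set E := [set e | B (path_solution t e i 0)].
have mX := measurable_path_solution t i.
have mS : measurable S by rewrite -[X in measurable X]setTI; exact: mX.
have mN : measurable ([set e | B (- path_solution t e i 0)] : set E).
  by have := measurableT_comp (@oppr_measurable R setT) mX measurableT mB; rewrite setTI.
have mF : measurable ((@noise_flip R d l) @^-1` S : set E).
  have h := measurable_noise_flip; have := h R d l measurableT S mS.
  by rewrite setTI.
rewrite -[RHS](noise_law_flip muP mS); apply: (eq_measure_ae mN mF).
have : {ae mu, forall e, forall j, cvgn (rsum (diag_mult j ^~ e) (diag_add j ^~ e) t)}.
  by apply: filter_forall => j; exact: diag_coord_ae_cvg.
apply: filterS => e cv; rewrite /S /=.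
suff -> : path_solution t (noise_flip e) = - path_solution t e.
  have -> // : (- path_solution t e) i 0 = - path_solution t e i 0 by rewrite [LHS]mxE.
rewrite /path_solution -mulmxN; congr (_ *m _); apply/colP => j; rewrite !mxE.
rewrite /diag_coord -perpN//; congr (perp _ _ _); apply/funext => s.
by rewrite /diag_add /= mulmxN mxE.
Qed.

(** Among the coordinates that enter [X i], the one with the least exponent
dominates. *)
Lemma path_solution_regularly_varying i a t :
  lbound (tail_indices P alphaY i) a ->
  (exists! j : 'I_d, invmx P i j != 0 /\ alphaY j = a) ->
  regularly_varying mu (fun e => path_solution t e i 0) a.
Proof.
move=> lba [j0 [[Pj0 aj0] uniq]].
have a0 : 0 < a by rewrite -aj0.
have mY j := measurable_diag_coord j t.
have [c c0 hc] := diag_coord_tail_limit j0.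
have main : power_tail mu (fun e => invmx P i j0 * diag_coord j0 t e) a (`|invmx P i j0| `^ a * c).
  by apply: power_tailZ => //; rewrite -aj0; exact: hc.
have rest : power_tail mu (fun e => \sum_(j | j != j0) invmx P i j * diag_coord j t e) a 0.
  apply: power_tail0_sum => [j|j jj0]; first exact: measurable_funM.
  have [->|Pj] := eqVneq (invmx P i j) 0.
    rewrite (_ : (fun e : E => 0 * diag_coord j t e) = (fun=> 0)); first exact: power_tail0_cst.
    by apply/funext => e; rewrite mul0r.
  have aj : a < alphaY j.
    rewrite lt_neqAle; apply/andP; split; last by apply: lba; exists j.
    by apply/eqP => aE; move/eqP: jj0; apply; rewrite (uniq j).
  have ab : a < (a + alphaY j) / 2 by lra.
  have b0 : 0 < (a + alphaY j) / 2 by lra.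
  have ba : (a + alphaY j) / 2 < alphaY j by lra.
  have [K _ hK] := @diag_coord_tail j _ b0 ba.
  rewrite -(mulr0 (`|invmx P i j| `^ a)); apply: power_tailZ => //.
  exact: power_tail0_of_bound ab (hK t) (mY j).
have XE : (fun e => path_solution t e i 0) = (fun e =>
    invmx P i j0 * diag_coord j0 t e + \sum_(j | j != j0) invmx P i j * diag_coord j t e).
  apply/funext => e; rewrite mxE (bigD1 j0)//= mxE; congr (_ + _).
  by apply: eq_bigr => j _; rewrite mxE.
apply: (@power_tail_regularly_varying _ _ _ mu _ a (`|invmx P i j0| `^ a * c)) => //.
- by rewrite mulr_gt0// powR_gt0// normr_gt0.
- exact: measurable_path_solution.
- by move=> B; exact: path_solution_symmetric.
rewrite XE; apply: power_tail_add => //.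
- by rewrite mulr_ge0 ?powR_ge0// ltW.
- exact: measurable_funM.
- by apply: measurable_sum_cond => j; exact: measurable_funM.
Qed.

Variable A : 'I_l -> 'M[R]_d.
Hypothesis D_diag : forall j, is_diag_mx (D j).
Hypothesis D_def : forall j, D j = P *m A j *m invmx P.

(** Conjugation by [P] diagonalizes the recurrence. *)
Lemma diag_step t e (x : 'cV[R]_d) i :
  (P *m ((\sum_j e.1 (j, t) *: A j) *m x + e.2 t)) i 0 =
  diag_mult i t e * (P *m x) i 0 + diag_add i t e.
Proof.
rewrite mulmxDr mxE; congr (_ + _).
have -> : P *m ((\sum_j e.1 (j, t) *: A j) *m x) = \sum_j e.1 (j, t) *: (D j *m (P *m x)).
  rewrite mulmx_suml mulmx_sumr; apply: eq_bigr => j _.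
  by rewrite D_def -scalemxAl -scalemxAr -!mulmxA mulKmx.
rewrite summxE /diag_mult /noise_comb mulr_suml; apply: eq_bigr => j _.
rewrite mxE mxE (bigD1 i)//= big1 ?addr0 => [|k ki]; first by rewrite mulrCA mulrA.
by have /is_diag_mxP -> := D_diag j; rewrite ?mul0r// eq_sym.
Qed.

Lemma path_solution_rec t : {ae mu, forall e,
  path_solution t e = (\sum_j e.1 (j, t) *: A j) *m path_solution (t - 1) e + e.2 t}.
Proof.
have : {ae mu, forall e, forall i, cvgn (rsum (diag_mult i ^~ e) (diag_add i ^~ e) (t - 1))}.
  by apply: filter_forall => i; exact: diag_coord_ae_cvg.
apply: filterS => e cv.
apply: (can_inj (mulKmx P_unit)); apply/colP => i.
rewrite diag_step /path_solution !mulKVmx// !mxE.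
exact: perp_rec.
Qed.

End Diagonal.

(** * The process on the original probability space *)

Section NoiseOf.
Context (dT : measure_display) (T : measurableType dT) (R : realType).
Variable Pr : probability T R.
Variables (d l : nat) (C : 'M[R]_d).
Variables (m : 'I_l -> int -> {RV Pr >-> R}) (Q : int -> T -> 'cV[R]_d).
Hypothesis noise : bekk_noise C m Q.

Definition noise_of (w : T) : noise_space R d l :=
  (fun jt => m jt.1 jt.2 w, fun t => Q t w).

Lemma measurable_noise_of : measurable_fun setT noise_of.
Proof.
move=> _ B mB; rewrite setTI.
apply: (preimage_g_sigma (@sigma_algebra_measurable _ T) _ mB).
move=> {mB}B [[[j t]|t] _ [A mA <-]]; rewrite setTI.
  have mj : measurable_fun setT (m j t) by exact: measurable_funPT.
  by have := mj measurableT A mA; rewrite setTI.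
exact: (bekk_Q_measurable noise).
Qed.

HB.instance Definition _ := isMeasurableFun.Build _ _ _ _ noise_of measurable_noise_of.

Definition noise_dist := distribution Pr noise_of.

Lemma noise_dist_law : noise_law C noise_dist.
Proof.
split=> [[j t]|t|J F JF].
- exact: (bekk_m_normal noise).
- exact: (bekk_Q_normal noise).
rewrite -[LHS]/(Pr (noise_of @^-1` _)) preimage_bigcap.
apply: (bekk_independent noise) => k /JF.
by case: k => [jt|t] [A mA <-]; exists A => //; rewrite !setTI.
Qed.

Lemma ae_noise_of (p : noise_space R d l -> Prop) :
  {ae noise_dist, forall e, p e} -> {ae Pr, forall w, p (noise_of w)}.
Proof.
move=> [N [mN N0 hN]]; exists (noise_of @^-1` N); split.
- by rewrite -[X in measurable X]setTI; exact: measurable_noise_of.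
- exact: N0.
- by move=> w /= h; apply: hN.
Qed.

End NoiseOf.

Lemma path_borel_preimage (R : realType) (d : nat) (K U : Type) (S : set_system U)
    (f : U -> K -> 'cV[R]_d) : sigma_algebra setT S ->
  (forall k B, vec_borel B -> S [set u | B (f u k)]) ->
  forall B, path_borel B -> S [set u | B (f u)].
Proof.
move=> sS fS; apply: preimage_g_sigma => // B [k _ [A vA <-]].
by rewrite setTI; exact: fS.
Qed.

Section Uniqueness.
Context (dT : measure_display) (T : measurableType dT) (R : realType).
Variable Pr : probability T R.
Variables (d : nat) (P : 'M[R]_d).

Lemma tail_to_0 (f : T -> R) (e : R) : measurable_fun setT f -> 0 < e ->
  exists2 M : R, 0 < M & (Pr [set w | (M < `|f w|)%R] <= e%:E)%E.
Proof.
move=> mf e0; pose F (n : nat) := [set w | n.+1%:R < `|f w|].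
have mF n : measurable (F n) by apply: measurable_gtr; exact: measurableT_comp.
have cF : Pr (F n) @[n --> \oo] --> Pr (\bigcap_n F n).
  apply: nonincreasing_cvg_mu => //.
  - by rewrite ltey_eq fin_num_measure.
  - exact: bigcapT_measurable.
  - move=> n k nk; apply/subsetPset => w /=; apply: le_lt_trans.
    by rewrite ler_nat.
have F0 : \bigcap_n F n = set0.
  apply/seteqP; split => // w Fw.
  have := Fw (Num.truncn `|f w|) I; rewrite /F/= ltNge => /negP; apply.
  by rewrite ltW// truncnS_gt.
rewrite F0 measure0 in cF.
have /fine_cvgP[_ /cvgrPdist_le /(_ e e0)[n _ /(_ n (leqnn n))]] := cF.
rewrite /= sub0r normrN ger0_norm ?fine_ge0// => hn.
exists n.+1%:R; first by rewrite ltr0n.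
have E : Pr (F n) = (fine (Pr (F n)))%:E by rewrite fineK// fin_num_measure.
by rewrite -/(F n) E lee_fin.
Qed.

Lemma vec_borel_row (i : 'I_d) (B : set R) : measurable B ->
  vec_borel [set x : 'cV[R]_d | B ((P *m x) i 0)].
Proof.
move=> mB.
pose V := g_sigma_algebraType (\bigcup_(i : 'I_d)
  preimage_set_system setT (fun x : 'cV[R]_d => x i 0) (measurable : set (set R))).
have mc j : measurable_fun setT (fun x : V => (x : 'cV[R]_d) j 0).
  by move=> _ A mA; rewrite setTI; exact: (vec_borel_coord j mA).
have mP : measurable_fun setT (fun x : V => \sum_j P i j * (x : 'cV[R]_d) j 0).
  by apply: measurable_sum => j; exact: measurable_funM.
have := mP measurableT B mB; rewrite setTI.
rewrite (_ : _ @^-1` B = [set x : 'cV[R]_d | B ((P *m x) i 0)])//.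
by apply/seteqP; split => x /=; rewrite mxE.
Qed.

Lemma random_vector_row (Y : T -> 'cV[R]_d) i : random_vector Y ->
  measurable_fun setT (fun w => (P *m Y w) i 0).
Proof.
move=> rY _ B mB; rewrite setTI.
exact: (rY _ (vec_borel_row i mB)).
Qed.

Lemma stationary_tight (X : int -> T -> 'cV[R]_d) i (e : R) :
  (forall t, random_vector (X t)) -> strictly_stationary Pr X -> 0 < e ->
  exists2 M : R, 0 < M & forall t,
    (Pr [set w | (M < `|(P *m X t w) i 0|)%R] <= e%:E)%E.
Proof.
move=> rX sX e0.
have [M M0 hM] := tail_to_0 (random_vector_row i (rX 0)) e0.
exists M => // t; apply: le_trans hM; rewrite le_eqVlt; apply/orP; left; apply/eqP.
have mM : measurable [set z : R | M < `|z|] by apply: measurable_gtr.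
have pB : path_borel [set x : 'I_1 -> 'cV[R]_d | M < `|(P *m x ord0) i 0|].
  apply: sub_sigma_algebra; exists ord0 => //.
  exists [set x : 'cV[R]_d | M < `|(P *m x) i 0|]; first exact: (vec_borel_row i mM).
  by rewrite setTI.
have := sX 1 (fun=> 0) t _ pB.
by rewrite /= add0r.
Qed.

End Uniqueness.

Section Transport.
Context (dT : measure_display) (T : measurableType dT) (R : realType).
Variable Pr : probability T R.
Variables (d l : nat) (C : 'M[R]_d).
Variables (m : 'I_l -> int -> {RV Pr >-> R}) (Q : int -> T -> 'cV[R]_d).
Hypotheses (noise : bekk_noise C m Q) (C_posdef : posdefmx C).
Variables (A D : 'I_l -> 'M[R]_d) (P : 'M[R]_d).
Hypotheses (P_unit : P \in unitmx) (D_diag : forall j, is_diag_mx (D j)).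
Hypothesis D_def : forall j, D j = P *m A j *m invmx P.
Variable alphaY : 'I_d -> R.
Hypothesis alphaY_gt0 : forall i, 0 < alphaY i.

Local Notation mu := (noise_dist noise).
Local Notation N := (noise_of m Q).

Hypothesis alphaY_moment : forall i t, amoment mu (alphaY i) (diag_mult D i t) = 1%E.

Let muP : noise_law C mu := noise_dist_law noise.

Definition bekk_process t w : 'cV[R]_d := path_solution P D t (N w).

Let mX := measurable_path_solution P D.

Lemma bekk_process_solution : bekk_solution A m Q bekk_process.
Proof.
split=> t.
  apply/random_vectorP => i.
  exact: (measurableT_comp (mX t i) (measurable_noise_of noise)).
exact: (ae_noise_of (path_solution_rec muP C_posdef P_unit alphaY_gt0 alphaY_moment
  D_diag D_def t)).
Qed.

Let path_solution_borel (K : Type) (s : K -> int) (B : set (K -> 'cV[R]_d)) :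
  path_borel B ->
  measurable ([set e | B (fun k => path_solution P D (s k) e)] : set (noise_space R d l)).
Proof.
apply: (path_borel_preimage (S := (measurable : set_system (noise_space R d l)))
  (f := fun e k => path_solution P D (s k) e)); first exact: sigma_algebra_measurable.
move=> k {}B; have rX : random_vector (path_solution P D (s k) : noise_space R d l -> _).
  by apply/random_vectorP => i; exact: mX.
exact: rX.
Qed.

Lemma bekk_process_stationary : strictly_stationary Pr bekk_process.
Proof.
move=> n t h B pB.
apply: etrans (noise_law_shift muP h (path_solution_borel t pB)).
rewrite -[RHS]/(Pr [set w | B (fun k => path_solution P D (t k) (noise_shift h (N w)))]).
congr (Pr _); apply/funext => w; congr (B _).
by apply/funext => k; exact: path_solution_shift.
Qed.

Lemma bekk_process_ergodic : ergodic_process Pr bekk_process.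
Proof.
move=> B pB BE.
apply: (shift_invariant_01 muP (path_solution_borel id pB)).
rewrite -[in RHS]BE; apply/funext => e; rewrite /preimage/=; congr (B _).
by apply/funext => t; rewrite path_solution_shift.
Qed.

Section TwoSolutions.
Variables X X' : int -> T -> 'cV[R]_d.
Hypotheses (solX : bekk_solution A m Q X) (solX' : bekk_solution A m Q X').
Hypotheses (statX : strictly_stationary Pr X) (statX' : strictly_stationary Pr X').

Let delta i t w := (P *m X' t w) i 0 - (P *m X t w) i 0.

Let delta_step i t :
  {ae Pr, forall w, delta i t w = diag_mult D i t (N w) * delta i (t - 1) w}.
Proof.
have [_ /(_ t) hX] := solX; have [_ /(_ t) hX'] := solX'.
apply: filterS2 hX hX' => w E E'; rewrite /delta E E'.
rewrite -[Q t w]/((N w).2 t) -[bekk_M A m t w]/(\sum_j (N w).1 (j, t) *: A j).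
by rewrite !(diag_step P_unit D_diag D_def) mulrBr opprD addrACA subrr addr0.
Qed.

Let delta_iter i t k : {ae Pr, forall w,
  delta i t w = rterm (diag_mult D i ^~ (N w)) (cst 1) t k * delta i (t - k%:Z) w}.
Proof.
suff h : {ae Pr, forall w,
    delta i t w = rterm (diag_mult D i ^~ (N w)) (delta i ^~ w) t k}.
  by apply: filterS h => w ->; exact: (rtermM _ (delta i ^~ w)).
elim: k t => [|k IH] t; first by apply: filterE.
by apply: filterS2 (delta_step i t) (IH (t - 1)) => w -> /= ->.
Qed.

Let mdelta i t : measurable_fun setT (delta i t).
Proof.
have [rX _] := solX; have [rX' _] := solX'.
by apply: measurable_funB; exact: random_vector_row.
Qed.

Let delta_small i t (x e : R) : 0 < x -> 0 < e ->
  (Pr [set w | (x < `|delta i t w|)%R] <= e%:E)%E.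
Proof.
move=> x0 e0; have e3 : 0 < e / 3 by rewrite divr_gt0.
have [rX _] := solX; have [rX' _] := solX'.
have [M M0 hM] := stationary_tight P i rX statX e3.
have [M' M0' hM'] := stationary_tight P i rX' statX' e3.
have MM : 0 < M + M' by rewrite addr_gt0.
have xM : 0 < x / (M + M') by rewrite divr_gt0.
have [k hk] := mult_product_small muP alphaY_gt0 alphaY_moment i xM e3.
pose s := t - k%:Z.
pose S1 := [set w | M < `|(P *m X s w) i 0|].
pose S2 := [set w | M' < `|(P *m X' s w) i 0|].
pose S3 := [set w | x / (M + M') < `|rterm (diag_mult D i ^~ (N w)) (cst 1) t k|].
have mS1 : measurable S1.
  by apply: measurable_gtr; apply: measurableT_comp => //; exact: random_vector_row.
have mS2 : measurable S2.
  by apply: measurable_gtr; apply: measurableT_comp => //; exact: random_vector_row.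
have mr : measurable_fun setT (fun e => rterm (diag_mult D i ^~ e) (cst 1) t k).
  apply: (measurable_rterm (t0 := t)) => // r _; exact: measurable_comb.
have mS3 : measurable S3.
  apply: measurable_gtr; apply: measurableT_comp => //.
  exact: (measurableT_comp mr (measurable_noise_of noise)).
have mS12 : measurable (S1 `|` S2) by exact: measurableU.
apply: (@le_trans _ _ (Pr ((S1 `|` S2) `|` S3))).
  apply: le_measure_ae.
  - by apply: measurable_gtr; exact: measurableT_comp.
  - exact: measurableU.
  apply: filterS (delta_iter i t k) => w E xd; rewrite /= E in xd.
  have [h1|h1] := ltP M `|(P *m X s w) i 0|; first by left; left.
  have [h2|h2] := ltP M' `|(P *m X' s w) i 0|; first by left; right.
  right; rewrite /S3/= ltr_pdivrMr//; apply: lt_le_trans xd _.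
  rewrite normrM ler_wpM2l//; apply: le_trans (ler_normB _ _) _.
  by rewrite addrC lerD.
apply: le_trans (measureU2 _ mS12 mS3) _.
apply: (@le_trans _ _ ((e / 3)%:E + (e / 3)%:E + (e / 3)%:E)%E); last first.
  by rewrite -!EFinD lee_fin; lra.
apply: leeD; last exact: hk.
apply: le_trans (measureU2 _ mS1 mS2) _; apply: leeD; [exact: hM|exact: hM'].
Qed.

Let delta_ae0 i t : {ae Pr, forall w, delta i t w = 0}.
Proof.
have h n : {ae Pr, forall w, `|delta i t w| <= n.+1%:R^-1}.
  exists [set w | n.+1%:R^-1 < `|delta i t w|]; split.
  - by apply: measurable_gtr; exact: measurableT_comp.
  - apply/eqP; rewrite eq_le measure_ge0 andbT; apply/lee_addgt0Pr => e e0.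
    by rewrite add0e; apply: delta_small; rewrite // invr_gt0 ltr0n.
  - by move=> w /= /negP; rewrite -ltNge.
apply: filterS (ae_foralln h) => w hw; apply/eqP; rewrite -normr_le0.
apply/ler_addgt0Pr => e e0; rewrite add0r.
have := hw (Num.truncn e^-1); move=> /le_trans; apply.
rewrite invf_ple ?posrE ?ltr0n//; exact/ltW/truncnS_gt.
Qed.

(** The difference of two solutions is multiplied by a long product of
multipliers, which tends to 0 in probability, while the law of each stationary
solution is the same at all times. *)
Lemma bekk_solution_unique : {ae Pr, forall w, forall t, X' t w = X t w}.
Proof.
have h t : {ae Pr, forall w, X' t w = X t w}.
  have : {ae Pr, forall w, forall i, delta i t w = 0}.
    by apply: filter_forall => i; exact: delta_ae0.
  apply: filterS => w hw; apply: (can_inj (mulKmx P_unit)); apply/colP => i.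
  by apply/eqP; rewrite -subr_eq0; apply/eqP; exact: hw.
have hn n : {ae Pr, forall w, X' (Posz n) w = X (Posz n) w /\ X' (Negz n) w = X (Negz n) w}.
  by apply: filterS2 (h (Posz n)) (h (Negz n)) => w.
by apply: filterS (ae_foralln hn) => w hw [n|n]; have [] := hw n.
Qed.

End TwoSolutions.
End Transport.

Theorem theorem5p3 (dT : measure_display) (T : measurableType dT)
    (R : realType) (Pr : probability T R)
    (d l : nat) (d_ge1 : (1 <= d)%N) (l_ge1 : (1 <= l)%N)
    (C : 'M[R]_d) (C_posdef : posdefmx C)
    (A : 'I_l -> 'M[R]_d)
    (m : 'I_l -> int -> {RV Pr >-> R}) (Q : int -> T -> 'cV[R]_d)
    (noise : bekk_noise C m Q)
    (P : 'M[R]_d) (D : 'I_l -> 'M[R]_d)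
    (P_unit : P \in unitmx)
    (D_diag : forall j, is_diag_mx (D j))
    (D_def : forall j, D j = P *m A j *m invmx P)
    (alphaY : 'I_d -> R)
    (alphaY_gt0 : forall i, 0 < alphaY i)
    (alphaY_moment : forall i t,
      ('E_Pr[(fun w => `|\sum_(j < l) D j i i * m j t w| `^ alphaY i)%R] = 1)%E) :
  exists X : int -> T -> 'cV[R]_d,
    [/\ bekk_solution A m Q X,
        strictly_stationary Pr X,
        ergodic_process Pr X,
        forall X' : int -> T -> 'cV[R]_d,
          bekk_solution A m Q X' -> strictly_stationary Pr X' ->
          {ae Pr, forall w, forall t, X' t w = X t w} &
        forall (i : 'I_d) (a : R),
          tail_indices P alphaY i a ->
          lbound (tail_indices P alphaY i) a ->
          (exists! j : 'I_d, invmx P i j != 0 /\ alphaY j = a) ->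
          forall t, regularly_varying Pr (fun w => X t w i 0) a].
Proof.
have moment i t : amoment (noise_dist noise) (alphaY i) (diag_mult D i t) = 1%E.
  rewrite -(alphaY_moment i t) unlock /amoment ge0_integral_distribution//.
  by apply/measurable_EFinP; apply: measurable_apow; exact: measurable_comb.
have muP := noise_dist_law noise.
have sol := bekk_process_solution C_posdef P_unit D_diag D_def alphaY_gt0 moment.
have stat := bekk_process_stationary noise D P.
exists (bekk_process m Q D P); split => //.
- exact: bekk_process_ergodic noise D P.
- move=> X' sol' stat'.
  exact: (bekk_solution_unique P_unit D_diag D_def alphaY_gt0 moment sol sol' stat stat').
- move=> i a _ lba uniq t.
  exact: (path_solution_regularly_varying muP C_posdef P_unit alphaY_gt0 moment t lba uniq).
Qed.
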